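(* The following provability results hold: \begin{enumerate} \item $\Pi^1_1\text{-}\mathrm{CA}_0\vdash\mathrm{GS}$. \item $\mathrm{ACA}_0\vdash\mathrm{GSD}$. \end{enumerate}
   Context: $\mathrm{RCA}_0$, $\mathrm{ACA}_0$ and $\Pi^1_1\text{-}\mathrm{CA}_0$ are the standard subsystems of second order arithmetic (recursive, arithmetical and $\Pi^1_1$ comprehension). $\mathrm{GS}$ (Grätzer–Schmidt) consists of $\mathrm{RCA}_0$ plus the axiom: for each (countable) algebraic lattice $L$ there exist (1) a (countable) algebra $\mathfrak A$, (2) a set $\{E_i\}_{i\in\omega}$ of congruences of $\mathfrak A$ such that each congruence of $\mathfrak A$ is one of the $E_i$, and (3) an isomorphism $\varphi$ between $L$ and $\{E_i\}_{i\in\omega}$ (ordered by inclusion). $\mathrm{GSD}$ is the Grätzer–Schmidt theorem for distributive lattices, i.e. every distributive algebraic lattice is isomorphic to the congruence lattice of an algebra, formalized as in $\mathrm{GS}$ with $L$ restricted to distributive lattices. An algebra $\mathfrak A$ consists of a set $A$ and functions $f_i:A^{n_i}\to A$, $i\in I$, where the index set $I$ may be finite or infinite. A congruence of $\mathfrak A$ is an equivalence relation on $A$ compatible with all the $f_i$. A lattice is complete if every subset has a supremum and an infimum; an element $a\in L$ is compact if for each $S\subseteq L$, if $a\preceq\sup S$ then $a\preceq\sup S'$ for some finite $S'\subseteq S$; a lattice is algebraic if it is complete and every element is the supremum of a set of compact elements. *)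

(* Defs.v *)
From Stdlib Require Import List.
Import ListNotations.

Set Implicit Arguments.

(** * The language of second order arithmetic

    Two-sorted first order syntax in de Bruijn style.  Number variables and
    set variables are indexed independently: [AllNum] binds number variable 0 and
    [AllSet] binds set variable 0.  Equality of sets is not primitive. *)

Inductive term : Type :=
| Var (n : nat)
| Zero
| One
| Plus (s t : term)
| Times (s t : term).

Inductive form : Type :=
| Bot
| Eq (s t : term)
| Lt (s t : term)
| Mem (t : term) (X : nat)
| Imp (p q : form)
| AllNum (p : form)
| AllSet (p : form).

(* The logic is classical, so the remaining connectives are abbreviations. *)
Definition Neg (p : form) : form := Imp p Bot.
Definition And (p q : form) : form := Neg (Imp p (Neg q)).
Definition Or (p q : form) : form := Imp (Neg p) q.
Definition Iff (p q : form) : form := And (Imp p q) (Imp q p).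
Definition ExNum (p : form) : form := Neg (AllNum (Neg p)).
Definition ExSet (p : form) : form := Neg (AllSet (Neg p)).

Fixpoint subst_term (sigma : nat -> term) (t : term) : term :=
  match t with
  | Var n => sigma n
  | Zero => Zero
  | One => One
  | Plus s t => Plus (subst_term sigma s) (subst_term sigma t)
  | Times s t => Times (subst_term sigma s) (subst_term sigma t)
  end.

Definition shift_term (t : term) : term := subst_term (fun n => Var (S n)) t.

Definition up_num (sigma : nat -> term) (n : nat) : term :=
  match n with 0 => Var 0 | S n => shift_term (sigma n) end.

Definition up_set (tau : nat -> nat) (n : nat) : nat :=
  match n with 0 => 0 | S n => S (tau n) end.

(* Simultaneous substitution: number variables by terms, set variables by set
   variables (the only set terms of the language). *)
Fixpoint subst (sigma : nat -> term) (tau : nat -> nat) (p : form) : form :=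
  match p with
  | Bot => Bot
  | Eq s t => Eq (subst_term sigma s) (subst_term sigma t)
  | Lt s t => Lt (subst_term sigma s) (subst_term sigma t)
  | Mem t X => Mem (subst_term sigma t) (tau X)
  | Imp p q => Imp (subst sigma tau p) (subst sigma tau q)
  | AllNum p => AllNum (subst (up_num sigma) tau p)
  | AllSet p => AllSet (subst sigma (up_set tau) p)
  end.

Definition shift_num (p : form) : form := subst (fun n => Var (S n)) (fun X => X) p.
Definition shift_set (p : form) : form := subst Var S p.

Definition inst_num (p : form) (t : term) : form :=
  subst (fun n => match n with 0 => t | S n => Var n end) (fun X => X) p.
Definition inst_set (p : form) (Y : nat) : form :=
  subst Var (fun X => match X with 0 => Y | S X => X end) p.

(* [p(x + 1)] where x is number variable 0, which stays free *)
Definition at_succ (p : form) : form :=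
  subst (fun n => match n with 0 => Plus (Var 0) One | S n => Var (S n) end)
        (fun X => X) p.

(** * Provability

    Classical natural deduction with equality.  The rules introducing a
    universal quantifier shift the local hypotheses [G] but not the axioms in
    [T]; thus free variables of an axiom may be generalized, i.e. each axiom
    stands for its universal closure. *)

Definition theory : Type := form -> Prop.

Inductive prv (T : theory) : list form -> form -> Prop :=
| prv_axiom G p : T p -> prv T G p
| prv_hyp G p : In p G -> prv T G p
| prv_ImpI G p q : prv T (p :: G) q -> prv T G (Imp p q)
| prv_ImpE G p q : prv T G (Imp p q) -> prv T G p -> prv T G q
| prv_raa G p : prv T (Neg p :: G) Bot -> prv T G p
| prv_AllNumI G p : prv T (map shift_num G) p -> prv T G (AllNum p)
| prv_AllNumE G p t : prv T G (AllNum p) -> prv T G (inst_num p t)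
| prv_AllSetI G p : prv T (map shift_set G) p -> prv T G (AllSet p)
| prv_AllSetE G p Y : prv T G (AllSet p) -> prv T G (inst_set p Y)
| prv_Eq_refl G t : prv T G (Eq t t)
| prv_Eq_subst G p s t :
    prv T G (Eq s t) -> prv T G (inst_num p s) -> prv T G (inst_num p t).

Definition proves (T : theory) (p : form) : Prop := prv T [] p.

Definition proves_theory (T U : theory) : Prop := forall p, U p -> proves T p.

(** * Writing closed formulas with Rocq binders

    A term (set, formula) under construction is a function of the number of
    enclosing number (resp. set, resp. number and set) quantifiers.  A bound
    variable remembers the depth at which it was bound, from which its de Bruijn
    index at the place of use is computed. *)

Definition tm : Type := nat -> term.
Definition st : Type := nat -> nat.
Definition fm : Type := nat -> nat -> form.

Declare Scope fm_scope.
Delimit Scope fm_scope with fm.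
Bind Scope fm_scope with fm.
Declare Scope tm_scope.
Delimit Scope tm_scope with tm.
Bind Scope tm_scope with tm.

Definition closed (p : fm) : form := p 0 0.

Definition tvar (n : nat) : tm := fun d => Var (d - S n).
Definition svar (n : nat) : st := fun e => e - S n.

Definition f_allN (p : tm -> fm) : fm := fun d e => AllNum (p (tvar d) (S d) e).
Definition f_exN (p : tm -> fm) : fm := fun d e => ExNum (p (tvar d) (S d) e).
Definition f_allS (p : st -> fm) : fm := fun d e => AllSet (p (svar e) d (S e)).
Definition f_exS (p : st -> fm) : fm := fun d e => ExSet (p (svar e) d (S e)).

Definition t_zero : tm := fun _ => Zero.
Definition t_one : tm := fun _ => One.
Definition t_plus (s t : tm) : tm := fun d => Plus (s d) (t d).
Definition t_times (s t : tm) : tm := fun d => Times (s d) (t d).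

Definition f_bot : fm := fun _ _ => Bot.
Definition f_eq (s t : tm) : fm := fun d _ => Eq (s d) (t d).
Definition f_lt (s t : tm) : fm := fun d _ => Lt (s d) (t d).
Definition f_mem (t : tm) (X : st) : fm := fun d e => Mem (t d) (X e).
Definition f_neg (p : fm) : fm := fun d e => Neg (p d e).
Definition f_and (p q : fm) : fm := fun d e => And (p d e) (q d e).
Definition f_or (p q : fm) : fm := fun d e => Or (p d e) (q d e).
Definition f_imp (p q : fm) : fm := fun d e => Imp (p d e) (q d e).
Definition f_iff (p q : fm) : fm := fun d e => Iff (p d e) (q d e).

Notation "0" := t_zero : tm_scope.
Notation "1" := t_one : tm_scope.
Notation "s + t" := (t_plus s t) : tm_scope.
Notation "s * t" := (t_times s t) : tm_scope.

Notation "⊥" := f_bot : fm_scope.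
Notation "s = t" := (f_eq s%tm t%tm) : fm_scope.
Notation "s < t" := (f_lt s%tm t%tm) : fm_scope.
Notation "t ∈ X" := (f_mem t%tm X) (at level 70) : fm_scope.
Notation "~ p" := (f_neg p) : fm_scope.
Notation "p /\ q" := (f_and p q) : fm_scope.
Notation "p \/ q" := (f_or p q) : fm_scope.
Notation "p -> q" := (f_imp p q) : fm_scope.
Notation "p <-> q" := (f_iff p q) : fm_scope.
Notation "∀ x .. y , p" := (f_allN (fun x => .. (f_allN (fun y => p%fm)) ..))
  (at level 200, x binder, y binder, right associativity) : fm_scope.
Notation "∃ x .. y , p" := (f_exN (fun x => .. (f_exN (fun y => p%fm)) ..))
  (at level 200, x binder, y binder, right associativity) : fm_scope.
Notation "∀₂ X .. Y , p" := (f_allS (fun X => .. (f_allS (fun Y => p%fm)) ..))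
  (at level 200, X binder, Y binder, right associativity) : fm_scope.
Notation "∃₂ X .. Y , p" := (f_exS (fun X => .. (f_exS (fun Y => p%fm)) ..))
  (at level 200, X binder, Y binder, right associativity) : fm_scope.
Notation "∀ₑ x ∈ X , p" := (f_allN (fun x => f_imp (f_mem x X) p%fm))
  (at level 200, x name, X at level 69, right associativity) : fm_scope.
Notation "∃ₑ x ∈ X , p" := (f_exN (fun x => f_and (f_mem x X) p%fm))
  (at level 200, x name, X at level 69, right associativity) : fm_scope.

(** * Subsystems of second order arithmetic (after Simpson, Chapter I) *)

(* A bounded quantifier binds number variable 0; its bound [t] is a term in
   which that variable does not occur, hence the shift. *)
Inductive bounded : form -> Prop :=
| bounded_Bot : bounded Bot
| bounded_Eq s t : bounded (Eq s t)
| bounded_Lt s t : bounded (Lt s t)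
| bounded_Mem t X : bounded (Mem t X)
| bounded_Imp p q : bounded p -> bounded q -> bounded (Imp p q)
| bounded_All t p : bounded p -> bounded (AllNum (Imp (Lt (Var 0) (shift_term t)) p))
| bounded_Ex t p : bounded p -> bounded (ExNum (And (Lt (Var 0) (shift_term t)) p)).

Definition Sigma01 (p : form) : Prop := exists q, bounded q /\ p = ExNum q.
Definition Pi01 (p : form) : Prop := exists q, bounded q /\ p = AllNum q.

Fixpoint arithmetical (p : form) : Prop :=
  match p with
  | Bot | Eq _ _ | Lt _ _ | Mem _ _ => True
  | Imp p q => arithmetical p /\ arithmetical q
  | AllNum p => arithmetical p
  | AllSet _ => False
  end.

Definition Pi11 (p : form) : Prop := exists q, arithmetical q /\ p = AllSet q.

Inductive basic_axiom : theory :=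
| basic_succ_neq0 : basic_axiom (closed (∀ m, ~ (m + 1 = 0)))
| basic_succ_inj : basic_axiom (closed (∀ m n, m + 1 = n + 1 -> m = n))
| basic_plus0 : basic_axiom (closed (∀ m, m + 0 = m))
| basic_plusS : basic_axiom (closed (∀ m n, m + (n + 1) = (m + n) + 1))
| basic_times0 : basic_axiom (closed (∀ m, m * 0 = 0))
| basic_timesS : basic_axiom (closed (∀ m n, m * (n + 1) = (m * n) + m))
| basic_lt0 : basic_axiom (closed (∀ m, ~ (m < 0)))
| basic_ltS : basic_axiom (closed (∀ m n, m < n + 1 <-> (m < n \/ m = n))).

Definition induction_axiom : form :=
  closed (∀₂ X, 0 ∈ X /\ (∀ n, n ∈ X -> n + 1 ∈ X) -> ∀ n, n ∈ X).

(* In the schemes, number variable 0 of [p] is the displayed variable n; the other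
   free variables of [p] are parameters. *)
Definition induction_for (p : form) : form :=
  Imp (And (inst_num p Zero) (AllNum (Imp p (at_succ p)))) (AllNum p).

(* ∃X ∀n (n ∈ X <-> p(n)); the shift ensures that X is not free in [p] *)
Definition comprehension_for (p : form) : form :=
  ExSet (AllNum (Iff (Mem (Var 0) 0) (shift_set p))).

Inductive RCA0 : theory :=
| RCA0_basic p : basic_axiom p -> RCA0 p
| RCA0_induction p : Sigma01 p -> RCA0 (induction_for p)
| RCA0_comp p q : Sigma01 p -> Pi01 q ->
    RCA0 (Imp (AllNum (Iff p q)) (comprehension_for p)).

Inductive ACA0 : theory :=
| ACA0_basic p : basic_axiom p -> ACA0 p
| ACA0_induction : ACA0 induction_axiom
| ACA0_comp p : arithmetical p -> ACA0 (comprehension_for p).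

Inductive Pi11CA0 : theory :=
| Pi11CA0_basic p : basic_axiom p -> Pi11CA0 p
| Pi11CA0_induction : Pi11CA0 induction_axiom
| Pi11CA0_comp p : Pi11 p -> Pi11CA0 (comprehension_for p).

(* Simpson's pairing function; being a polynomial, it is a term of the language. *)
Definition t_pair (x y : tm) : tm := ((x + y) * (x + y) + x)%tm.

(* A definable class of numbers, possibly not (known to be) a set. *)
Definition cls : Type := tm -> fm.

Definition f_subset (X Y : cls) : fm := (∀ n, X n -> Y n)%fm.
Definition f_same (X Y : cls) : fm := (∀ n, X n <-> Y n)%fm.

Definition f_set (X : st) : cls := fun n => (n ∈ X)%fm.
(* The i-th member of the sequence of sets coded by E. *)
Definition f_col (E : st) (i : tm) : cls := fun n => (t_pair i n ∈ E)%fm.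

Definition f_finite (X : st) : fm := (∃ k, ∀ₑ i ∈ X, i < k)%fm.

(* Gödel's beta function: y is the remainder of a modulo (i + 1) b + 1. *)
Definition f_beta (a b i y : tm) : fm :=
  (y < (i + 1) * b + 1 /\ ∃ q, a = q * ((i + 1) * b + 1) + y)%fm.

(* s codes a sequence of length n.  Minimality of the beta-code makes the code
   of each finite sequence unique. *)
Definition f_seq (n s : tm) : fm :=
  (∃ a b, s = t_pair n (t_pair a b) /\
     ∀ a' b', t_pair a' b' < t_pair a b ->
       ∃ i, i < n /\ ∃ y, f_beta a b i y /\ ~ f_beta a' b' i y)%fm.

(* y is the i-th entry of the sequence coded by s *)
Definition f_entry (s i y : tm) : fm :=
  (∃ n a b, s = t_pair n (t_pair a b) /\ i < n /\ f_beta a b i y)%fm.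

(* s ∈ A^n *)
Definition f_seq_in (A : st) (n s : tm) : fm :=
  (f_seq n s /\ ∀ i y, f_entry s i y -> y ∈ A)%fm.

(** * Lattices

    A countable ordered set is a set L of numbers with a set R of (codes of)
    pairs. *)

Section Order.
Variables L R : st.

Definition f_le (x y : tm) : fm := (t_pair x y ∈ R)%fm.

Definition f_poset : fm :=
  ((∀ₑ x ∈ L, f_le x x) /\
   (∀ₑ x ∈ L, ∀ₑ y ∈ L, f_le x y -> f_le y x -> x = y) /\
   (∀ₑ x ∈ L, ∀ₑ y ∈ L, ∀ₑ z ∈ L, f_le x y -> f_le y z -> f_le x z))%fm.

Definition f_is_sup (X : cls) (x : tm) : fm :=
  (x ∈ L /\ (∀ s, X s -> f_le s x) /\
   ∀ₑ u ∈ L, (∀ s, X s -> f_le s u) -> f_le x u)%fm.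

Definition f_is_inf (X : cls) (x : tm) : fm :=
  (x ∈ L /\ (∀ s, X s -> f_le x s) /\
   ∀ₑ u ∈ L, (∀ s, X s -> f_le u s) -> f_le u x)%fm.

Definition f_is_join (x y : tm) : tm -> fm := f_is_sup (fun s => s = x \/ s = y)%fm.
Definition f_is_meet (x y : tm) : tm -> fm := f_is_inf (fun s => s = x \/ s = y)%fm.

Definition f_lattice : fm :=
  (f_poset /\
   ∀ₑ x ∈ L, ∀ₑ y ∈ L, (∃ z, f_is_join x y z) /\ (∃ z, f_is_meet x y z))%fm.

Definition f_complete : fm :=
  (∀₂ X, f_subset (f_set X) (f_set L) ->
     (∃ x, f_is_sup (f_set X) x) /\ (∃ x, f_is_inf (f_set X) x))%fm.

Definition f_compact (a : tm) : fm :=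
  (a ∈ L /\
   ∀₂ X, f_subset (f_set X) (f_set L) ->
     ∀ x, f_is_sup (f_set X) x -> f_le a x ->
       ∃₂ Y, f_finite Y /\ f_subset (f_set Y) (f_set X) /\
         ∃ y, f_is_sup (f_set Y) y /\ f_le a y)%fm.

Definition f_algebraic : fm :=
  (f_lattice /\ f_complete /\
   ∀ₑ x ∈ L, ∃₂ X, (∀ₑ c ∈ X, f_compact c) /\ f_is_sup (f_set X) x)%fm.

Definition f_distributive : fm :=
  (∀ₑ x ∈ L, ∀ₑ y ∈ L, ∀ₑ z ∈ L, ∀ yz xyz xy xz,
     f_is_join y z yz -> f_is_meet x yz xyz ->
     f_is_meet x y xy -> f_is_meet x z xz ->
     f_is_join xy xz xyz)%fm.

End Order.

(** * Algebras and congruences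

    An algebra is given by its universe A, its index set I, the set N of pairs
    (i, n_i) of indices and arities, and the set F of all ((i, s), f_i(s)) with
    i ∈ I and s a code of an element of A^(n_i). *)

Section Algebra.
Variables A I N F : st.

Definition f_algebra : fm :=
  ((∀ₑ i ∈ I, ∃ n, t_pair i n ∈ N /\ ∀ m, t_pair i m ∈ N -> m = n) /\
   (∀ₑ i ∈ I, ∀ n s, t_pair i n ∈ N -> f_seq_in A n s ->
      ∃ y, y ∈ A /\ t_pair (t_pair i s) y ∈ F /\
        ∀ z, t_pair (t_pair i s) z ∈ F -> z = y))%fm.

Definition f_congruence (X : cls) : fm :=
  ((∀ n, X n -> ∃ a b, a ∈ A /\ b ∈ A /\ n = t_pair a b) /\
   (∀ₑ a ∈ A, X (t_pair a a)) /\
   (∀ a b, X (t_pair a b) -> X (t_pair b a)) /\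
   (∀ a b c, X (t_pair a b) -> X (t_pair b c) -> X (t_pair a c)) /\
   (∀ₑ i ∈ I, ∀ n s t y z, t_pair i n ∈ N ->
      f_seq_in A n s -> f_seq_in A n t ->
      (∀ j u v, f_entry s j u -> f_entry t j v -> X (t_pair u v)) ->
      t_pair (t_pair i s) y ∈ F -> t_pair (t_pair i t) z ∈ F ->
      X (t_pair y z)))%fm.

End Algebra.

(* P is (the graph of) an isomorphism from (L, R) onto the family of the sets E_i
   ordered by inclusion.  The family may have repetitions, so a value E_i is
   represented by any one of its indices. *)
Definition f_isomorphism (L R E P : st) : fm :=
  ((∀ₑ x ∈ L, ∃ i, t_pair x i ∈ P /\ ∀ j, t_pair x j ∈ P -> j = i) /\
   (∀ₑ x ∈ L, ∀ₑ y ∈ L, ∀ i j, t_pair x i ∈ P -> t_pair y j ∈ P ->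
      (f_le R x y <-> f_subset (f_col E i) (f_col E j))) /\
   (∀ i, ∃ₑ x ∈ L, ∃ j, t_pair x j ∈ P /\ f_same (f_col E i) (f_col E j)))%fm.

Definition f_representable (L R : st) : fm :=
  (∃₂ A I N F, f_algebra A I N F /\
     ∃₂ E, (∀ i, f_congruence A I N F (f_col E i)) /\
       (∀₂ X, f_congruence A I N F (f_set X) -> ∃ i, f_same (f_set X) (f_col E i)) /\
       ∃₂ P, f_isomorphism L R E P)%fm.

Definition GS_axiom : form :=
  closed (∀₂ L R, f_algebraic L R -> f_representable L R).

Definition GSD_axiom : form :=
  closed (∀₂ L R, f_algebraic L R /\ f_distributive L R -> f_representable L R).

Definition GS : theory := fun p => RCA0 p \/ p = GS_axiom.
Definition GSD : theory := fun p => RCA0 p \/ p = GSD_axiom.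

(* Main.v *)
Require Import Defs.
From Stdlib Require Import List Arith Lia Ring Cantor.
From Stdlib Require Import Classical ClassicalEpsilon FunctionalExtensionality
  PropExtensionality.
Import ListNotations.

(** Provability is reduced to truth: by [completeness] it is enough to verify the formulas
    in an arbitrary, possibly nonstandard, model of the theory, where one can argue freely
    as long as sets are formed by arithmetical (or Pi^1_1) comprehension.  Arithmetical
    comprehension is applied through a closure calculus for definable predicates, and
    recursion along numbers is obtained by coding finite derivations as numbers
    ([inductive_definition], [recursion]).

    The first half of the argument shows that the compact elements of the lattice form a
    set.  A finite subset of [X] is contained in an initial segment of [X], so compactness is
    a Pi^1_1 condition ([compact_iff]); this settles the first theory.  In a distributive
    lattice an element [a] is compact iff each element strictly below [a] is below a lower
    cover of [a], which is arithmetical.  A compact element has these covers because a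
    greedy ascending sequence stays away from it in the limit ([compact_coatomic]).
    Conversely, if such an [a] were not compact, there would be an infinite sequence of
    covers of [a] whose subsets could be recovered from their infima; as the elements of the
    lattice are numbers, Cantor's diagonal argument refutes this ([coatomic_compact]).

    The second half needs arithmetical comprehension only and follows an idea of Pudlák.
    Consider a graph whose edges are coloured by the nonzero compact elements, in which each
    edge coloured [a] carries, whenever a <= b \/ g, an ear with the colours b, g, b, g in
    this order; the edges of the ears carry ears again.  An ideal of colours gives the
    equivalence relation of being connected by edges with colours in the ideal, described
    here by representatives of the classes.  The algebra has the vertices of a star of such
    graphs as its elements, and unary operations of three sorts: insertions of a component
    at an edge of an ear, foldings of one ear onto an edge of one of its two colours, and
    retractions onto a component.  A folding sends both ends of the ear, hence all of the
    graph outside, to one vertex; this is why each colour occurs twice in an ear.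
    All the operations respect the equivalence relations ([modulo_congruence]).  Conversely,
    the colours of the edges contracted by a congruence form an ideal, as the ears show, and
    there is no further identification, because distinct representatives are separated by a
    folding onto an edge whose colour is outside of the ideal ([separation],
    [congruence_modulo]).  Since the ideals of compact elements correspond to the elements of
    the lattice, the congruences do ([representable_of_compact_set]). *)

Set Implicit Arguments.

(** * Substitution *)

Lemma subst_term_ext t : forall f g, (forall n, f n = g n) -> subst_term f t = subst_term g t.
Proof. induction t; simpl; intros; auto; f_equal; auto. Qed.

Lemma up_num_ext f g : (forall n, f n = g n) -> forall n, up_num f n = up_num g n.
Proof. intros H [|n]; simpl; auto. now rewrite H. Qed.

Lemma up_set_ext f g : (forall n, f n = g n) -> forall n, up_set f n = up_set g n.
Proof. intros H [|n]; simpl; auto. Qed.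

Lemma subst_ext p : forall f g a b, (forall n, f n = g n) -> (forall n, a n = b n) ->
  subst f a p = subst g b p.
Proof.
  induction p; simpl; intros; f_equal; auto using subst_term_ext, up_num_ext, up_set_ext.
Qed.

Lemma subst_term_comp t : forall f g,
  subst_term g (subst_term f t) = subst_term (fun n => subst_term g (f n)) t.
Proof. induction t; simpl; intros; auto; f_equal; auto. Qed.

Lemma up_num_comp f g n :
  subst_term (up_num g) (up_num f n) = up_num (fun n => subst_term g (f n)) n.
Proof.
  destruct n; simpl; auto. unfold shift_term. rewrite !subst_term_comp. reflexivity.
Qed.

Lemma subst_comp p : forall f g a b,
  subst g b (subst f a p) = subst (fun n => subst_term g (f n)) (fun n => b (a n)) p.
Proof.
  induction p; simpl; intros; f_equal; auto using subst_term_comp.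
  - rewrite IHp. apply subst_ext; auto using up_num_comp.
  - rewrite IHp. apply subst_ext; auto. intros [|n]; reflexivity.
Qed.

Lemma subst_term_id t : subst_term Var t = t.
Proof. induction t; simpl; congruence. Qed.

Lemma subst_id p : forall f a, (forall n, f n = Var n) -> (forall n, a n = n) -> subst f a p = p.
Proof.
  induction p; simpl; intros; f_equal; auto;
    try (rewrite <- subst_term_id; now apply subst_term_ext).
  - apply IHp; auto. intros [|k]; simpl; auto. now rewrite H.
  - apply IHp; auto. intros [|k]; simpl; auto.
Qed.

Lemma subst_inst_num f a p t :
  subst f a (inst_num p t) = inst_num (subst (up_num f) a p) (subst_term f t).
Proof.
  unfold inst_num. rewrite !subst_comp. apply subst_ext; auto.
  intros [|n]; simpl; auto. unfold shift_term.
  rewrite subst_term_comp. symmetry. apply subst_term_id.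
Qed.

Lemma subst_inst_set f a p Y :
  subst f a (inst_set p Y) = inst_set (subst f (up_set a) p) (a Y).
Proof.
  unfold inst_set. rewrite !subst_comp. apply subst_ext.
  - intro n. symmetry. apply subst_term_id.
  - intros [|n]; reflexivity.
Qed.

Lemma subst_shift_num f a p : subst (up_num f) a (shift_num p) = shift_num (subst f a p).
Proof. unfold shift_num. rewrite !subst_comp. now apply subst_ext. Qed.

Lemma subst_shift_set f a p : subst f (up_set a) (shift_set p) = shift_set (subst f a p).
Proof.
  unfold shift_set. rewrite !subst_comp. apply subst_ext; auto.
  intro n. simpl. now rewrite subst_term_id.
Qed.

(** * Derived rules of the calculus *)

Definition subst_closed (T : theory) : Prop := forall f a p, T p -> T (subst f a p).

Lemma prv_weak T G p : prv T G p -> forall G', incl G G' -> prv T G' p.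
Proof.
  induction 1; intros G' HG.
  - now apply prv_axiom.
  - apply prv_hyp; auto.
  - apply prv_ImpI. apply IHprv. intros x [->|Hx]; simpl; auto.
  - eapply prv_ImpE; eauto.
  - apply prv_raa. apply IHprv. intros x [->|Hx]; simpl; auto.
  - apply prv_AllNumI. apply IHprv. now apply incl_map.
  - now apply prv_AllNumE, IHprv.
  - apply prv_AllSetI. apply IHprv. now apply incl_map.
  - now apply prv_AllSetE, IHprv.
  - apply prv_Eq_refl.
  - eapply prv_Eq_subst; eauto.
Qed.

Lemma prv_subst T (HT : subst_closed T) G p : prv T G p ->
  forall f a, prv T (map (subst f a) G) (subst f a p).
Proof.
  induction 1; intros f a; simpl.
  - apply prv_axiom, HT, H.
  - now apply prv_hyp, in_map.
  - apply prv_ImpI. apply IHprv.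
  - eapply prv_ImpE; [apply IHprv1|apply IHprv2].
  - apply prv_raa. apply IHprv.
  - apply prv_AllNumI. specialize (IHprv (up_num f) a). rewrite map_map in *.
    erewrite map_ext; [apply IHprv|]. intro. simpl. now rewrite subst_shift_num.
  - rewrite subst_inst_num. apply prv_AllNumE. apply IHprv.
  - apply prv_AllSetI. specialize (IHprv f (up_set a)). rewrite map_map in *.
    erewrite map_ext; [apply IHprv|]. intro. simpl. now rewrite subst_shift_set.
  - rewrite subst_inst_set. apply prv_AllSetE. apply IHprv.
  - apply prv_Eq_refl.
  - rewrite subst_inst_num in *. eapply prv_Eq_subst; [apply IHprv1|].
    specialize (IHprv2 f a). now rewrite subst_inst_num in IHprv2.
Qed.

Lemma prv_cut T G p q : prv T G p -> prv T (p :: G) q -> prv T G q.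
Proof. intros Hp Hq. eapply prv_ImpE; [apply prv_ImpI, Hq|apply Hp]. Qed.

Lemma prv_exfalso T G p : prv T G Bot -> prv T G p.
Proof. intro H. apply prv_raa. eapply prv_weak; [apply H|]. intros x Hx; now right. Qed.

(** ** Fresh variables *)

(** Every variable free in [p] is below [N], expressed by the behaviour of
    substitutions. *)
Definition vars_below (N : nat) (p : form) : Prop :=
  forall f g a b, (forall n, n < N -> f n = g n) -> (forall n, n < N -> a n = b n) ->
    subst f a p = subst g b p.

Lemma vars_below_ex p : exists N, forall M, N <= M -> vars_below M p.
Proof.
  assert (Ht : forall t, exists N, forall M, N <= M -> forall f g,
             (forall n, n < M -> f n = g n) -> subst_term f t = subst_term g t).
  { induction t as [n| | |s [N1 H1] t [N2 H2]|s [N1 H1] t [N2 H2]]; simpl.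
    - exists (S n). intros; auto with arith.
    - now exists 0.
    - now exists 0.
    - exists (N1 + N2). intros M HM f g E. f_equal.
      + apply (H1 M); auto; lia.
      + apply (H2 M); auto; lia.
    - exists (N1 + N2). intros M HM f g E. f_equal.
      + apply (H1 M); auto; lia.
      + apply (H2 M); auto; lia. }
  induction p as [|s t|s t|t X|p [N1 H1] q [N2 H2]|p [N H]|p [N H]].
  - exists 0. now repeat intro.
  - destruct (Ht s) as [N1 H1], (Ht t) as [N2 H2]. exists (N1 + N2).
    intros M HM f g a b E E'. simpl. f_equal; [apply (H1 M)|apply (H2 M)]; auto; lia.
  - destruct (Ht s) as [N1 H1], (Ht t) as [N2 H2]. exists (N1 + N2).
    intros M HM f g a b E E'. simpl. f_equal; [apply (H1 M)|apply (H2 M)]; auto; lia.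
  - destruct (Ht t) as [N1 H1]. exists (N1 + S X).
    intros M HM f g a b E E'. simpl. f_equal; [apply (H1 M)|apply E']; auto; lia.
  - exists (N1 + N2). intros M HM f g a b E E'. simpl.
    f_equal; [apply (H1 M)|apply (H2 M)]; auto; lia.
  - exists N. intros M HM f g a b E E'. simpl. f_equal. apply (H M); auto.
    intros [|n] Hn; simpl; auto. rewrite E; auto; lia.
  - exists N. intros M HM f g a b E E'. simpl. f_equal. apply (H M); auto.
    intros [|n] Hn; simpl; auto. rewrite E'; auto; lia.
Qed.

Lemma vars_below_list G : exists N, forall M, N <= M -> forall p, In p G -> vars_below M p.
Proof.
  induction G as [|q G [N HN]].
  - exists 0. intros M _ p [].
  - destruct (vars_below_ex q) as [N' HN']. exists (N + N').
    intros M HM p [<-|Hp]; [apply HN'; lia|apply HN; auto; lia].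
Qed.

(** Renaming [x] to the bound variable turns a proof about the fresh [x] into a
    proof of the generic instance. *)
Lemma prv_AllNum_fresh T (HT : subst_closed T) G p x :
  vars_below x p -> (forall q, In q G -> vars_below x q) ->
  prv T G (inst_num p (Var x)) -> prv T G (AllNum p).
Proof.
  intros Hp HG H. apply prv_AllNumI.
  set (f := fun n => if Nat.eq_dec n x then Var 0 else Var (S n)).
  apply prv_subst with (f := f) (a := fun X => X) in H; auto.
  assert (Hf : forall n, n < x -> f n = Var (S n)).
  { intros n Hn. unfold f. destruct (Nat.eq_dec n x); auto; lia. }
  replace (map shift_num G) with (map (subst f (fun X => X)) G).
  - replace (subst f (fun X => X) (inst_num p (Var x))) with p in H; auto.
    unfold inst_num. rewrite subst_comp.
    rewrite <- (@subst_id p Var (fun X => X)) at 1 by auto.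
    apply Hp; auto. intros [|n] Hn; simpl.
    + unfold f. destruct (Nat.eq_dec x x); auto; congruence.
    + symmetry. apply Hf. lia.
  - apply map_ext_in. intros q Hq. unfold shift_num. apply HG; auto.
Qed.

Lemma prv_AllSet_fresh T (HT : subst_closed T) G p x :
  vars_below x p -> (forall q, In q G -> vars_below x q) ->
  prv T G (inst_set p x) -> prv T G (AllSet p).
Proof.
  intros Hp HG H. apply prv_AllSetI.
  set (f := fun n => if Nat.eq_dec n x then 0 else S n).
  apply prv_subst with (f := Var) (a := f) in H; auto.
  assert (Hf : forall n, n < x -> f n = S n).
  { intros n Hn. unfold f. destruct (Nat.eq_dec n x); auto; lia. }
  replace (map shift_set G) with (map (subst Var f) G).
  - replace (subst Var f (inst_set p x)) with p in H; auto.
    unfold inst_set. rewrite subst_comp.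
    rewrite <- (@subst_id p Var (fun X => X)) at 1 by auto.
    apply Hp; auto. intros [|n] Hn; simpl.
    + unfold f. destruct (Nat.eq_dec x x); auto; congruence.
    + symmetry. apply Hf. lia.
  - apply map_ext_in. intros q Hq. unfold shift_set. apply HG; auto.
Qed.

(** * Semantics *)

Record model : Type := {
  num : Type;
  sets : Type;
  m_zero : num;
  m_one : num;
  m_plus : num -> num -> num;
  m_times : num -> num -> num;
  m_lt : num -> num -> Prop;
  m_mem : num -> sets -> Prop }.

Arguments m_zero {_}.
Arguments m_one {_}.
Arguments m_plus {_}.
Arguments m_times {_}.
Arguments m_lt {_}.
Arguments m_mem {_}.

Declare Scope num_scope.
Delimit Scope num_scope with num.
Bind Scope num_scope with num.
Notation "0" := m_zero : num_scope.
Notation "1" := m_one : num_scope.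
Notation "x + y" := (m_plus x%num y%num) : num_scope.
Notation "x * y" := (m_times x%num y%num) : num_scope.
Notation "x < y" := (m_lt x%num y%num) : num_scope.
Notation "x ∈ X" := (m_mem x%num X) (at level 70) : num_scope.

Definition scons {A : Type} (x : A) (f : nat -> A) (n : nat) : A :=
  match n with 0 => x | S n => f n end.

Fixpoint tval (M : model) (r : nat -> num M) (t : term) : num M :=
  match t with
  | Var n => r n
  | Zero => m_zero
  | One => m_one
  | Plus s t => m_plus (tval M r s) (tval M r t)
  | Times s t => m_times (tval M r s) (tval M r t)
  end.

Fixpoint sat (M : model) (r : nat -> num M) (u : nat -> sets M) (p : form) : Prop :=
  match p with
  | Bot => False
  | Eq s t => tval M r s = tval M r t
  | Lt s t => m_lt (tval M r s) (tval M r t)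
  | Mem t X => m_mem (tval M r t) (u X)
  | Imp p q => sat M r u p -> sat M r u q
  | AllNum p => forall d, sat M (scons d r) u p
  | AllSet p => forall X, sat M r (scons X u) p
  end.

Definition models (M : model) (T : theory) : Prop := forall p, T p -> forall r u, sat M r u p.

Lemma tval_ext M t : forall r r', (forall n, r n = r' n) -> tval M r t = tval M r' t.
Proof. induction t; simpl; intros; auto; f_equal; auto. Qed.

Lemma sat_ext M p : forall r r' u u', (forall n, r n = r' n) -> (forall n, u n = u' n) ->
  (sat M r u p <-> sat M r' u' p).
Proof.
  induction p; simpl; intros r r' u u' Hr Hu.
  - tauto.
  - rewrite (tval_ext M s _ _ Hr), (tval_ext M t _ _ Hr). tauto.
  - rewrite (tval_ext M s _ _ Hr), (tval_ext M t _ _ Hr). tauto.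
  - rewrite (tval_ext M t _ _ Hr), Hu. tauto.
  - rewrite (IHp1 r r' u u'), (IHp2 r r' u u'); tauto.
  - split; intros H d; apply (IHp (scons d r) (scons d r') u u'); auto;
      intros [|n]; simpl; auto.
  - split; intros H d; apply (IHp r r' (scons d u) (scons d u')); auto;
      intros [|n]; simpl; auto.
Qed.

Lemma tval_subst M t : forall r f,
  tval M r (subst_term f t) = tval M (fun n => tval M r (f n)) t.
Proof. induction t; simpl; intros; auto; f_equal; auto. Qed.

Lemma sat_subst M p : forall r u f a,
  sat M r u (subst f a p) <-> sat M (fun n => tval M r (f n)) (fun n => u (a n)) p.
Proof.
  induction p; simpl; intros r u f a; rewrite ?tval_subst; try tauto.
  - rewrite IHp1, IHp2. tauto.
  - split; intros H d; specialize (H d); rewrite IHp in *;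
      (eapply sat_ext; [| |apply H]); auto; intros [|n]; simpl; auto;
      unfold shift_term; rewrite tval_subst; auto using tval_ext.
  - split; intros H d; specialize (H d); rewrite IHp in *;
      (eapply sat_ext; [| |apply H]); auto; intros [|n]; simpl; auto.
Qed.

(** ** Enumerating the formulas *)

Fixpoint term_code (t : term) : nat :=
  match t with
  | Var n => to_nat (0, n)
  | Zero => to_nat (1, 0)
  | One => to_nat (2, 0)
  | Plus s t => to_nat (3, to_nat (term_code s, term_code t))
  | Times s t => to_nat (4, to_nat (term_code s, term_code t))
  end.

Fixpoint form_code (p : form) : nat :=
  match p with
  | Bot => to_nat (0, 0)
  | Eq s t => to_nat (1, to_nat (term_code s, term_code t))
  | Lt s t => to_nat (2, to_nat (term_code s, term_code t))
  | Mem t X => to_nat (3, to_nat (term_code t, X))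
  | Imp p q => to_nat (4, to_nat (form_code p, form_code q))
  | AllNum p => to_nat (5, form_code p)
  | AllSet p => to_nat (6, form_code p)
  end.

Lemma to_nat_pair_inj a b c d : to_nat (a, b) = to_nat (c, d) -> a = c /\ b = d.
Proof. intro H. apply to_nat_inj in H. split; congruence. Qed.

Ltac code_inv :=
  repeat match goal with
  | H : to_nat _ = to_nat _ |- _ => apply to_nat_pair_inj in H as [? H]; try discriminate
  end.

Lemma term_code_inj s : forall t, term_code s = term_code t -> s = t.
Proof.
  induction s; intros [] H; cbn [term_code] in H; code_inv;
    try discriminate; f_equal; auto.
Qed.

Lemma form_code_inj p : forall q, form_code p = form_code q -> p = q.
Proof.
  induction p; intros [] H; cbn [form_code] in H; code_inv;
    try discriminate; f_equal; auto using term_code_inj.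
Qed.

Definition enum_form (n : nat) : form := epsilon (inhabits Bot) (fun p => form_code p = n).

Lemma enum_form_code p : enum_form (form_code p) = p.
Proof. apply form_code_inj. unfold enum_form.
  apply (epsilon_spec (inhabits Bot) (fun q => form_code q = form_code p)). now exists p. Qed.

(** * Completeness *)

Section Henkin.
Variable T : theory.
Hypothesis HT : subst_closed T.

Definition consistent (G : list form) : Prop := ~ prv T G Bot.

Definition fresh (G : list form) : nat :=
  epsilon (inhabits 0) (fun N => forall p, In p G -> vars_below N p).

Lemma fresh_spec G p : In p G -> vars_below (fresh G) p.
Proof.
  revert p. unfold fresh. apply epsilon_spec.
  destruct (vars_below_list G) as [N HN]. exists N. apply HN. auto.
Qed.

(** A refuted universal formula comes with an instance that is refuted at a fresh
    variable. *)
Definition counterexample (G : list form) (p : form) : list form :=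
  match p with
  | AllNum q => Neg (inst_num q (Var (fresh (q :: Neg p :: G)))) :: Neg p :: G
  | AllSet q => Neg (inst_set q (fresh (q :: Neg p :: G))) :: Neg p :: G
  | _ => Neg p :: G
  end.

Definition extend (G : list form) (p : form) : list form :=
  if excluded_middle_informative (consistent (p :: G)) then p :: G else counterexample G p.

Lemma extend_incl G p : incl G (extend G p).
Proof.
  unfold extend, counterexample. intros q Hq.
  destruct (excluded_middle_informative _); [now right|].
  destruct p; simpl; auto.
Qed.

Lemma inconsistent_neg G p : ~ consistent (p :: G) -> prv T G (Neg p).
Proof. intro H. apply prv_ImpI. now apply NNPP. Qed.

Lemma extend_consistent G p : consistent G -> consistent (extend G p).
Proof.
  intros HG. unfold extend.
  destruct (excluded_middle_informative _) as [Hc|Hc]; auto.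
  apply inconsistent_neg in Hc.
  assert (Hn : consistent (Neg p :: G)) by (intro H; apply HG; eapply prv_cut; eauto).
  unfold counterexample. destruct p; auto; intros H; apply Hn.
  - apply prv_raa in H. set (L := p :: _) in H.
    apply prv_AllNum_fresh in H; auto.
    + eapply prv_ImpE; [apply prv_hyp; left; reflexivity|exact H].
    + apply fresh_spec. now left.
    + intros q Hq. apply fresh_spec. now right.
  - apply prv_raa in H. set (L := p :: _) in H.
    apply prv_AllSet_fresh in H; auto.
    + eapply prv_ImpE; [apply prv_hyp; left; reflexivity|exact H].
    + apply fresh_spec. now left.
    + intros q Hq. apply fresh_spec. now right.
Qed.

Variable G0 : list form.
Hypothesis HG0 : consistent G0.

Fixpoint stage (n : nat) : list form :=
  match n with 0 => G0 | S n => extend (stage n) (enum_form n) end.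

Lemma stage_consistent n : consistent (stage n).
Proof. induction n; simpl; auto using extend_consistent. Qed.

Lemma stage_incl n m : n <= m -> incl (stage n) (stage m).
Proof.
  induction 1; [apply incl_refl|].
  eapply incl_tran; [apply IHle|apply extend_incl].
Qed.

(** The deductive closure of the union of the stages, a complete theory with witnesses. *)
Definition limit (p : form) : Prop := exists n, prv T (stage n) p.

Lemma limit_prv G p : (forall q, In q G -> limit q) -> prv T G p -> limit p.
Proof.
  intros HG Hp.
  assert (H : exists n, forall q, In q G -> prv T (stage n) q).
  { clear Hp. induction G as [|q G IH].
    - exists 0. intros q [].
    - destruct IH as [n Hn]; [intros; apply HG; now right|].
      destruct (HG q) as [m Hm]; [now left|].
      exists (n + m). intros r [<-|Hr].
      + eapply prv_weak; [apply Hm|apply stage_incl; lia].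
      + eapply prv_weak; [apply Hn, Hr|apply stage_incl; lia]. }
  destruct H as [n Hn]. exists n. clear HG. revert p Hp.
  induction G as [|q G IH]; intros p Hp.
  - eapply prv_weak; [apply Hp|]. intros x [].
  - eapply prv_ImpE; [apply IH|apply Hn; now left].
    + intros; apply Hn; now right.
    + now apply prv_ImpI.
Qed.

Lemma limit_consistent : ~ limit Bot.
Proof. intros [n H]. now apply stage_consistent in H. Qed.

Lemma stage_decides p :
  In p (stage (S (form_code p))) \/
  incl (counterexample (stage (form_code p)) p) (stage (S (form_code p))).
Proof.
  simpl. rewrite enum_form_code. unfold extend.
  destruct (excluded_middle_informative _); [left; now left|right; apply incl_refl].
Qed.

Lemma limit_stage n p : In p (stage n) -> limit p.
Proof. exists n. now apply prv_hyp. Qed.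

Lemma limit_complete p : limit p \/ limit (Neg p).
Proof.
  destruct (stage_decides p) as [H|H].
  - left. eapply limit_stage, H.
  - right. apply limit_stage with (n := S (form_code p)). apply H. unfold counterexample.
    destruct p; simpl; auto.
Qed.

Lemma limit_neg p : limit (Neg p) <-> ~ limit p.
Proof.
  split.
  - intros Hn Hp. apply limit_consistent. apply (@limit_prv [Neg p; p]).
    + intros q [<-|[<-|[]]]; auto.
    + apply prv_ImpE with p; apply prv_hyp; simpl; auto.
  - intro H. destruct (limit_complete p); tauto.
Qed.

Lemma limit_imp p q : limit (Imp p q) <-> (limit p -> limit q).
Proof.
  split.
  - intros Hi Hp. apply (@limit_prv [Imp p q; p]).
    + intros r [<-|[<-|[]]]; auto.
    + apply prv_ImpE with p; apply prv_hyp; simpl; auto.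
  - intro H. destruct (limit_complete p) as [Hp|Hp].
    + apply (@limit_prv [q]); [intros r [<-|[]]; auto|].
      apply prv_ImpI, prv_hyp. simpl; auto.
    + apply (@limit_prv [Neg p]); [intros r [<-|[]]; auto|].
      apply prv_ImpI, prv_exfalso. apply prv_ImpE with p; apply prv_hyp; simpl; auto.
Qed.

Lemma limit_AllNum p : limit (AllNum p) <-> forall t, limit (inst_num p t).
Proof.
  split.
  - intros H t. apply (@limit_prv [AllNum p]); [intros r [<-|[]]; auto|].
    apply prv_AllNumE, prv_hyp. simpl; auto.
  - intro H. apply NNPP. intro Hn.
    destruct (stage_decides (AllNum p)) as [Hs|Hs].
    + apply Hn. eapply limit_stage, Hs.
    + specialize (Hs _ (or_introl eq_refl)). apply limit_stage in Hs.
      apply limit_neg in Hs. apply Hs, H.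
Qed.

Lemma limit_AllSet p : limit (AllSet p) <-> forall X, limit (inst_set p X).
Proof.
  split.
  - intros H t. apply (@limit_prv [AllSet p]); [intros r [<-|[]]; auto|].
    apply prv_AllSetE, prv_hyp. simpl; auto.
  - intro H. apply NNPP. intro Hn.
    destruct (stage_decides (AllSet p)) as [Hs|Hs].
    + apply Hn. eapply limit_stage, Hs.
    + specialize (Hs _ (or_introl eq_refl)). apply limit_stage in Hs.
      apply limit_neg in Hs. apply Hs, H.
Qed.

Lemma limit_eq_subst p s t : limit (Eq s t) -> limit (inst_num p s) -> limit (inst_num p t).
Proof.
  intros He Hp. apply (@limit_prv [Eq s t; inst_num p s]).
  - intros q [<-|[<-|[]]]; auto.
  - eapply prv_Eq_subst; apply prv_hyp; simpl; auto.
Qed.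

Lemma limit_eq_refl t : limit (Eq t t).
Proof. apply (@limit_prv []); [intros q []|apply prv_Eq_refl]. Qed.

Definition hole (t : term) (n : nat) : term := match n with 0 => t | S n => Var n end.

Lemma hole_shift t u : subst_term (hole t) (shift_term u) = u.
Proof. unfold shift_term. rewrite subst_term_comp. apply subst_term_id. Qed.

Lemma inst_num_hole p t : inst_num p t = subst (hole t) (fun X => X) p.
Proof. reflexivity. Qed.

Lemma limit_eq_sym s t : limit (Eq s t) -> limit (Eq t s).
Proof.
  intro H. pose (p := Eq (Var 0) (shift_term s)).
  assert (E : forall u, inst_num p u = Eq u s).
  { intro u. rewrite inst_num_hole. simpl. now rewrite hole_shift. }
  rewrite <- E. eapply limit_eq_subst; [apply H|]. rewrite E. apply limit_eq_refl.
Qed.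

Lemma limit_eq_trans s t u : limit (Eq s t) -> limit (Eq t u) -> limit (Eq s u).
Proof.
  intros H1 H2. pose (p := Eq (shift_term s) (Var 0)).
  assert (E : forall u, inst_num p u = Eq s u).
  { intro v. rewrite inst_num_hole. simpl. now rewrite hole_shift. }
  rewrite <- E. eapply limit_eq_subst; [apply H2|]. now rewrite E.
Qed.

Lemma limit_eq_context c s t : limit (Eq s t) ->
  limit (Eq (subst_term (hole s) c) (subst_term (hole t) c)).
Proof.
  intro H. pose (p := Eq (shift_term (subst_term (hole s) c)) c).
  assert (E : forall u, inst_num p u = Eq (subst_term (hole s) c) (subst_term (hole u) c)).
  { intro u. rewrite inst_num_hole. simpl. now rewrite hole_shift. }
  rewrite <- E. eapply limit_eq_subst; [apply H|]. rewrite E. apply limit_eq_refl.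
Qed.

Lemma limit_eq_Plus s s' t t' : limit (Eq s s') -> limit (Eq t t') ->
  limit (Eq (Plus s t) (Plus s' t')).
Proof.
  intros H K. apply limit_eq_trans with (Plus s' t).
  - apply (limit_eq_context (Plus (Var 0) (shift_term t))) in H.
    simpl in H. now rewrite !hole_shift in H.
  - apply (limit_eq_context (Plus (shift_term s') (Var 0))) in K.
    simpl in K. now rewrite !hole_shift in K.
Qed.

Lemma limit_eq_Times s s' t t' : limit (Eq s s') -> limit (Eq t t') ->
  limit (Eq (Times s t) (Times s' t')).
Proof.
  intros H K. apply limit_eq_trans with (Times s' t).
  - apply (limit_eq_context (Times (Var 0) (shift_term t))) in H.
    simpl in H. now rewrite !hole_shift in H.
  - apply (limit_eq_context (Times (shift_term s') (Var 0))) in K.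
    simpl in K. now rewrite !hole_shift in K.
Qed.

Lemma limit_Lt s s' t t' : limit (Eq s s') -> limit (Eq t t') ->
  limit (Lt s t) -> limit (Lt s' t').
Proof.
  intros H K L.
  assert (L' : limit (Lt s' t)).
  { generalize (@limit_eq_subst (Lt (Var 0) (shift_term t)) s s' H).
    rewrite !inst_num_hole. simpl. rewrite !hole_shift. auto. }
  generalize (@limit_eq_subst (Lt (shift_term s') (Var 0)) t t' K).
  rewrite !inst_num_hole. simpl. rewrite !hole_shift. auto.
Qed.

Lemma limit_Mem s s' X : limit (Eq s s') -> limit (Mem s X) -> limit (Mem s' X).
Proof. intro H. exact (@limit_eq_subst (Mem (Var 0) X) s s' H). Qed.

(** Terms up to provable equality, each class being represented by a chosen term. *)
Definition repr (t : term) : term := epsilon (inhabits Zero) (fun s => limit (Eq t s)).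

Lemma repr_spec t : limit (Eq t (repr t)).
Proof. unfold repr. apply epsilon_spec. exists t. apply limit_eq_refl. Qed.

Lemma repr_eq s t : repr s = repr t <-> limit (Eq s t).
Proof.
  split; intro H.
  - eapply limit_eq_trans; [apply repr_spec|]. rewrite H. apply limit_eq_sym, repr_spec.
  - unfold repr. f_equal. extensionality u. apply propositional_extensionality.
    split; intro; eauto using limit_eq_trans, limit_eq_sym.
Qed.

Definition class : Type := { t : term | repr t = t }.

Definition to_class (t : term) : class :=
  exist _ (repr t) (proj2 (repr_eq _ _) (limit_eq_sym (repr_spec t))).

Lemma to_class_eq s t : to_class s = to_class t <-> limit (Eq s t).
Proof.
  rewrite <- repr_eq. split; intro H.
  - now injection H.
  - apply eq_sig_hprop; auto. intros. apply proof_irrelevance.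
Qed.

Lemma to_class_proj (c : class) : to_class (proj1_sig c) = c.
Proof.
  destruct c as [t Ht]. apply eq_sig_hprop; auto. intros. apply proof_irrelevance.
Qed.

(** The language has no equality between sets, so the set variables themselves serve as
    the sets. *)
Definition canonical : model := {|
  num := class;
  sets := nat;
  m_zero := to_class Zero;
  m_one := to_class One;
  m_plus s t := to_class (Plus (proj1_sig s) (proj1_sig t));
  m_times s t := to_class (Times (proj1_sig s) (proj1_sig t));
  m_lt s t := limit (Lt (proj1_sig s) (proj1_sig t));
  m_mem t X := limit (Mem (proj1_sig t) X) |}.

Lemma canonical_tval (f : nat -> term) t :
  tval canonical (fun n => to_class (f n)) t = to_class (subst_term f t).
Proof.
  induction t as [n| | |s IHs t IHt|s IHs t IHt]; simpl; auto; rewrite IHs, IHt;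
    apply to_class_eq; [apply limit_eq_Plus|apply limit_eq_Times];
    apply limit_eq_sym, repr_spec.
Qed.

Lemma canonical_sat p : forall f a,
  sat canonical (fun n => to_class (f n)) a p <-> limit (subst f a p).
Proof.
  induction p as [|s t|s t|t X|p IHp q IHq|p IHp|p IHp]; intros f a; simpl.
  - split; [tauto|]. apply limit_consistent.
  - rewrite !canonical_tval. apply to_class_eq.
  - rewrite !canonical_tval. simpl.
    split; apply limit_Lt; first [apply repr_spec|apply limit_eq_sym, repr_spec].
  - rewrite canonical_tval. simpl.
    split; apply limit_Mem; first [apply repr_spec|apply limit_eq_sym, repr_spec].
  - rewrite IHp, IHq. symmetry. apply limit_imp.
  - rewrite limit_AllNum.
    assert (E : forall t, limit (inst_num (subst (up_num f) a p) t) <->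
                          sat canonical (scons (to_class t) (fun n => to_class (f n))) a p).
    { intro t. unfold inst_num. rewrite subst_comp.
      rewrite (sat_ext canonical p _ (fun n => to_class (scons t f n)) a a);
        auto; [|now intros [|n]].
      rewrite IHp.
      replace (subst (scons t f) a p) with
        (subst (fun n => subst_term (hole t) (up_num f n)) (fun n => a n) p); [tauto|].
      apply subst_ext; auto. intros [|n]; simpl; auto. apply hole_shift. }
    split; intros H t.
    + apply E, H.
    + rewrite <- (to_class_proj t). apply E, H.
  - rewrite limit_AllSet. split; intros H X; specialize (H X).
    + rewrite IHp in H. unfold inst_set. rewrite subst_comp.
      replace (subst _ _ p) with (subst f (scons X a) p); auto.
      apply subst_ext; [intro; symmetry; apply subst_term_id|now intros [|n]].
    + rewrite IHp. unfold inst_set in H. rewrite subst_comp in H.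
      replace (subst f (scons X a) p) with
        (subst (fun n => subst_term Var (f n))
           (fun n => match up_set a n with 0 => X | S n => n end) p); auto.
      apply subst_ext; [intro; apply subst_term_id|now intros [|n]].
Qed.

End Henkin.

(** If [p] is not provable, the canonical model of a complete extension of [Neg p] refutes
    it.  An assignment in that model is a substitution, which is why the axioms have to be
    closed under substitution. *)
Theorem completeness T p : subst_closed T ->
  (forall M, models M T -> forall r u, sat M r u p) -> proves T p.
Proof.
  intros HT H. apply NNPP. intro Hn.
  assert (HG : consistent T [Neg p]).
  { intro K. apply Hn. now apply prv_raa. }
  set (M := canonical T [Neg p]).
  assert (HM : models M T).
  { intros q Hq r u.
    rewrite (sat_ext M q r (fun n => to_class T [Neg p] (proj1_sig (r n))) u u); auto.
    - apply (canonical_sat HT HG). exists 0. now apply prv_axiom, HT.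
    - intro n. symmetry. apply to_class_proj. }
  specialize (H M HM (fun n => to_class T [Neg p] (Var n)) (fun n => n)).
  apply (canonical_sat HT HG) in H. rewrite subst_id in H by auto. revert H.
  apply (limit_neg HT HG). apply limit_stage with 0. now left.
Qed.

(** * Models of arithmetical comprehension *)

Lemma arithmetical_subst p : forall f a, arithmetical p -> arithmetical (subst f a p).
Proof. induction p; simpl; intuition. Qed.

Lemma sat_And M r u p q : sat M r u (And p q) <-> sat M r u p /\ sat M r u q.
Proof. simpl. tauto. Qed.

Lemma sat_Or M r u p q : sat M r u (Or p q) <-> sat M r u p \/ sat M r u q.
Proof. simpl. tauto. Qed.

Lemma sat_Neg M r u p : sat M r u (Neg p) <-> ~ sat M r u p.
Proof. simpl. tauto. Qed.

Lemma sat_Iff M r u p q : sat M r u (Iff p q) <-> (sat M r u p <-> sat M r u q).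
Proof. simpl. tauto. Qed.

Lemma sat_ExNum M r u p : sat M r u (ExNum p) <-> exists d, sat M (scons d r) u p.
Proof.
  simpl. split.
  - intro H. apply NNPP. intro K. apply H. intros d Hd. apply K. now exists d.
  - intros [d Hd] H. apply (H d Hd).
Qed.

Lemma sat_ExSet M r u p : sat M r u (ExSet p) <-> exists X, sat M r (scons X u) p.
Proof.
  simpl. split.
  - intro H. apply NNPP. intro K. apply H. intros d Hd. apply K. now exists d.
  - intros [d Hd] H. apply (H d Hd).
Qed.

Definition has_comprehension (M : model) (p : form) : Prop :=
  forall r u, exists X : sets M, forall n, m_mem n X <-> sat M (scons n r) u p.

Lemma sat_comprehension M p :
  (forall r u, sat M r u (comprehension_for p)) <-> has_comprehension M p.
Proof.
  unfold has_comprehension, comprehension_for, shift_set.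
  split; intros H r u; specialize (H r u).
  - apply sat_ExSet in H as [X H]. exists X. intro n. specialize (H n).
    apply sat_Iff in H. rewrite sat_subst in H. exact H.
  - apply sat_ExSet. destruct H as [X H]. exists X. intro n.
    apply sat_Iff. rewrite sat_subst. exact (H n).
Qed.

Section Definability.

Variable M : model.

Notation D := (num M).
Notation S_ := (sets M).
Local Open Scope num_scope.

(** ** Arithmetically definable predicates *)

Definition look (r : nat -> D) (v : nat + D) : D :=
  match v with inl i => r i | inr d => d end.
Definition look_set (X : S_) (v : option S_) : S_ :=
  match v with None => X | Some Y => Y end.

(** [P X r] is arithmetical in the set [X] and the numbers [r 0], [r 1], ...; each
    variable of the formula is assigned one of these or a parameter. *)
Definition def (P : S_ -> (nat -> D) -> Prop) : Prop :=
  exists p f a, arithmetical p /\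
    forall X r, P X r <-> sat M (fun n => look r (f n)) (fun n => look_set X (a n)) p.

Definition deft (t : S_ -> (nat -> D) -> D) : Prop :=
  def (fun X r => r O = t X (fun i => r (S i))).

Definition def1 (R : D -> Prop) := def (fun _ r => R (r O)).
Definition def2 (R : D -> D -> Prop) := def (fun _ r => R (r O) (r 1%nat)).
Definition def3 (R : D -> D -> D -> Prop) := def (fun _ r => R (r O) (r 1%nat) (r 2%nat)).
Definition def4 (R : D -> D -> D -> D -> Prop) :=
  def (fun _ r => R (r O) (r 1%nat) (r 2%nat) (r 3%nat)).
Definition deff1 (f : D -> D) := def2 (fun y x => y = f x).
Definition deff2 (f : D -> D -> D) := def3 (fun z x y => z = f x y).
Definition deff3 (f : D -> D -> D -> D) := def4 (fun z x y w => z = f x y w).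

Lemma def_iff P Q : (forall X r, P X r <-> Q X r) -> def P -> def Q.
Proof.
  intros E (p & f & a & Hp & H). exists p, f, a. split; auto.
  intros X r. rewrite <- E. apply H.
Qed.

Lemma def_ren P g : def P -> def (fun X r => P X (fun i => r (g i))).
Proof.
  intros (p & f & a & Hp & H).
  exists p, (fun n => match f n with inl i => inl (g i) | inr d => inr d end), a.
  split; auto. intros X r. rewrite H. apply sat_ext; auto.
  intro n. now destruct (f n).
Qed.

Lemma def_const (P : Prop) : def (fun _ _ => P).
Proof.
  destruct (classic P).
  - exists (Imp Bot Bot), inl, (fun _ => None). simpl. tauto.
  - exists Bot, inl, (fun _ => None). simpl. tauto.
Qed.

(** The variables of the two formulas are kept apart as the even and the odd ones. *)
Lemma def_imp P Q : def P -> def Q -> def (fun X r => P X r -> Q X r).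
Proof.
  intros (p & f & a & Hp & H) (q & g & b & Hq & K).
  pose (p' := subst (fun n => Var (2 * n)) (fun n => 2 * n)%nat p).
  pose (q' := subst (fun n => Var (S (2 * n))) (fun n => S (2 * n))%nat q).
  pose (mix := fun (A : Type) (f g : nat -> A) n =>
                 if Nat.even n then f (Nat.div2 n) else g (Nat.div2 n)).
  assert (E1 : forall A (f g : nat -> A) n, mix A f g (2 * n)%nat = f n).
  { intros. unfold mix. rewrite Nat.even_mul, Nat.div2_double. reflexivity. }
  assert (E2 : forall A (f g : nat -> A) n, mix A f g (S (2 * n)) = g n).
  { intros. unfold mix. rewrite Nat.even_succ, Nat.odd_mul, Nat.div2_succ_double. reflexivity. }
  exists (Imp p' q'), (mix _ f g), (mix _ a b). split.
  - split; now apply arithmetical_subst.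
  - intros X r. simpl. unfold p', q'. rewrite !sat_subst, H, K.
    cbn [tval].
    rewrite (sat_ext M p (fun n => look r (mix _ f g (2 * n)%nat)) (fun n => look r (f n))
               (fun n => look_set X (mix _ a b (2 * n)%nat)) (fun n => look_set X (a n)));
      [|intro; now rewrite E1..].
    rewrite (sat_ext M q (fun n => look r (mix _ f g (S (2 * n)))) (fun n => look r (g n))
               (fun n => look_set X (mix _ a b (S (2 * n)))) (fun n => look_set X (b n)));
      [|intro; now rewrite E2..].
    tauto.
Qed.

Lemma def_all Q : def (fun X r => Q X (r O) (fun i => r (S i))) ->
  def (fun X r => forall d : D, Q X d r).
Proof.
  intros (p & f & a & Hp & H).
  pose (s := fun n => match f n with inl O => Var 0 | _ => Var (S n) end).
  exists (AllNum (subst s (fun n => n) p)),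
    (fun n => match f n with inl (S i) => inl i | inl O => inr 0 | inr d => inr d end), a.
  split; [now apply arithmetical_subst|].
  intros X r. simpl.
  assert (E : forall d, Q X d r <->
    sat M (scons d (fun n => look r (match f n with inl (S i) => inl i | inl O => inr 0
             | inr d => inr d end))) (fun n => look_set X (a n)) (subst s (fun n => n) p)).
  { intro d. rewrite sat_subst.
    specialize (H X (scons d r)). simpl in H.
    change (fun i => r i) with r in H. rewrite H.
    apply sat_ext; auto. intro n. unfold s. simpl.
    destruct (f n) as [[|i]|d'] eqn:Ef; simpl; rewrite ?Ef; auto. }
  split; intros K d; now apply E.
Qed.

Lemma def_not P : def P -> def (fun X r => ~ P X r).
Proof. intro H. apply (def_imp H (def_const False)). Qed.

Lemma def_and P Q : def P -> def Q -> def (fun X r => P X r /\ Q X r).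
Proof.
  intros H K. apply def_iff with (fun X r => ~ (P X r -> ~ Q X r)).
  - intros. tauto.
  - auto using def_not, def_imp.
Qed.

Lemma def_or P Q : def P -> def Q -> def (fun X r => P X r \/ Q X r).
Proof.
  intros H K. apply def_iff with (fun X r => ~ P X r -> Q X r).
  - intros. tauto.
  - auto using def_not, def_imp.
Qed.

Lemma def_equiv P Q : def P -> def Q -> def (fun X r => P X r <-> Q X r).
Proof. intros H K. unfold iff. auto using def_and, def_imp. Qed.

Lemma def_ex Q : def (fun X r => Q X (r O) (fun i => r (S i))) ->
  def (fun X r => exists d : D, Q X d r).
Proof.
  intros H. apply def_iff with (fun X r => ~ forall d, ~ Q X d r).
  - intros X r. split.
    + intro K. apply NNPP. firstorder.
    + firstorder.
  - apply def_not, def_all, def_not. exact H.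
Qed.

Lemma def_sub Q t : def (fun X r => Q X (r O) (fun i => r (S i))) -> deft t ->
  def (fun X r => Q X (t X r) r).
Proof.
  intros HQ Ht. apply def_iff with (fun X r => exists d, d = t X r /\ Q X d r).
  - intros X r. split; [intros [d [-> H]]; auto|intro H; now exists (t X r)].
  - apply def_ex, def_and; auto.
Qed.

Lemma deft_ren t g : deft t -> deft (fun X r => t X (fun i => r (g i))).
Proof.
  intro H. unfold deft in *.
  apply def_ren with (g := fun n => match n with O => O | S i => S (g i) end) in H.
  exact H.
Qed.

Lemma deft_shift t : deft t -> deft (fun X r => t X (fun i => r (S i))).
Proof. apply deft_ren. Qed.

Lemma def_app1 R t : def1 R -> deft t -> def (fun X r => R (t X r)).
Proof. intros HR Ht. exact (def_sub (fun _ x _ => R x) HR Ht). Qed.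

Lemma def_app2 R t1 t2 : def2 R -> deft t1 -> deft t2 ->
  def (fun X r => R (t1 X r) (t2 X r)).
Proof.
  intros HR H1 H2. apply (def_sub (fun X x r => R x (t2 X r))); auto.
  apply (def_sub (fun X x r => R (r O) x)); auto using deft_shift.
  exact (def_ren (fun n => match n with O => 1 | _ => O end)%nat HR).
Qed.

Lemma def_app3 R t1 t2 t3 : def3 R -> deft t1 -> deft t2 -> deft t3 ->
  def (fun X r => R (t1 X r) (t2 X r) (t3 X r)).
Proof.
  intros HR H1 H2 H3. apply (def_sub (fun X x r => R x (t2 X r) (t3 X r))); auto.
  apply (def_sub (fun X x r => R (r O) x (t3 X (fun i => r (S i))))); auto using deft_shift.
  apply (def_sub (fun X x r => R (r 1%nat) (r O) x));
    [|exact (deft_ren (fun i => S (S i)) H3)].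
  exact (def_ren (fun n => match n with O => 2 | 1 => 1 | _ => O end)%nat HR).
Qed.

Lemma def_app4 R t1 t2 t3 t4 : def4 R -> deft t1 -> deft t2 -> deft t3 -> deft t4 ->
  def (fun X r => R (t1 X r) (t2 X r) (t3 X r) (t4 X r)).
Proof.
  intros HR H1 H2 H3 H4. apply (def_sub (fun X x r => R x (t2 X r) (t3 X r) (t4 X r))); auto.
  apply (def_sub (fun X x r => R (r O) x (t3 X (fun i => r (S i))) (t4 X (fun i => r (S i)))));
    auto using deft_shift.
  apply (def_sub (fun X x r => R (r 1%nat) (r O) x (t4 X (fun i => r (S (S i))))));
    [|exact (deft_ren (fun i => S (S i)) H3)].
  apply (def_sub (fun X x r => R (r 2%nat) (r 1%nat) (r O) x));
    [|exact (deft_ren (fun i => S (S (S i))) H4)].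
  exact (def_ren (fun n => match n with O => 3 | 1 => 2 | 2 => 1 | _ => O end)%nat HR).
Qed.

Lemma deft_app1 f t : deff1 f -> deft t -> deft (fun X r => f (t X r)).
Proof.
  intros Hf H. unfold deft.
  apply (def_sub (fun X x r => r O = f x)); auto using deft_shift.
  exact (def_ren (fun n => match n with O => 1 | _ => O end)%nat Hf).
Qed.

Lemma deft_var i : deft (fun _ r => r i).
Proof.
  exists (Eq (Var 0) (Var 1)),
    (fun n => match n with O => inl O | _ => inl (S i) end), (fun _ => None).
  now simpl.
Qed.

Lemma deft_const d : deft (fun _ _ => d).
Proof.
  exists (Eq (Var 0) (Var 1)),
    (fun n => match n with O => inl O | _ => inr d end), (fun _ => None).
  now simpl.
Qed.

Lemma def2_eq : def2 (@eq D).
Proof. now exists (Eq (Var 0) (Var 1)), inl, (fun _ => None). Qed.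

Lemma def2_lt : def2 (@m_lt M).
Proof. now exists (Lt (Var 0) (Var 1)), inl, (fun _ => None). Qed.

Lemma def1_mem X : def1 (fun x => x ∈ X).
Proof. now exists (Mem (Var 0) 0), inl, (fun _ => Some X). Qed.

Lemma def_mem_var t : deft t -> def (fun X r => t X r ∈ X).
Proof.
  intro H. apply (def_sub (fun X x r => x ∈ X)); auto.
  now exists (Mem (Var 0) 0), inl, (fun _ => None).
Qed.

Lemma deff2_plus : deff2 (@m_plus M).
Proof. now exists (Eq (Var 0) (Plus (Var 1) (Var 2))), inl, (fun _ => None). Qed.

Lemma deff2_times : deff2 (@m_times M).
Proof. now exists (Eq (Var 0) (Times (Var 1) (Var 2))), inl, (fun _ => None). Qed.

Lemma deft_app2 f t1 t2 : deff2 f -> deft t1 -> deft t2 ->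
  deft (fun X r => f (t1 X r) (t2 X r)).
Proof.
  intros Hf H1 H2. unfold deft.
  apply (@def_app3 (fun z x y => z = f x y) (fun _ r => r O) (fun X r => t1 X (fun i => r (S i)))
           (fun X r => t2 X (fun i => r (S i)))); auto using deft_shift, deft_var.
Qed.

Lemma deft_app3 f t1 t2 t3 : deff3 f -> deft t1 -> deft t2 -> deft t3 ->
  deft (fun X r => f (t1 X r) (t2 X r) (t3 X r)).
Proof.
  intros Hf H1 H2 H3. unfold deft.
  apply (@def_app4 (fun z x y w => z = f x y w) (fun _ r => r O)
           (fun X r => t1 X (fun i => r (S i))) (fun X r => t2 X (fun i => r (S i)))
           (fun X r => t3 X (fun i => r (S i)))); auto using deft_shift, deft_var.
Qed.

Lemma def_mem_const X t : deft t -> def (fun Y r => t Y r ∈ X).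
Proof. exact (@def_app1 (fun x => x ∈ X) t (def1_mem X)). Qed.

Lemma deft_if (P : S_ -> (nat -> D) -> Prop) t1 t2 : def P -> deft t1 -> deft t2 ->
  deft (fun X r => if excluded_middle_informative (P X r) then t1 X r else t2 X r).
Proof.
  intros HP H1 H2. unfold deft in *.
  apply def_iff with (fun X r =>
    (P X (fun i => r (S i)) /\ r O = t1 X (fun i => r (S i))) \/
    (~ P X (fun i => r (S i)) /\ r O = t2 X (fun i => r (S i)))).
  - intros X r. destruct (excluded_middle_informative _); tauto.
  - apply def_or; apply def_and; auto; [|apply def_not]; now apply def_ren.
Qed.

End Definability.

Arguments look {M}.
Arguments look_set {M}.
Arguments def {M}.
Arguments deft {M}.
Arguments def1 {M}.
Arguments def2 {M}.
Arguments def3 {M}.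
Arguments def4 {M}.
Arguments deff1 {M}.
Arguments deff2 {M}.
Arguments deff3 {M}.

Create HintDb def.

#[export] Hint Resolve def2_eq def2_lt deff2_plus deff2_times : def.

Ltac find_def := solve [auto 2 with def nocore].

(** Reads off definability from the syntax of a predicate; the definability of the
    predicates and functions that occur in it is looked up in the database [def]. *)
Ltac ddef_step :=
  cbn beta;
  match goal with
  | |- def1 _ => unfold def1
  | |- def2 _ => unfold def2
  | |- def3 _ => unfold def3
  | |- def4 _ => unfold def4
  | |- deff1 _ => unfold deff1, def2
  | |- deff2 _ => unfold deff2, def3
  | |- deff3 _ => unfold deff3, def4
  | |- def (fun _ _ => ~ _) => apply def_not
  | |- def (fun _ _ => _ /\ _) => apply def_and
  | |- def (fun _ _ => _ \/ _) => apply def_or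
  | |- def (fun _ _ => _ <-> _) => apply def_equiv
  | |- def (fun _ _ => exists _, _) => apply def_ex
  | |- def (fun _ _ => ?P) => apply def_const
  | |- def (fun X r => @?P X r -> @?Q X r) => apply (def_imp (P := P) (Q := Q))
  | |- def (fun X r => forall d, _) => apply def_all
  | |- def (fun X r => m_mem _ X) => apply def_mem_var
  | |- def (fun X r => m_mem _ ?Y) => apply def_mem_const
  | |- def (fun X r => ?R (@?a X r) (@?b X r) (@?c X r) (@?d X r)) =>
      apply (@def_app4 _ R a b c d); [find_def|..]
  | |- def (fun X r => ?R (@?a X r) (@?b X r) (@?c X r)) =>
      apply (@def_app3 _ R a b c); [find_def|..]
  | |- def (fun X r => ?R (@?a X r) (@?b X r)) =>
      apply (@def_app2 _ R a b); [find_def|..]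
  | |- def (fun X r => ?R (@?a X r)) =>
      apply (@def_app1 _ R a); [find_def|..]
  | |- deft (fun _ r => r _) => apply deft_var
  | |- deft (fun _ _ => _) => apply deft_const
  | |- deft (fun X r => if excluded_middle_informative _ then _ else _) => apply deft_if
  | |- deft (fun X r => ?f (@?a X r) (@?b X r) (@?c X r)) =>
      apply (@deft_app3 _ f a b c); [find_def|..]
  | |- deft (fun X r => ?f (@?a X r) (@?b X r)) =>
      apply (@deft_app2 _ f a b); [find_def|..]
  | |- deft (fun X r => ?f (@?a X r)) =>
      apply (@deft_app1 _ f a); [find_def|..]
  end.

Ltac ddef := repeat ddef_step.

Unset Strict Implicit.

(** * Arithmetic in a model *)

(** A structure without elements of the second sort admits no assignment and satisfies every
    formula vacuously, hence the last condition. *)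
Class ACA (M : model) : Prop := {
  basic : models M basic_axiom;
  set_induction : forall r u, sat M r u induction_axiom;
  comprehension : forall p, arithmetical p -> has_comprehension M p;
  has_set : exists X : sets M, True }.

Section Arithmetic.
Context {M : model} {HM : ACA M}.
Local Open Scope num_scope.
Notation D := (num M).
Notation set := (sets M).

Lemma comp_param (P : set -> (nat -> D) -> Prop) X : def P ->
  exists Y : set, forall n, n ∈ Y <-> P X (fun _ => n).
Proof.
  intros (p & f & a & Hp & H).
  pose (s := fun n => match f n with inl _ => Var 0 | inr _ => Var (S n) end).
  destruct (comprehension (p := subst s (fun n => n) p)) with
    (r := fun n => match f n with inl _ => m_zero : D | inr d => d end)
    (u := fun n => look_set X (a n)) as [Y HY]; [now apply arithmetical_subst|].
  exists Y. intro n. rewrite HY, H, sat_subst. apply sat_ext; auto.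
  intro i. unfold s. destruct (f i) eqn:E; simpl; rewrite ?E; auto.
Qed.

Lemma comp (P : D -> Prop) : def1 P -> exists Y : set, forall n, n ∈ Y <-> P n.
Proof.
  intro H. destruct has_set as [X _]. exact (comp_param X H).
Qed.


Lemma basic_at p : basic_axiom p -> exists u, sat M (fun _ => 0) u p.
Proof. intro H. destruct has_set as [X _]. exists (fun _ => X). now apply basic. Qed.

Lemma succ_neq0 (x : D) : x + 1 <> 0.
Proof. destruct (basic_at basic_succ_neq0) as [u H]. exact (H x). Qed.

Lemma succ_inj (x y : D) : x + 1 = y + 1 -> x = y.
Proof. destruct (basic_at basic_succ_inj) as [u H]. exact (H x y). Qed.

Lemma plus0 (x : D) : x + 0 = x.
Proof. destruct (basic_at basic_plus0) as [u H]. exact (H x). Qed.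

Lemma plusS (x y : D) : x + (y + 1) = x + y + 1.
Proof. destruct (basic_at basic_plusS) as [u H]. exact (H x y). Qed.

Lemma times0 (x : D) : x * 0 = 0.
Proof. destruct (basic_at basic_times0) as [u H]. exact (H x). Qed.

Lemma timesS (x y : D) : x * (y + 1) = x * y + x.
Proof. destruct (basic_at basic_timesS) as [u H]. exact (H x y). Qed.

Lemma not_lt0 (x : D) : ~ x < 0.
Proof. destruct (basic_at basic_lt0) as [u H]. exact (H x). Qed.

Lemma ltS (x y : D) : x < y + 1 <-> x < y \/ x = y.
Proof.
  destruct (basic_at basic_ltS) as [u H]. specialize (H x y). simpl in H. tauto.
Qed.

Lemma induction (P : D -> Prop) : def1 P -> P 0 -> (forall x, P x -> P (x + 1)) ->
  forall x, P x.
Proof.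
  intros HP H0 HS x. destruct (comp HP) as [Y HY]. apply HY.
  generalize (@set_induction M HM (fun _ => 0) (fun _ => Y)). simpl. intro H. specialize (H Y).
  simpl in H.
  apply H. intro K. apply K.
  - now apply HY.
  - intros d Hd. apply HY, HS, HY, Hd.
Qed.

Ltac ind x := pattern x; apply induction; [ddef| |clear x; intros x].

Lemma plus0l (x : D) : 0 + x = x.
Proof. ind x; [apply plus0|]. intro H. now rewrite plusS, H. Qed.

Lemma plusSl (x y : D) : x + 1 + y = x + y + 1.
Proof. ind y; [now rewrite !plus0|]. intro H. now rewrite !plusS, H. Qed.

Lemma plus_comm (x y : D) : x + y = y + x.
Proof. ind y; [now rewrite plus0, plus0l|]. intro H. now rewrite plusS, plusSl, H. Qed.

Lemma plus_assoc (x y z : D) : x + (y + z) = x + y + z.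
Proof. ind z; [now rewrite !plus0|]. intro H. now rewrite !plusS, H. Qed.

Lemma times0l (x : D) : 0 * x = 0.
Proof. ind x; [apply times0|]. intro H. now rewrite timesS, H, plus0. Qed.

Lemma timesSl (x y : D) : (x + 1) * y = x * y + y.
Proof.
  ind y; [now rewrite !times0, plus0|]. intro H.
  rewrite !timesS, H, !plusS. f_equal. rewrite <- !plus_assoc. f_equal. apply plus_comm.
Qed.

Lemma times_comm (x y : D) : x * y = y * x.
Proof. ind y; [now rewrite times0, times0l|]. intro H. now rewrite timesS, timesSl, H. Qed.

Lemma times_plus (x y z : D) : (x + y) * z = x * z + y * z.
Proof.
  ind z; [now rewrite !times0, plus0|]. intro H. rewrite !timesS, H.
  rewrite <- !plus_assoc. f_equal. rewrite !plus_assoc. f_equal. apply plus_comm.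
Qed.

Lemma times_assoc (x y z : D) : x * (y * z) = x * y * z.
Proof.
  ind z; [now rewrite !times0|]. intro H.
  rewrite !timesS, <- H. rewrite (times_comm x (y * z + y)), times_plus.
  f_equal; apply times_comm.
Qed.

Lemma times1l (x : D) : 1 * x = x.
Proof. rewrite <- (plus0l 1), timesSl, times0l. apply plus0l. Qed.

Lemma num_semiring : semi_ring_theory 0 1 (@m_plus M) (@m_times M) eq.
Proof.
  constructor; auto using plus0l, plus_comm, plus_assoc, times1l, times0l, times_comm,
    times_assoc, times_plus.
Qed.

Add Ring num_ring : num_semiring.

Lemma plus_cancel (x y z : D) : x + z = y + z -> x = y.
Proof. ind z; [now rewrite !plus0|]. intros H K. apply H, succ_inj. now rewrite <- !plusS. Qed.

Lemma zero_or_succ (x : D) : x = 0 \/ exists y, x = y + 1.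
Proof. ind x; [now left|]. intros _. right. now exists x. Qed.

Lemma plus_eq0 (x y : D) : x + y = 0 -> x = 0 /\ y = 0.
Proof.
  destruct (zero_or_succ y) as [->|[z ->]].
  - now rewrite plus0.
  - rewrite plusS. intro H. now apply succ_neq0 in H.
Qed.

(** ** Order *)

Definition le (x y : D) : Prop := exists z, y = x + z.
Notation "x <= y" := (le x%num y%num) : num_scope.

Lemma def2_le : def2 le.
Proof. unfold le. ddef. Qed.
Hint Resolve def2_le : def.

Lemma lt_le (x y : D) : x < y <-> x + 1 <= y.
Proof.
  unfold le. ind y.
  - split; intro H; [now apply not_lt0 in H|]. destruct H as [z Hz].
    symmetry in Hz. apply plus_eq0 in Hz as [H _]. now apply succ_neq0 in H.
  - intro IH. rewrite ltS, IH. split.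
    + intros [[z ->]| ->]; [exists (z + 1)|exists 0]; ring.
    + intros [z Hz]. destruct (zero_or_succ z) as [->|[z' ->]].
      * right. apply succ_inj. rewrite Hz. ring.
      * left. exists z'. apply succ_inj. rewrite Hz. ring.
Qed.

Lemma le_refl (x : D) : x <= x.
Proof. exists 0. ring. Qed.

Lemma le_trans (x y z : D) : x <= y -> y <= z -> x <= z.
Proof. intros [a ->] [b ->]. exists (a + b). ring. Qed.

Lemma le0 (x : D) : 0 <= x.
Proof. exists x. ring. Qed.

Lemma le_antisym (x y : D) : x <= y -> y <= x -> x = y.
Proof.
  intros [a ->] [b Hb]. assert (a + b = 0) as H.
  { apply (@plus_cancel _ _ x). rewrite plus0l. rewrite Hb at 2. ring. }
  apply plus_eq0 in H as [-> _]. ring.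
Qed.

Lemma le_or_lt (x y : D) : x <= y \/ y < x.
Proof.
  ind y.
  - destruct (zero_or_succ x) as [->|[z ->]]; [left; apply le_refl|right].
    apply lt_le. exists z. ring.
  - intros [[z ->]|H].
    + left. exists (z + 1). ring.
    + apply lt_le in H as [z ->]. destruct (zero_or_succ z) as [->|[z' ->]].
      * left. exists 0. ring.
      * right. apply lt_le. exists z'. ring.
Qed.

Lemma lt_irrefl (x : D) : ~ x < x.
Proof.
  rewrite lt_le. intros [z Hz]. apply (@succ_neq0 z), (@plus_cancel _ _ x).
  rewrite plus0l. rewrite Hz at 2. ring.
Qed.

Lemma lt_le_incl (x y : D) : x < y -> x <= y.
Proof. rewrite lt_le. intros [z ->]. exists (1 + z). ring. Qed.

Lemma le_lt_trans (x y z : D) : x <= y -> y < z -> x < z.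
Proof. rewrite !lt_le. intros [a ->] [b ->]. exists (a + b). ring. Qed.

Lemma lt_le_trans (x y z : D) : x < y -> y <= z -> x < z.
Proof. rewrite !lt_le. intros [a ->] [b ->]. exists (a + b). ring. Qed.

Lemma lt_not_le (x y : D) : x < y -> ~ y <= x.
Proof. intros H K. apply (@lt_irrefl x). eapply lt_le_trans; eauto. Qed.

Lemma le_lt_eq (x y : D) : x <= y <-> x < y \/ x = y.
Proof.
  split.
  - intro H. destruct (le_or_lt y x) as [K|K]; auto. right. now apply le_antisym.
  - intros [H| ->]; auto using lt_le_incl, le_refl.
Qed.

Lemma lt_trichotomy (x y : D) : x < y \/ x = y \/ y < x.
Proof. destruct (le_or_lt x y) as [H|H]; auto. apply le_lt_eq in H. tauto. Qed.

Lemma lt_succ (x : D) : x < x + 1.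
Proof. apply ltS. auto. Qed.

Lemma lt_succ_le (x y : D) : x < y + 1 <-> x <= y.
Proof. rewrite ltS, le_lt_eq. tauto. Qed.

Lemma pos_succ (x : D) : x <> 0 -> exists y, x = y + 1.
Proof. destruct (zero_or_succ x); tauto. Qed.

Lemma strong_induction (P : D -> Prop) : def1 P ->
  (forall x, (forall y, y < x -> P y) -> P x) -> forall x, P x.
Proof.
  intros HP H x. apply H. ind x; [intros y K; now apply not_lt0 in K|].
  intros IH y K. apply ltS in K as [K| ->]; auto.
Qed.

Lemma least (P : D -> Prop) : def1 P -> (exists x, P x) ->
  exists x, P x /\ forall y, y < x -> ~ P y.
Proof.
  intros HP [x Hx]. apply NNPP. intro N. revert Hx.
  pattern x. apply strong_induction; [ddef|].
  clear x. intros x IH Hx. apply N. exists x. auto.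
Qed.

(** ** Pairs *)

Definition pair (x y : D) : D := (x + y) * (x + y) + x.

Lemma deff2_pair : deff2 pair.
Proof. unfold pair. ddef. Qed.
Hint Resolve deff2_pair : def.

Lemma pair_inj (x y x' y' : D) : pair x y = pair x' y' -> x = x' /\ y = y'.
Proof.
  assert (L : forall x y x' y' : D, x + y < x' + y' -> pair x y < pair x' y').
  { clear x y x' y'. intros x y x' y' H. unfold pair. apply lt_le in H as [z ->].
    apply lt_le. exists (z * z + (1 + 1) * z * (x + y + 1) + x + y + y + x').
    ring. }
  intro E. destruct (lt_trichotomy (x + y) (x' + y')) as [H|[H|H]].
  - apply L in H. rewrite E in H. now apply lt_irrefl in H.
  - unfold pair in E. rewrite H, (plus_comm _ x), (plus_comm _ x') in E.
    apply plus_cancel in E as ->. split; auto.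
    rewrite (plus_comm x' y), (plus_comm x' y') in H. now apply plus_cancel in H.
  - apply L in H. rewrite E in H. now apply lt_irrefl in H.
Qed.

Lemma square_le (x : D) : x <= x * x.
Proof. destruct (zero_or_succ x) as [->|[y ->]]; [exists 0|exists (y * y + y)]; ring. Qed.

Lemma le_pair_l (x y : D) : x <= pair x y.
Proof. exists ((x + y) * (x + y)). unfold pair. ring. Qed.

Lemma le_pair_r (x y : D) : y <= pair x y.
Proof.
  destruct (square_le (x + y)) as [z Hz]. exists (x + z + x).
  unfold pair. rewrite Hz. ring.
Qed.

Lemma lt_pair_r (x y : D) : x <> 0 -> y < pair x y.
Proof.
  intro H. apply pos_succ in H as [z ->]. apply lt_le.
  destruct (square_le (z + 1 + y)) as [w Hw]. exists (z + w + z + 1).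
  unfold pair. rewrite Hw. ring.
Qed.

(** Definite description: a function introduced in this way by a definable condition has a
    definable graph. *)
Definition the (P : D -> Prop) : D :=
  if excluded_middle_informative (exists x, P x) then epsilon (inhabits 0) P else 0.

Lemma the_eq (P : D -> Prop) x : (forall y, P y -> y = x) -> P x -> the P = x.
Proof.
  intros U Hx. unfold the. destruct (excluded_middle_informative _) as [E|N].
  - apply U. now apply epsilon_spec.
  - exfalso. eauto.
Qed.

Lemma deft_the (P : set -> (nat -> D) -> D -> Prop) :
  def (fun X r => P X (fun i => r (S i)) (r O)) ->
  (forall X r x y, P X r x -> P X r y -> x = y) -> deft (fun X r => the (P X r)).
Proof.
  intros HP U. unfold deft.
  apply def_iff with (fun X r =>
    P X (fun i => r (S i)) (r O) \/ ((~ exists x, P X (fun i => r (S i)) x) /\ r O = 0)).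
  - intros X r. split.
    + intros [H|[N E]].
      * symmetry. apply the_eq; eauto.
      * unfold the. destruct (excluded_middle_informative _); tauto.
    + intro E. unfold the in E. destruct (excluded_middle_informative _); auto.
      left. rewrite E. now apply epsilon_spec.
  - apply def_or; auto. apply def_and; [|ddef]. apply def_not, def_ex.
    exact (def_ren (fun n => match n with O => O | S n => S (S n) end) HP).
Qed.

Definition the_least (P : D -> Prop) : D := the (fun x => P x /\ forall y, y < x -> ~ P y).

Lemma least_unique (P : D -> Prop) x y : (P x /\ forall z, z < x -> ~ P z) ->
  (P y /\ forall z, z < y -> ~ P z) -> x = y.
Proof.
  intros [Hx Lx] [Hy Ly]. destruct (lt_trichotomy x y) as [H|[H|H]]; auto; exfalso.
  - now apply (Ly x).
  - now apply (Lx y).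
Qed.

Lemma the_least_spec (P : D -> Prop) : def1 P -> (exists x, P x) -> P (the_least P).
Proof.
  intros HP Hx. destruct (least HP Hx) as [x Lx]. unfold the_least.
  rewrite (@the_eq _ x); [apply Lx| |exact Lx].
  intros y Ly. eapply least_unique; eauto.
Qed.

Lemma deft_the_least (P : set -> (nat -> D) -> D -> Prop) :
  def (fun X r => P X (fun i => r (S i)) (r O)) -> deft (fun X r => the_least (P X r)).
Proof.
  intro HP. apply (@deft_the (fun X r x => P X r x /\ forall y, y < x -> ~ P X r y)).
  - apply def_and; auto. apply def_all, def_imp; [ddef|]. apply def_not.
    exact (def_ren (fun n => match n with O => O | S n => S (S n) end) HP).
  - intros X r x y. apply least_unique.
Qed.

Definition fst (z : D) : D := the (fun x => exists y, z = pair x y).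
Definition snd (z : D) : D := the (fun y => exists x, z = pair x y).

Lemma fst_pair (x y : D) : fst (pair x y) = x.
Proof.
  unfold fst. apply the_eq; eauto. intros a [b H]. apply pair_inj in H as [H _]. auto.
Qed.

Lemma snd_pair (x y : D) : snd (pair x y) = y.
Proof.
  unfold snd. apply the_eq; eauto. intros a [b H]. apply pair_inj in H as [_ H]. auto.
Qed.

Lemma deff1_fst : deff1 fst.
Proof.
  apply (@deft_the (fun _ r x => exists y, r O = pair x y)); [ddef|].
  intros _ r x y [a Ha] [b Hb]. rewrite Ha in Hb. now apply pair_inj in Hb.
Qed.

Lemma deff1_snd : deff1 snd.
Proof.
  apply (@deft_the (fun _ r y => exists x, r O = pair x y)); [ddef|].
  intros _ r x y [a Ha] [b Hb]. rewrite Ha in Hb. now apply pair_inj in Hb.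
Qed.
Hint Resolve deff1_fst deff1_snd : def.

(** ** Coding finite sets *)

Definition divides (d a : D) : Prop := exists q, a = d * q.

Lemma def2_divides : def2 divides.
Proof. unfold divides. ddef. Qed.
Hint Resolve def2_divides : def.

Lemma divides_mul (d a q : D) : divides d a -> divides d (a * q).
Proof. intros [r ->]. exists (r * q). ring. Qed.

Lemma divides_add_inv (d x y : D) : divides (d + 1) y -> divides (d + 1) (x + y) ->
  divides (d + 1) x.
Proof.
  intros [r ->] [q E]. destruct (le_or_lt r q) as [[s ->]|H].
  - exists s. apply (@plus_cancel _ _ ((d + 1) * r)). rewrite E. ring.
  - exfalso. apply lt_le in H as [s ->].
    assert (x + (d + (d + 1) * s) + 1 = 0) as K.
    { apply (@plus_cancel _ _ ((d + 1) * q)). rewrite plus0l. rewrite <- E at 2. ring. }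
    now apply succ_neq0 in K.
Qed.

Definition modulus (b i : D) : D := (i + 1) * b + 1.

(** Moduli whose indices differ by a divisor of [b] are coprime to each other, as each
    of them is coprime to [b]. *)
Lemma modulus_coprime (a b i p : D) : divides p b ->
  divides (modulus b i) (a * (p * b)) -> divides (modulus b i) a.
Proof.
  unfold modulus. intros [c Hc] H. set (u := (i + 1) * b) in *.
  assert (H1 : divides (u + 1) (a * (u * u))).
  { apply (@divides_mul _ _ (c * (i + 1) * (i + 1))) in H.
    replace (a * (u * u)) with (a * (p * b) * (c * (i + 1) * (i + 1))); auto.
    unfold u. rewrite Hc. ring. }
  assert (H2 : divides (u + 1) (a * u)).
  { apply divides_add_inv with (a * (u * u)); auto. exists (a * u). ring. }
  apply divides_add_inv with (a * u); auto. exists a. ring.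
Qed.

Lemma modulus_step (a b i j k : D) :
  (forall p, p < k -> divides (p + 1) b) -> i < k -> j < k -> i <> j ->
  divides (modulus b i) (a * modulus b j) -> divides (modulus b i) a.
Proof.
  intros Hb Hi Hj N H.
  destruct (lt_trichotomy i j) as [L|[L|L]]; [|tauto|]; apply lt_le in L as [p ->].
  - apply modulus_coprime with (p + 1).
    + apply Hb. eapply le_lt_trans; [|apply Hj]. exists (i + 1). ring.
    + apply divides_add_inv with (a * modulus b i); [exists a; unfold modulus; ring|].
      fold (modulus b i).
      replace (a * ((p + 1) * b) + a * modulus b i) with (a * modulus b (i + 1 + p)); auto.
      unfold modulus. ring.
  - apply modulus_coprime with (p + 1).
    + apply Hb. eapply le_lt_trans; [|apply Hi]. exists (j + 1). ring.
    + apply divides_add_inv with (a * modulus b j); auto.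
      exists a. unfold modulus. ring.
Qed.

Lemma factorial (k : D) : exists b, b <> 0 /\ forall i, i < k -> divides (i + 1) b.
Proof.
  ind k.
  - exists 1. split; [rewrite <- (plus0l 1); apply succ_neq0|].
    intros i H. now apply not_lt0 in H.
  - intros [b [Hb H]]. exists (b * (k + 1)). split.
    + rewrite timesS. intro E. apply plus_eq0 in E. tauto.
    + intros i Hi. apply ltS in Hi as [Hi| ->]; auto using divides_mul.
      exists b. ring.
Qed.

Lemma times_eq0 (x y : D) : x * y = 0 -> x = 0 \/ y = 0.
Proof.
  destruct (zero_or_succ y) as [->|[z ->]]; auto.
  rewrite timesS. intro H. apply plus_eq0 in H. tauto.
Qed.

(** The moduli that belong to a common multiple [b] of 1, ..., [k] are coprime, so that the
    product of some of them is divisible by no other one. *)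
Lemma finite_set_code (P : D -> Prop) (k : D) : def1 P ->
  exists a b, forall i, i < k -> (divides (modulus b i) a <-> P i).
Proof.
  intro HP. destruct (factorial k) as [b [Hb Hd]].
  assert (H : forall j, j <= k ->
            exists a, forall i, i < k -> (divides (modulus b i) a <-> P i /\ i < j)).
  { intro j. unfold modulus. ind j.
    - intros _. exists 1. intros i Hi. split; [|intros [_ H]; now apply not_lt0 in H].
      intros [q Hq]. exfalso. destruct (zero_or_succ q) as [->|[q' ->]].
      + rewrite times0 in Hq. rewrite <- (plus0l 1) in Hq.
        now apply succ_neq0 in Hq.
      + assert (E : (i + 1) * b + ((i + 1) * b + 1) * q' = 0).
        { apply succ_inj. rewrite plus0l.
          transitivity (((i + 1) * b + 1) * (q' + 1)); [ring|now symmetry]. }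
        apply plus_eq0 in E as [E _]. apply times_eq0 in E as [E|E]; auto.
        now apply succ_neq0 in E.
    - intros IH Hk. destruct IH as [a Ha].
      { eapply le_trans; [|apply Hk]. exists 1. ring. }
      assert (Hj : j < k) by (now apply lt_le).
      destruct (classic (P j)) as [Pj|Pj].
      + exists (a * modulus b j). intros i Hi.
        destruct (classic (i = j)) as [->|N].
        * split; [split; auto using lt_succ|]. intros _. exists a. unfold modulus. ring.
        * rewrite ltS.
          split; [|intros [Pi [L|L]]; [|tauto]; now apply divides_mul, Ha].
          intro H. apply modulus_step with (k := k) in H; auto.
          apply Ha in H; tauto.
      + exists a. intros i Hi. rewrite Ha, ltS by auto.
        split; [tauto|]. intros [Pi [L| ->]]; tauto. }
  destruct (H k (le_refl k)) as [a Ha]. exists a, b. intros i Hi.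
  rewrite Ha by auto. tauto.
Qed.

Definition elt (y c : D) : Prop :=
  y < fst c /\ divides (modulus (snd (snd c)) y) (fst (snd c)).

Lemma def2_elt : def2 elt.
Proof. unfold elt, modulus. ddef. Qed.
Hint Resolve def2_elt : def.

Lemma code_bounded (P : D -> Prop) (k : D) : def1 P ->
  exists c, forall y, elt y c <-> y < k /\ P y.
Proof.
  intro HP. destruct (finite_set_code k HP) as (a & b & H).
  exists (pair k (pair a b)). intro y. unfold elt. rewrite !snd_pair, !fst_pair.
  split; intros [K L]; specialize (H y K); tauto.
Qed.

Lemma code_insert (c z : D) : exists c', forall y, elt y c' <-> elt y c \/ y = z.
Proof.
  destruct (@code_bounded (fun y => elt y c \/ y = z) (fst c + z + 1)) as [c' H]; [ddef|].
  exists c'. intro y. rewrite H. split; [tauto|]. intro K. split; auto.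
  apply lt_succ_le. destruct K as [[K _]| ->].
  - apply lt_le_incl. eapply lt_le_trans; [apply K|]. now exists z.
  - exists (fst c). ring.
Qed.

(** ** Recursion *)

(** Finite derivations, coded as finite sets, make a linear inductive definition
    arithmetical. *)
Lemma inductive_definition (B : D -> Prop) (T : D -> D -> Prop) : def1 B -> def2 T ->
  exists F : D -> Prop, def1 F /\ forall z, F z <-> B z \/ exists z', T z z' /\ F z'.
Proof.
  intros HB HT.
  exists (fun z => exists c, elt z c /\
            forall x, elt x c -> B x \/ exists x', T x x' /\ elt x' c).
  split; [ddef|]. intro z. split.
  - intros (c & Hz & Hc). destruct (Hc z Hz) as [H|(z' & H & Hz')]; eauto 6.
  - intros [H|(z' & H & c & Hz' & Hc)].
    + destruct (@code_bounded (fun y => y = z) (z + 1)) as [c Hc]; [ddef|].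
      exists c. split; [apply Hc; split; auto using lt_succ|].
      intros x Hx. apply Hc in Hx as [_ ->]. auto.
    + destruct (code_insert c z) as [c' Hc']. exists c'. split; [now apply Hc'; right|].
      intros x Hx. apply Hc' in Hx as [Hx| ->].
      * destruct (Hc x Hx) as [K|(x' & K & Hx')]; auto.
        right. exists x'. split; auto. apply Hc'. auto.
      * right. exists z'. split; auto. apply Hc'. auto.
Qed.

(** The decreasing measure makes the derivable value exist and be unique. *)
Theorem recursion (c : D -> Prop) (t mu base : D -> D) (step : D -> D -> D) :
  def1 c -> deff1 t -> deff1 mu -> deff1 base -> deff2 step ->
  (forall x, c x -> mu (t x) < mu x) ->
  exists f : D -> D, deff1 f /\ forall x,
    f x = if excluded_middle_informative (c x) then step x (f (t x)) else base x.
Proof.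
  intros Hc Ht Hmu Hb Hs Hlt.
  destruct (@inductive_definition
    (fun z => ~ c (fst z) /\ z = pair (fst z) (base (fst z)))
    (fun z z' => c (fst z) /\ z' = pair (t (fst z)) (snd z') /\
                 z = pair (fst z) (step (fst z) (snd z')))) as (F & HF & E);
    [ddef|ddef|].
  assert (E' : forall x v, F (pair x v) <->
    (~ c x /\ v = base x) \/ (c x /\ exists w, F (pair (t x) w) /\ v = step x w)).
  { intros x v. rewrite E, fst_pair. split.
    - intros [[H K]|(z' & (H & K & L) & Hz')].
      + left. split; auto. now apply pair_inj in K as [_ K].
      + right. split; auto. exists (snd z'). rewrite <- K. apply pair_inj in L. tauto.
    - intros [[H ->]|[H (w & Hw & ->)]]; auto.
      right. exists (pair (t x) w). rewrite snd_pair. auto. }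
  assert (U : forall n x, mu x = n -> exists v, F (pair x v) /\
                forall v', F (pair x v') -> v' = v).
  { intro n. pattern n. apply strong_induction; [ddef|].
    clear n. intros n IH x Hx. destruct (classic (c x)) as [C|C].
    - destruct (IH (mu (t x))) with (x := t x) as (w & Hw & Uw); auto.
      { rewrite <- Hx. auto. }
      exists (step x w). split; [apply E'; right; eauto|].
      intros v' Hv'. apply E' in Hv' as [[N _]|[_ (w' & Hw' & ->)]]; [tauto|].
      now rewrite (Uw w').
    - exists (base x). split; [apply E'; auto|].
      intros v' Hv'. apply E' in Hv' as [[_ H]|[H _]]; tauto. }
  assert (Uniq : forall x v w, F (pair x v) -> F (pair x w) -> v = w).
  { intros x v w Hv Hw. destruct (U (mu x) x eq_refl) as (v0 & _ & H).
    now rewrite (H v), (H w). }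
  pose (f := fun x => the (fun v => F (pair x v))).
  assert (Hf : forall x, F (pair x (f x))).
  { intro x. destruct (U (mu x) x eq_refl) as (v & Hv & H).
    unfold f. rewrite (the_eq H); auto. }
  exists f. split.
  - apply (@deft_the (fun _ r v => F (pair (r O) v))); [ddef|]. eauto.
  - intro x. destruct (excluded_middle_informative (c x)) as [C|C];
      apply Uniq with x; auto; apply E'; eauto.
Qed.

Lemma iteration (s0 : D) (g : D -> D -> D) : deff2 g ->
  exists s : D -> D, deff1 s /\ s 0 = s0 /\ forall n, s (n + 1) = g n (s n).
Proof.
  intro Hg.
  pose (pred := fun x => the (fun y => x = y + 1)).
  assert (Hp : forall x, pred (x + 1) = x).
  { intro x. apply the_eq; auto. intros y H. now apply succ_inj. }
  assert (Dp : deff1 pred).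
  { apply (@deft_the (fun _ r y => r O = y + 1)); [ddef|].
    intros X r x y H K. apply succ_inj. congruence. }
  destruct (@recursion (fun x => x <> 0) pred (fun x => x) (fun _ => s0)
              (fun x v => g (pred x) v)) as (s & Ds & E); [ddef..| |].
  - intros x Hx. apply pos_succ in Hx as [y ->]. rewrite Hp. apply lt_succ.
  - exists s. split; [exact Ds|split].
    + rewrite E. destruct (excluded_middle_informative _); tauto.
    + intro n. rewrite E, Hp. destruct (excluded_middle_informative _) as [|N]; auto.
      exfalso. apply N. apply succ_neq0.
Qed.

End Arithmetic.

Notation "x <= y" := (le x%num y%num) : num_scope.
#[export] Hint Resolve def2_le deff2_pair def2_divides def2_elt : def.
#[export] Hint Extern 1 (deff1 fst) => apply deff1_fst : def.
#[export] Hint Extern 1 (deff1 snd) => apply deff1_snd : def.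
#[export] Hint Extern 1 (def2 elt) => apply def2_elt : def.

(** * The Grätzer–Schmidt property of a model *)

(** Each definition repeats the formula of the same meaning connective by connective, so that
    the formula and its reading are equivalent by unfolding. *)

Section Properties.
Variable M : model.
Local Open Scope num_scope.
Notation D := (num M).
Notation set := (sets M).

Definition subset (X Y : D -> Prop) : Prop := forall n, X n -> Y n.
Definition same (X Y : D -> Prop) : Prop := forall n, X n <-> Y n.
Definition col (E : set) (i n : D) : Prop := pair i n ∈ E.
Definition bounded_set (X : set) : Prop := exists k, forall i, i ∈ X -> i < k.

Definition beta (a b i y : D) : Prop :=
  y < (i + 1) * b + 1 /\ exists q, a = q * ((i + 1) * b + 1) + y.

Definition seq_code (n s : D) : Prop :=
  exists a b, s = pair n (pair a b) /\
    forall a' b', pair a' b' < pair a b ->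
      exists i, i < n /\ exists y, beta a b i y /\ ~ beta a' b' i y.

Definition entry (s i y : D) : Prop :=
  exists n a b, s = pair n (pair a b) /\ i < n /\ beta a b i y.

Definition seq_in (A : set) (n s : D) : Prop :=
  seq_code n s /\ forall i y, entry s i y -> y ∈ A.

Section Lattices.
Variables L R : set.

Definition below (x y : D) : Prop := pair x y ∈ R.

Definition poset : Prop :=
  (forall x, x ∈ L -> below x x) /\
  (forall x, x ∈ L -> forall y, y ∈ L -> below x y -> below y x -> x = y) /\
  (forall x, x ∈ L -> forall y, y ∈ L -> forall z, z ∈ L ->
     below x y -> below y z -> below x z).

Definition is_sup (X : D -> Prop) (x : D) : Prop :=
  x ∈ L /\ (forall s, X s -> below s x) /\
  forall u, u ∈ L -> (forall s, X s -> below s u) -> below x u.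

Definition is_inf (X : D -> Prop) (x : D) : Prop :=
  x ∈ L /\ (forall s, X s -> below x s) /\
  forall u, u ∈ L -> (forall s, X s -> below u s) -> below u x.

Definition is_join (x y : D) : D -> Prop := is_sup (fun s => s = x \/ s = y).
Definition is_meet (x y : D) : D -> Prop := is_inf (fun s => s = x \/ s = y).

Definition lattice : Prop :=
  poset /\ forall x, x ∈ L -> forall y, y ∈ L ->
    (exists z, is_join x y z) /\ (exists z, is_meet x y z).

Definition complete : Prop :=
  forall X : set, subset (fun n => n ∈ X) (fun n => n ∈ L) ->
    (exists x, is_sup (fun n => n ∈ X) x) /\ (exists x, is_inf (fun n => n ∈ X) x).

Definition compact (a : D) : Prop :=
  a ∈ L /\ forall X : set, subset (fun n => n ∈ X) (fun n => n ∈ L) ->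
    forall x, is_sup (fun n => n ∈ X) x -> below a x ->
      exists Y : set, bounded_set Y /\ subset (fun n => n ∈ Y) (fun n => n ∈ X) /\
        exists y, is_sup (fun n => n ∈ Y) y /\ below a y.

Definition algebraic : Prop :=
  lattice /\ complete /\
  forall x, x ∈ L -> exists X : set,
    (forall c, c ∈ X -> compact c) /\ is_sup (fun n => n ∈ X) x.

Definition distributive : Prop :=
  forall x, x ∈ L -> forall y, y ∈ L -> forall z, z ∈ L -> forall yz xyz xy xz,
    is_join y z yz -> is_meet x yz xyz -> is_meet x y xy -> is_meet x z xz ->
    is_join xy xz xyz.

End Lattices.

Definition algebra (A I N F : set) : Prop :=
  (forall i, i ∈ I -> exists n, pair i n ∈ N /\ forall m, pair i m ∈ N -> m = n) /\
  (forall i, i ∈ I -> forall n s, pair i n ∈ N -> seq_in A n s ->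
     exists y, y ∈ A /\ pair (pair i s) y ∈ F /\
       forall z, pair (pair i s) z ∈ F -> z = y).

Definition congruence (A I N F : set) (X : D -> Prop) : Prop :=
  (forall n, X n -> exists a b, a ∈ A /\ b ∈ A /\ n = pair a b) /\
  (forall a, a ∈ A -> X (pair a a)) /\
  (forall a b, X (pair a b) -> X (pair b a)) /\
  (forall a b c, X (pair a b) -> X (pair b c) -> X (pair a c)) /\
  (forall i, i ∈ I -> forall n s t y z, pair i n ∈ N -> seq_in A n s -> seq_in A n t ->
     (forall j u v, entry s j u -> entry t j v -> X (pair u v)) ->
     pair (pair i s) y ∈ F -> pair (pair i t) z ∈ F -> X (pair y z)).

Definition isomorphism (L R E P : set) : Prop :=
  (forall x, x ∈ L -> exists i, pair x i ∈ P /\ forall j, pair x j ∈ P -> j = i) /\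
  (forall x, x ∈ L -> forall y, y ∈ L -> forall i j, pair x i ∈ P -> pair y j ∈ P ->
     (below R x y <-> subset (col E i) (col E j))) /\
  (forall i, exists x, x ∈ L /\ exists j, pair x j ∈ P /\ same (col E i) (col E j)).

Definition representable (L R : set) : Prop :=
  exists A I N F : set, algebra A I N F /\
    exists E : set, (forall i, congruence A I N F (col E i)) /\
      (forall X : set, congruence A I N F (fun n => n ∈ X) ->
         exists i, same (fun n => n ∈ X) (col E i)) /\
      exists P : set, isomorphism L R E P.

End Properties.

Lemma sat_Imp_iff M r u p q P Q : (sat M r u p <-> P) -> (sat M r u q <-> Q) ->
  (sat M r u (Imp p q) <-> (P -> Q)).
Proof. simpl. tauto. Qed.

Lemma sat_And_iff M r u p q P Q : (sat M r u p <-> P) -> (sat M r u q <-> Q) ->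
  (sat M r u (And p q) <-> P /\ Q).
Proof. rewrite sat_And. tauto. Qed.

Lemma sat_Or_iff M r u p q P Q : (sat M r u p <-> P) -> (sat M r u q <-> Q) ->
  (sat M r u (Or p q) <-> P \/ Q).
Proof. rewrite sat_Or. tauto. Qed.

Lemma sat_Iff_iff M r u p q P Q : (sat M r u p <-> P) -> (sat M r u q <-> Q) ->
  (sat M r u (Iff p q) <-> (P <-> Q)).
Proof. rewrite sat_Iff. tauto. Qed.

Lemma sat_Neg_iff M r u p P : (sat M r u p <-> P) -> (sat M r u (Neg p) <-> ~ P).
Proof. rewrite sat_Neg. tauto. Qed.

Lemma sat_AllNum_iff M r u p P : (forall d, sat M (scons d r) u p <-> P d) ->
  (sat M r u (AllNum p) <-> forall d, P d).
Proof. intro H. simpl. split; intros K d; now apply H. Qed.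

Lemma sat_AllSet_iff M r u p P : (forall X, sat M r (scons X u) p <-> P X) ->
  (sat M r u (AllSet p) <-> forall X, P X).
Proof. intro H. simpl. split; intros K d; now apply H. Qed.

Lemma sat_ExNum_iff M r u p P : (forall d, sat M (scons d r) u p <-> P d) ->
  (sat M r u (ExNum p) <-> exists d, P d).
Proof. intro H. rewrite sat_ExNum. split; intros [d K]; exists d; now apply H. Qed.

Lemma sat_ExSet_iff M r u p P : (forall X, sat M r (scons X u) p <-> P X) ->
  (sat M r u (ExSet p) <-> exists X, P X).
Proof. intro H. rewrite sat_ExSet. split; intros [d K]; exists d; now apply H. Qed.

Ltac sat_iff :=
  repeat match goal with
  | |- sat _ _ _ (Neg _) <-> _ => apply sat_Neg_iff
  | |- sat _ _ _ (And _ _) <-> _ => apply sat_And_iff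
  | |- sat _ _ _ (Or _ _) <-> _ => apply sat_Or_iff
  | |- sat _ _ _ (Iff _ _) <-> _ => apply sat_Iff_iff
  | |- sat _ _ _ (Imp _ _) <-> _ => apply sat_Imp_iff
  | |- sat _ _ _ (ExNum _) <-> _ => apply sat_ExNum_iff; intro
  | |- sat _ _ _ (ExSet _) <-> _ => apply sat_ExSet_iff; intro
  | |- sat _ _ _ (AllNum _) <-> _ => apply sat_AllNum_iff; intro
  | |- sat _ _ _ (AllSet _) <-> _ => apply sat_AllSet_iff; intro
  | |- sat _ _ _ _ <-> _ => apply iff_refl
  end.

Ltac normalize_form :=
  match goal with
  | |- sat ?M ?r ?u ?p <-> _ =>
      let q := eval cbv -[And Or Neg Iff ExNum ExSet] in p in
      change p with q
  end.

Ltac unfold_properties :=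
  unfold algebraic, distributive, lattice, complete, poset, compact, is_join, is_meet, is_sup,
    is_inf, representable, algebra, congruence, isomorphism, seq_in, seq_code, entry, beta,
    subset, same, bounded_set, col, below.

Lemma sat_GS M r u :
  sat M r u GS_axiom <-> forall L R : sets M, algebraic L R -> representable L R.
Proof. normalize_form. unfold_properties. sat_iff. Qed.

Lemma sat_GSD M r u :
  sat M r u GSD_axiom <->
  forall L R : sets M, algebraic L R /\ distributive L R -> representable L R.
Proof. normalize_form. unfold_properties. sat_iff. Qed.

(** * The three theories and their models *)

Lemma basic_subst f a p : basic_axiom p -> subst f a p = p.
Proof. now destruct 1. Qed.

Lemma comprehension_subst f a p :
  subst f a (comprehension_for p) = comprehension_for (subst (up_num f) a p).
Proof. unfold comprehension_for. rewrite <- subst_shift_set. reflexivity. Qed.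

Lemma ACA0_subst_closed : subst_closed ACA0.
Proof.
  intros f a p [q H| |q H].
  - rewrite basic_subst; auto using ACA0_basic.
  - apply ACA0_induction.
  - rewrite comprehension_subst. apply ACA0_comp. now apply arithmetical_subst.
Qed.

Lemma Pi11CA0_subst_closed : subst_closed Pi11CA0.
Proof.
  intros f a p [q H| |q [q' [H ->]]].
  - rewrite basic_subst; auto using Pi11CA0_basic.
  - apply Pi11CA0_induction.
  - rewrite comprehension_subst. apply Pi11CA0_comp. simpl.
    eexists. split; [|reflexivity]. now apply arithmetical_subst.
Qed.

Lemma ACA0_model M : models M ACA0 -> (exists X : sets M, True) -> ACA M.
Proof.
  intros H HX. split; [| | |assumption].
  - intros p Hp. apply H. now apply ACA0_basic.
  - intros r u. apply H. apply ACA0_induction.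
  - intros p Hp. apply sat_comprehension. intros r u. apply H. now apply ACA0_comp.
Qed.

(** A dummy set quantifier makes an arithmetical formula Pi^1_1. *)
Lemma Pi11CA0_model M : models M Pi11CA0 -> (exists X : sets M, True) -> ACA M.
Proof.
  intros H HX. split; [| | |assumption].
  - intros p Hp. apply H. now apply Pi11CA0_basic.
  - intros r u. apply H. apply Pi11CA0_induction.
  - intros p Hp r u.
    assert (K : has_comprehension M (AllSet (shift_set p))).
    { apply sat_comprehension. intros r' u'. apply H. apply Pi11CA0_comp. eexists. split; [|reflexivity].
      now apply arithmetical_subst. }
    destruct (K r u) as [X HX']. exists X. intro n. rewrite HX'. unfold shift_set. simpl.
    destruct HX as [Y _]. split.
    + intro L. specialize (L Y). now rewrite sat_subst in L.
    + intros L Z. now rewrite sat_subst.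
Qed.

Lemma bounded_arithmetical p : bounded p -> arithmetical p.
Proof. induction 1; simpl; tauto. Qed.

Lemma ACA_models_RCA0 M : ACA M -> models M RCA0.
Proof.
  intros HM p [q H|q (q' & H & ->)|q q2 (q' & H & ->) _] r u.
  - now apply basic.
  - intros K d. apply sat_And in K as [K0 KS].
    assert (A : arithmetical (ExNum q')) by (apply bounded_arithmetical in H; simpl; tauto).
    destruct (comprehension A r u) as [X HX].
    apply HX. pattern d. apply induction.
    + ddef.
    + apply HX. unfold inst_num in K0. rewrite sat_subst in K0.
      eapply sat_ext; [| |exact K0]; auto. now intros [|n].
    + intros x Hx. apply HX in Hx. apply KS in Hx. apply HX.
      unfold at_succ in Hx. rewrite sat_subst in Hx.
      eapply sat_ext; [| |exact Hx]; auto. now intros [|n].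
  - intros _. revert r u. apply sat_comprehension. apply comprehension.
    apply bounded_arithmetical in H. simpl. tauto.
Qed.

(** * Compact elements *)

Ltac unfold_order :=
  unfold compact, is_join, is_meet, is_sup, is_inf, subset, bounded_set, below.

Section Lattice.
Context {M : model} {HM : ACA M}.
Local Open Scope num_scope.
Notation D := (num M).
Notation set := (sets M).
Variables L R : set.
Hypothesis alg : algebraic L R.
Notation "x ⊑ y" := (below R x y) (at level 70).

Lemma below_refl x : x ∈ L -> x ⊑ x.
Proof. apply alg. Qed.

Lemma below_antisym x y : x ∈ L -> y ∈ L -> x ⊑ y -> y ⊑ x -> x = y.
Proof. intros. now apply alg. Qed.

Lemma below_trans y x z : x ∈ L -> y ∈ L -> z ∈ L -> x ⊑ y -> y ⊑ z -> x ⊑ z.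
Proof. intros Hx Hy Hz. now apply (proj2 (proj2 (proj1 (proj1 alg))) x Hx y Hy z Hz). Qed.

Lemma def2_below : def2 (below R).
Proof. unfold below. ddef. Qed.
Hint Resolve def2_below : def.

Lemma is_sup_ext P Q x : (forall n, P n <-> Q n) -> is_sup L R P x -> is_sup L R Q x.
Proof.
  intros E (H1 & H2 & H3). split; [|split]; auto.
  - intros s Hs. now apply H2, E.
  - intros u Hu K. apply H3; auto. intros s Hs. now apply K, E.
Qed.

Lemma is_sup_unique P x y : is_sup L R P x -> is_sup L R P y -> x = y.
Proof. intros (H1 & H2 & H3) (K1 & K2 & K3). apply below_antisym; auto. Qed.

Lemma sup_ex P : def1 P -> (forall x, P x -> x ∈ L) -> exists x, is_sup L R P x.
Proof.
  intros HP HL. destruct (comp HP) as [X HX].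
  destruct (proj1 (proj2 alg) X) as [[x Hx] _].
  - intros n Hn. now apply HL, HX.
  - exists x. eapply is_sup_ext; [|exact Hx]. apply HX.
Qed.

Lemma inf_ex P : def1 P -> (forall x, P x -> x ∈ L) -> exists x, is_inf L R P x.
Proof.
  intros HP HL. destruct (comp HP) as [X HX].
  destruct (proj1 (proj2 alg) X) as [_ [x (H1 & H2 & H3)]].
  - intros n Hn. now apply HL, HX.
  - exists x. split; [|split]; auto.
    + intros s Hs. now apply H2, HX.
    + intros u Hu K. apply H3; auto. intros s Hs. now apply K, HX.
Qed.

Definition join (x y : D) : D := the (is_join L R x y).
Definition meet (x y : D) : D := the (is_meet L R x y).

Lemma is_inf_unique P x y : is_inf L R P x -> is_inf L R P y -> x = y.
Proof. intros (H1 & H2 & H3) (K1 & K2 & K3). apply below_antisym; auto. Qed.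

Lemma deff2_join : deff2 join.
Proof.
  apply (@deft_the _ (fun _ r => is_join L R (r O) (r 1%nat))).
  - unfold_order. ddef.
  - intros X r x y. apply is_sup_unique.
Qed.

Lemma deff2_meet : deff2 meet.
Proof.
  apply (@deft_the _ (fun _ r => is_meet L R (r O) (r 1%nat))).
  - unfold_order. ddef.
  - intros X r x y. apply is_inf_unique.
Qed.
Hint Resolve deff2_join deff2_meet : def.

Lemma join_spec x y : x ∈ L -> y ∈ L -> is_join L R x y (join x y).
Proof.
  intros Hx Hy. destruct (proj2 (proj1 alg) x Hx y Hy) as [[z Hz] _].
  unfold join. rewrite (@the_eq _ _ z); auto. intros w Hw. eapply is_sup_unique; eauto.
Qed.

Lemma meet_spec x y : x ∈ L -> y ∈ L -> is_meet L R x y (meet x y).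
Proof.
  intros Hx Hy. destruct (proj2 (proj1 alg) x Hx y Hy) as [_ [z Hz]].
  unfold meet. rewrite (@the_eq _ _ z); auto. intros w Hw. eapply is_inf_unique; eauto.
Qed.

Lemma join_in x y : x ∈ L -> y ∈ L -> join x y ∈ L.
Proof. intros Hx Hy. apply (join_spec Hx Hy). Qed.

Lemma join_l x y : x ∈ L -> y ∈ L -> x ⊑ join x y.
Proof. intros Hx Hy. apply (join_spec Hx Hy). auto. Qed.

Lemma join_r x y : x ∈ L -> y ∈ L -> y ⊑ join x y.
Proof. intros Hx Hy. apply (join_spec Hx Hy). auto. Qed.

Lemma join_lub x y z : x ∈ L -> y ∈ L -> z ∈ L -> x ⊑ z -> y ⊑ z -> join x y ⊑ z.
Proof. intros Hx Hy Hz H K. apply (join_spec Hx Hy); auto. now intros s [->| ->]. Qed.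

Lemma meet_in x y : x ∈ L -> y ∈ L -> meet x y ∈ L.
Proof. intros Hx Hy. apply (meet_spec Hx Hy). Qed.

Lemma meet_l x y : x ∈ L -> y ∈ L -> meet x y ⊑ x.
Proof. intros Hx Hy. apply (meet_spec Hx Hy). auto. Qed.

Lemma meet_r x y : x ∈ L -> y ∈ L -> meet x y ⊑ y.
Proof. intros Hx Hy. apply (meet_spec Hx Hy). auto. Qed.

Lemma meet_glb x y z : x ∈ L -> y ∈ L -> z ∈ L -> z ⊑ x -> z ⊑ y -> z ⊑ meet x y.
Proof. intros Hx Hy Hz H K. apply (meet_spec Hx Hy); auto. now intros s [->| ->]. Qed.

Hint Resolve below_refl join_in meet_in join_l join_r meet_l meet_r join_lub meet_glb : core.

Definition initial (X : set) (k n : D) : Prop := n ∈ X /\ n < k.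

(** A finite subset of [X] lies in an initial segment of [X], which makes the finite
    subcover of a compact element a number. *)
Lemma compact_iff a : compact L R a <->
  a ∈ L /\ forall X : set, (forall n, n ∈ X -> n ∈ L) ->
    forall x, is_sup L R (fun n => n ∈ X) x -> a ⊑ x ->
      exists k y, is_sup L R (initial X k) y /\ a ⊑ y.
Proof.
  unfold compact. split; intros [Ha H]; split; auto; intros X HX x Hx Hax.
  - destruct (H X HX x Hx Hax) as (Y & [k Hk] & HY & y & Hy & Hay). exists k.
    destruct (@sup_ex (initial X k)) as [z Hz]; [unfold initial; ddef|intros n [Hn _]; auto|].
    exists z. split; auto. destruct Hy as (Hy1 & Hy2 & Hy3), Hz as (Hz1 & Hz2 & Hz3).
    apply below_trans with y; auto. apply Hy3; [assumption|].
    intros s Hs. apply Hz2. split; [now apply HY|auto].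
  - destruct (H X HX x Hx Hax) as (k & y & Hy & Hay).
    destruct (@comp _ _ (initial X k)) as [Y HY]; [unfold initial; ddef|].
    exists Y. split; [|split].
    + exists k. intros i Hi. now apply HY.
    + intros n Hn. now apply HY.
    + exists y. split; auto. eapply is_sup_ext; [|exact Hy]. intro n. now rewrite HY.
Qed.

Lemma compact_in a : compact L R a -> a ∈ L.
Proof. now intros [H _]. Qed.

Lemma compact_join a b : compact L R a -> compact L R b -> compact L R (join a b).
Proof.
  rewrite !compact_iff. intros [Ha Ca] [Hb Cb]. split; auto.
  intros X HX x Hx Hle. assert (x ∈ L) by apply Hx.
  destruct (Ca X HX x Hx) as (k1 & y1 & Hy1 & L1); [apply below_trans with (join a b); auto|].
  destruct (Cb X HX x Hx) as (k2 & y2 & Hy2 & L2); [apply below_trans with (join a b); auto|].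
  destruct (@sup_ex (initial X (k1 + k2))) as [z Hz]; [unfold initial; ddef|intros n [Hn _]; auto|].
  exists (k1 + k2), z. split; auto.
  destruct Hy1 as (? & _ & U1), Hy2 as (? & _ & U2), Hz as (? & Uz & _).
  apply join_lub; auto.
  - apply below_trans with y1; auto. apply U1; auto. intros s [Hs Hk]. apply Uz. split; auto.
    eapply lt_le_trans; [exact Hk|now exists k2].
  - apply below_trans with y2; auto. apply U2; auto. intros s [Hs Hk]. apply Uz. split; auto.
    eapply lt_le_trans; [exact Hk|]. exists k1. apply plus_comm.
Qed.

Lemma compact_gen x u : x ∈ L -> u ∈ L -> (forall c, compact L R c -> c ⊑ x -> c ⊑ u) -> x ⊑ u.
Proof.
  intros Hx Hu H. destruct (proj2 (proj2 alg) x Hx) as (X & HX & H1 & H2 & H3).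
  apply H3; auto.
Qed.

Lemma Pi11_set (P : set -> (nat -> D) -> Prop) :
  (forall p, Pi11 p -> has_comprehension M p) -> def P ->
  exists Y : set, forall n, n ∈ Y <-> forall X, P X (fun _ => n).
Proof.
  intros HC (p & f & a & Hp & H).
  pose (s := fun n => match f n with inl _ => Var 0 | inr _ => Var (S n) end).
  pose (t := fun n => match a n with None => O | Some _ => S n end).
  destruct has_set as [Z _].
  destruct (HC (AllSet (subst s t p))) with
    (r := fun n => match f n with inl _ => m_zero : D | inr d => d end)
    (u := fun n => look_set Z (a n)) as [Y HY].
  { eexists. split; [|reflexivity]. now apply arithmetical_subst. }
  exists Y. intro n. rewrite HY. simpl.
  assert (E : forall X, P X (fun _ => n) <->
            sat M (scons n (fun n => match f n with inl _ => m_zero : D | inr d => d end))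
              (scons X (fun n => look_set Z (a n))) (subst s t p)).
  { intro X. rewrite H, sat_subst. apply sat_ext.
    - intro i. unfold s. destruct (f i) eqn:Ei; simpl; rewrite ?Ei; auto.
    - intro i. unfold t. destruct (a i) eqn:Ei; simpl; rewrite ?Ei; auto. }
  split; intros K X; now apply E.
Qed.

Lemma Pi11_compact_set : (forall p, Pi11 p -> has_comprehension M p) ->
  exists K : set, forall a, a ∈ K <-> compact L R a.
Proof.
  intro HC.
  destruct (@Pi11_set (fun X r => r O ∈ L /\ ((forall n, n ∈ X -> n ∈ L) ->
    forall x, is_sup L R (fun n => n ∈ X) x -> r O ⊑ x ->
      exists k y, is_sup L R (initial X k) y /\ r O ⊑ y)) HC) as [K HK].
  { unfold initial. unfold_order. ddef. }
  exists K. intro a. rewrite HK, compact_iff. destruct has_set as [Z _].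
  split; [intro H; split; [apply (H Z)|intro X; apply (H X)]|].
  intros [H H'] X. split; [exact H|apply H'].
Qed.

(** ** Distributive lattices *)

Definition cover (c a : D) : Prop :=
  c ∈ L /\ c ⊑ a /\ c <> a /\ forall d, d ∈ L -> c ⊑ d -> d ⊑ a -> d = c \/ d = a.

Definition coatomic (a : D) : Prop :=
  a ∈ L /\ forall b, b ∈ L -> b ⊑ a -> b <> a -> exists c, b ⊑ c /\ cover c a.

Lemma def2_cover : def2 cover.
Proof. unfold cover. ddef. Qed.
Hint Resolve def2_cover : def.

Lemma def1_coatomic : def1 coatomic.
Proof. unfold coatomic. ddef. Qed.

(** Starting from [b], join the numbers 0, 1, 2, ... greedily as long as the result is
    not above [a]; by compactness the limit is not above [a] either. *)
Lemma compact_coatomic a : compact L R a -> coatomic a.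
Proof.
  intro C. assert (Ha := compact_in C). split; auto. intros b Hb Hba Nba.
  destruct (@iteration _ _ b (fun n s =>
    if excluded_middle_informative (n ∈ L /\ n ⊑ a /\ ~ a ⊑ join s n) then join s n else s))
    as (s & Ds & E0 & ES); [ddef|].
  assert (G : forall n, s n ∈ L /\ s n ⊑ a /\ b ⊑ s n /\ ~ a ⊑ s n).
  { intro n. pattern n. apply induction; [ddef| |].
    - rewrite E0. repeat split; auto. intro K. apply Nba. now apply below_antisym.
    - clear n. intros n (H1 & H2 & H3 & H4). rewrite ES.
      destruct (excluded_middle_informative _) as [(K1 & K2 & K3)|]; auto.
      repeat split; auto. apply below_trans with (s n); auto. }
  assert (GL : forall n, s n ∈ L) by apply G.
  assert (Step : forall n, s n ⊑ s (n + 1)).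
  { intro n. rewrite ES. destruct (excluded_middle_informative _) as [(K1 & K2 & K3)|]; auto. }
  assert (Mono : forall m k, s m ⊑ s (m + k)).
  { intros m k. pattern k. apply induction; [ddef| |].
    - rewrite plus0. auto.
    - clear k. intros k IH. rewrite plusS. apply below_trans with (s (m + k)); auto. }
  destruct (@comp _ _ (fun x => exists n, x = s n)) as [X HX]; [ddef|].
  assert (XL : forall n, n ∈ X -> n ∈ L).
  { intros n Hn. apply HX in Hn as [m ->]. auto. }
  destruct (@sup_ex (fun n => n ∈ X)) as [c Hc]; [ddef|auto|].
  assert (cL : c ∈ L) by apply Hc.
  assert (sc : forall n, s n ⊑ c) by (intro n; apply Hc, HX; eauto).
  assert (ca : c ⊑ a).
  { apply Hc; auto. intros x Hx. apply HX in Hx as [n ->]. apply G. }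
  assert (nac : ~ a ⊑ c).
  { intro K. destruct (proj2 (proj1 (compact_iff a) C) X XL c Hc K) as (k & y & Hy & Hay).
    assert (B : forall j, exists N, forall n, s n < j -> s n ⊑ s N).
    { intro j. pattern j. apply induction; [ddef| |].
      - exists 0. intros n Hn. now apply not_lt0 in Hn.
      - clear j. intros j [N HN]. destruct (classic (exists m, s m = j)) as [[m Hm]|Hm].
        + exists (N + m). intros n Hn. apply ltS in Hn as [Hn|Hn].
          * apply below_trans with (s N); auto.
          * rewrite Hn, <- Hm, plus_comm. auto.
        + exists N. intros n Hn. apply ltS in Hn as [Hn|Hn]; auto. exfalso; eauto. }
    destruct (B k) as [N HN]. apply (G N). destruct Hy as (Hy1 & Hy2 & Hy3).
    apply below_trans with y; auto. apply Hy3; auto.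
    intros x [Hx Hk]. apply HX in Hx as [n ->]. auto. }
  exists c. split; [|split; [|split; [|split]]]; auto.
  - rewrite <- E0. auto.
  - intros ->. auto.
  - intros d Hd cd da. destruct (classic (a ⊑ join (s d) d)) as [K|K].
    + right. apply below_antisym; auto. apply below_trans with (join (s d) d); auto.
      apply join_lub; auto. apply below_trans with c; auto.
    + left. apply below_antisym; auto. apply below_trans with (s (d + 1)); auto.
      rewrite ES. destruct (excluded_middle_informative _); auto. tauto.
Qed.

Hypothesis distr : distributive L R.

Lemma meet_join x y z : x ∈ L -> y ∈ L -> z ∈ L ->
  meet x (join y z) = join (meet x y) (meet x z).
Proof.
  intros Hx Hy Hz. symmetry. apply the_eq.
  - intros w Hw. eapply is_sup_unique; [exact Hw|].
    apply (distr Hx Hy Hz (join_spec Hy Hz)); auto using meet_spec.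
  - apply (distr Hx Hy Hz (join_spec Hy Hz)); auto using meet_spec.
Qed.

(** If [v] is not below [c], then [c] and [v] join to [a], and meeting this equation with [u]
    bounds [u] by distributivity. *)
Lemma cover_prime c a u v : a ∈ L -> cover c a -> u ∈ L -> v ∈ L -> u ⊑ a -> v ⊑ a ->
  meet u v ⊑ c -> u ⊑ c \/ v ⊑ c.
Proof.
  intros Ha (Hc & ca & nca & C) Hu Hv ua va K.
  destruct (classic (v ⊑ c)) as [|N]; auto. left.
  assert (E : join c v = a).
  { destruct (C (join c v)) as [E|E]; auto. exfalso. apply N. rewrite <- E. auto. }
  apply below_trans with (meet u (join c v)); auto.
  - rewrite E. auto.
  - rewrite meet_join; auto.
Qed.

(** If [a] were covered by a set without a finite subcover, the lower covers of [a] would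
    contain a sequence [e] such that the infimum of some members of [e] is below no other
    member.  The infimum of Cantor's diagonal set, the [e n] with [n] not below [e n], is a
    number that would be an index in that set iff it is not. *)
Lemma coatomic_compact a : coatomic a -> compact L R a.
Proof.
  intros [Ha Hco]. apply compact_iff. split; auto. intros X XL x Hx ax.
  apply NNPP. intro N.
  assert (xL : x ∈ L) by apply Hx.
  pose (sigma := fun k => the (is_sup L R (initial X k))).
  assert (Dsigma : deff1 sigma).
  { apply (@deft_the _ (fun _ r => is_sup L R (initial X (r O)))).
    - unfold initial. unfold_order. ddef.
    - intros Y r u v. apply is_sup_unique. }
  assert (Hsigma : forall k, is_sup L R (initial X k) (sigma k)).
  { intro k. destruct (@sup_ex (initial X k)) as [z Hz]; [unfold initial; ddef|intros n [Hn _]; auto|].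
    unfold sigma. rewrite (@the_eq _ _ z); auto. intros. eapply is_sup_unique; eauto. }
  assert (sL : forall k, sigma k ∈ L) by (intro; apply Hsigma).
  (* The increasing sequence [b] tends to [a] without reaching it. *)
  pose (b := fun k => meet a (sigma k)).
  assert (Db : deff1 b) by (unfold b; ddef).
  assert (bL : forall k, b k ∈ L) by (intro; unfold b; auto).
  assert (ba : forall k, b k ⊑ a) by (intro; unfold b; auto).
  assert (nab : forall k, b k <> a).
  { intros k E. apply N. exists k, (sigma k). split; auto. rewrite <- E. unfold b. auto. }
  assert (bmono : forall k l, b k ⊑ b (k + l)).
  { intros k l. unfold b. apply meet_glb; auto.
    apply below_trans with (sigma k); auto. apply Hsigma; auto.
    intros s [Hs Hk]. apply Hsigma. split; auto. eapply lt_le_trans; [exact Hk|now exists l]. }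
  pose (c := fun k => the_least (fun c => b k ⊑ c /\ cover c a)).
  assert (Dc : deff1 c).
  { apply (@deft_the_least _ _ (fun _ r c => b (r O) ⊑ c /\ cover c a)). ddef. }
  assert (Hc : forall k, b k ⊑ c k /\ cover (c k) a).
  { intro k. apply (@the_least_spec _ _ (fun c => b k ⊑ c /\ cover c a)); [ddef|auto]. }
  assert (cL : forall k, c k ∈ L) by (intro; apply Hc).
  assert (Unb : forall d, cover d a -> exists k, ~ b k ⊑ d).
  { intros d (dL & da & nda & _). apply NNPP. intro K. apply nda, below_antisym; auto.
    apply compact_gen; auto. intros z Cz za. assert (zL := compact_in Cz).
    destruct (proj2 (proj1 (compact_iff z) Cz) X XL x Hx) as (k & y & Hy & zy).
    { now apply below_trans with a. }
    rewrite (is_sup_unique Hy (Hsigma k)) in zy.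
    apply below_trans with (b k); auto.
    - unfold b. auto.
    - apply NNPP. eauto. }
  assert (Bound : forall m, exists i, forall j, j <= m -> ~ b i ⊑ c j).
  { assert (Up : forall i l d, d ∈ L -> ~ b i ⊑ d -> ~ b (i + l) ⊑ d).
    { intros i l d Hd H K. apply H. now apply below_trans with (b (i + l)). }
    intro m. pattern m. apply induction; [ddef| |].
    - destruct (Unb (c 0)) as [i Hi]; [apply Hc|]. exists i. intros j Hj.
      apply le_lt_eq in Hj as [Hj| ->]; auto. now apply not_lt0 in Hj.
    - clear m. intros m [i Hi]. destruct (Unb (c (m + 1))) as [i' Hi']; [apply Hc|].
      exists (i + i'). intros j Hj. apply le_lt_eq in Hj as [Hj| ->].
      + apply Up; auto. apply Hi. now apply lt_succ_le.
      + rewrite plus_comm. auto. }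
  pose (h := fun m => the_least (fun i => forall j, j <= m -> ~ b i ⊑ c j)).
  assert (Dh : deff1 h).
  { apply (@deft_the_least _ _ (fun _ r i => forall j, j <= r O -> ~ b i ⊑ c j)). ddef. }
  assert (Hh : forall m j, j <= m -> ~ b (h m) ⊑ c j).
  { intro m. apply (@the_least_spec _ _ (fun i => forall j, j <= m -> ~ b i ⊑ c j));
      [ddef|auto]. }
  (* Along the indices [t] no [b (t n)] lies below an earlier cover. *)
  destruct (@iteration _ _ 0 (fun _ m => h m)) as (t & Dt & _ & ES); [ddef|].
  pose (e := fun n => c (t n)).
  assert (De : deff1 e) by (unfold e; ddef).
  assert (eL : forall n, e n ∈ L) by (intro; apply cL).
  assert (ecov : forall n, cover (e n) a) by (intro; apply Hc).
  assert (be : forall n, b (t n) ⊑ e n) by (intro; apply Hc).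
  assert (Next : forall n, ~ b (t (n + 1)) ⊑ e n).
  { intro n. rewrite ES. apply Hh, le_refl. }
  assert (tmono : forall n l, b (t n) ⊑ b (t (n + l))).
  { intros n l. pattern l. apply induction; [ddef| |].
    - rewrite plus0. auto.
    - clear l. intros l IH. rewrite plusS. apply below_trans with (b (t (n + l))); auto.
      destruct (le_or_lt (t (n + l)) (t (n + l + 1))) as [[d ->]|K]; auto.
      exfalso. apply (Next (n + l)). apply lt_le_incl in K as [d Hd].
      apply below_trans with (b (t (n + l))); auto. rewrite Hd. auto. }
  assert (Sep : forall m n, m < n -> ~ b (t n) ⊑ e m).
  { intros m n H K. apply lt_le in H as [l ->]. apply (Next m).
    apply below_trans with (b (t (m + 1 + l))); auto. }
  (* The diagonal set; the number [n] is its infimum. *)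
  destruct (@inf_ex (fun y => exists n, (n ∈ L /\ ~ n ⊑ e n) /\ y = e n)) as [n Hn];
    [ddef|intros y (n & _ & ->); auto|].
  assert (nL : n ∈ L) by apply Hn.
  assert (En : n ⊑ e n).
  { apply NNPP. intro K. apply K. apply Hn. eauto. }
  (* The covers before the [n]-th one are met one after the other, those after it lie above
     [b (t (n + 1))]; so their infimum is not below the [n]-th one. *)
  assert (Fin : forall j, j <= n -> exists u, u ∈ L /\ u ⊑ a /\ ~ u ⊑ e n /\
                  forall m, m < j -> u ⊑ e m).
  { intro j. pattern j. apply induction; [ddef| |].
    - intros _. exists a. repeat split; auto.
      + intro K. destruct (ecov n) as (_ & K1 & K2 & _). apply K2. now apply below_antisym.
      + intros m Hm. now apply not_lt0 in Hm.
    - clear j. intros j IH Hj. apply lt_le in Hj.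
      destruct IH as (u & uL & ua & nu & Hu); [now apply lt_le_incl|].
      destruct (ecov j) as (_ & ja & _ & jc).
      exists (meet u (e j)). repeat split; auto.
      + apply below_trans with u; auto.
      + intro K. apply (cover_prime Ha (ecov n)) in K as [K|K]; auto.
        destruct (ecov n) as (_ & K1 & K2 & _).
        destruct (jc (e n)) as [E|E]; auto. apply (Sep j n Hj). rewrite <- E. auto.
      + intros m Hm. apply ltS in Hm as [Hm| ->]; auto.
        apply below_trans with u; auto. }
  destruct (Fin n (le_refl n)) as (u & uL & ua & nu & Hu).
  assert (K : meet u (b (t (n + 1))) ⊑ e n).
  { apply below_trans with n; auto. apply Hn; auto. intros s (m & [mL Hm] & ->).
    destruct (lt_trichotomy m n) as [H|[->|H]]; [|tauto|].
    - apply below_trans with u; auto.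
    - apply lt_le in H as [l ->].
      apply below_trans with (b (t (n + 1))); auto.
      apply below_trans with (b (t (n + 1 + l))); auto. }
  apply (cover_prime Ha (ecov n)) in K as [K|K]; auto.
  apply (Sep n (n + 1)); auto using lt_succ.
Qed.

Lemma distributive_compact_set : exists K : set, forall a, a ∈ K <-> compact L R a.
Proof.
  destruct (comp def1_coatomic) as [K HK]. exists K. intro a. rewrite HK.
  split; [apply coatomic_compact|apply compact_coatomic].
Qed.

End Lattice.

(** * The coloured graph *)

(** An edge coloured [a] from 0 to 1 carries, for some pairs of colours [b] and [g], an ear:
    the path 0 -b- p -g- q -b- r -g- 1.  Its inner vertices are the points and its four edges
    the parts; the kinds tell the two colours apart. *)
Inductive point := Pp | Pq | Pr.
Inductive part := E1 | E2 | E3 | E4.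
Inductive kind := KB | KG.

Definition kind_of (i : part) : kind := match i with E1 | E3 => KB | E2 | E4 => KG end.

Notation decide P := (excluded_middle_informative P).

Section Words.
Context {M : model} {HM : ACA M}.
Local Open Scope num_scope.
Notation D := (num M).
Notation set := (sets M).

Add Ring num_ring : (num_semiring (M := M)).

Fixpoint numeral (n : nat) : D := match n with O => 0 | S n => numeral n + 1 end.

Lemma numeral_inj n : forall m, numeral n = numeral m -> n = m.
Proof.
  induction n as [|n IH]; intros [|m] H; simpl in H; auto.
  - symmetry in H. now apply succ_neq0 in H.
  - now apply succ_neq0 in H.
  - apply succ_inj in H. auto.
Qed.

Definition point_tag (j : point) : nat := match j with Pp => 2 | Pq => 3 | Pr => 4 end.
Definition part_tag (i : part) : nat := match i with E1 => 5 | E2 => 6 | E3 => 7 | E4 => 8 end.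

(** The component of a colour consists of an edge from 0 to 1, its ears, the ears of their
    edges, and so on.  Its vertices are numbers: [pnt j b g] is a point of an ear of the first
    edge, and [cpy i b g w] is the vertex [w] of the component attached at a part of that ear.
    The tags start from 2, which keeps these codes apart from the ends 0 and 1. *)
Definition pnt (j : point) (b g : D) : D := pair (numeral (point_tag j)) (pair b g).
Definition cpy (i : part) (b g w : D) : D := pair (numeral (part_tag i)) (pair (pair b g) w).

Inductive shape := SStart | SEnd | SPnt (j : point) (b g : D) | SCpy (i : part) (b g w : D)
  | SJunk.

Definition encodes (x : D) (s : shape) : Prop :=
  match s with
  | SStart => x = 0
  | SEnd => x = 1
  | SPnt j b g => x = pnt j b g
  | SCpy i b g w => x = cpy i b g w
  | SJunk => False
  end.

Lemma pair_tag_neq (n : nat) (y : D) :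
  pair (numeral (S (S n))) y <> 0 /\ pair (numeral (S (S n))) y <> 1.
Proof.
  assert (H := le_pair_l (numeral (S (S n))) y). simpl in *.
  assert (1 < pair (numeral n + 1 + 1) y).
  { eapply lt_le_trans; [|exact H]. apply lt_le. exists (numeral n). ring. }
  split; intro E; rewrite E in H0.
  - now apply not_lt0 in H0.
  - now apply lt_irrefl in H0.
Qed.

Lemma encodes_unique x s s' : encodes x s -> encodes x s' -> s = s'.
Proof.
  assert (Z : (0 : D) <> 1).
  { intro E. symmetry in E. rewrite <- (plus0l 1) in E. now apply succ_neq0 in E. }
  assert (TP : forall j b g, pnt j b g <> 0 /\ pnt j b g <> 1).
  { intros j b g. destruct j; apply pair_tag_neq. }
  assert (TC : forall i b g w, cpy i b g w <> 0 /\ cpy i b g w <> 1).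
  { intros i b g w. destruct i; apply pair_tag_neq. }
  destruct s as [| |j b g|i b g w|], s' as [| |j' b' g'|i' b' g' w'|]; simpl; try tauto;
    intros -> E; try congruence; try (exfalso; now apply (TP _ _ _) in E);
    try (exfalso; now apply (TC _ _ _ _) in E);
    try (exfalso; symmetry in E; now apply (TP _ _ _) in E);
    try (exfalso; symmetry in E; now apply (TC _ _ _ _) in E);
    apply pair_inj in E as [E1 E2]; apply numeral_inj in E1.
  - apply pair_inj in E2 as [-> ->]. destruct j, j'; congruence || discriminate.
  - destruct j, i'; discriminate.
  - destruct i, j'; discriminate.
  - apply pair_inj in E2 as [E2 ->]. apply pair_inj in E2 as [-> ->].
    destruct i, i'; congruence || discriminate.
Qed.

Definition view (x : D) : shape :=
  if decide (exists s, encodes x s) then epsilon (inhabits SJunk) (encodes x) else SJunk.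

Lemma view_encodes x s : encodes x s -> view x = s.
Proof.
  intro H. unfold view. destruct (decide _) as [E|N]; [|exfalso; eauto].
  apply (encodes_unique (x := x)); auto. now apply epsilon_spec.
Qed.

Lemma view_start : view 0 = SStart. Proof. now apply view_encodes. Qed.
Lemma view_end : view 1 = SEnd. Proof. now apply view_encodes. Qed.
Lemma view_pnt j b g : view (pnt j b g) = SPnt j b g. Proof. now apply view_encodes. Qed.
Lemma view_cpy i b g w : view (cpy i b g w) = SCpy i b g w. Proof. now apply view_encodes. Qed.

Lemma lt_cpy i b g w : w < cpy i b g w.
Proof.
  unfold cpy. eapply le_lt_trans; [apply (le_pair_r (pair b g))|].
  apply lt_pair_r. destruct i; apply succ_neq0.
Qed.

(** Case distinction on the shape of a vertex, as a function whose definability is proved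
    once and for all. *)
Definition vcase (x a0 a1 : D) (fp : point -> D -> D -> D) (fc : part -> D -> D -> D -> D) : D :=
  match view x with
  | SStart => a0
  | SEnd => a1
  | SPnt j b g => fp j b g
  | SCpy i b g w => fc i b g w
  | SJunk => 0
  end.

Lemma deff2_pnt j : deff2 (pnt j).
Proof. unfold pnt. ddef. Qed.

Lemma deff3_cpy i : deff3 (cpy i).
Proof. unfold cpy. ddef. Qed.
Hint Resolve deff2_pnt deff3_cpy : def.

Lemma def_ex_point (Q : point -> set -> (nat -> D) -> Prop) :
  (forall j, def (Q j)) -> def (fun X r => exists j, Q j X r).
Proof.
  intro H. apply def_iff with (fun X r => Q Pp X r \/ Q Pq X r \/ Q Pr X r).
  - intros X r. split; [intros [?|[?|?]]; eauto|intros [[] ?]; auto].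
  - auto using def_or.
Qed.

Lemma def_ex_part (Q : part -> set -> (nat -> D) -> Prop) :
  (forall j, def (Q j)) -> def (fun X r => exists j, Q j X r).
Proof.
  intro H. apply def_iff with (fun X r => Q E1 X r \/ Q E2 X r \/ Q E3 X r \/ Q E4 X r).
  - intros X r. split; [intros [?|[?|[?|?]]]; eauto|intros [[] ?]; auto].
  - auto using def_or.
Qed.

Lemma def_ex_kind (Q : kind -> set -> (nat -> D) -> Prop) :
  (forall j, def (Q j)) -> def (fun X r => exists j, Q j X r).
Proof.
  intro H. apply def_iff with (fun X r => Q KB X r \/ Q KG X r).
  - intros X r. split; [intros [?|?]; eauto|intros [[] ?]; auto].
  - auto using def_or.
Qed.

Ltac gdef := repeat first
  [ ddef_step | apply def_ex_point; intro | apply def_ex_part; intro | apply def_ex_kind; intro ].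

Lemma deft_vcase t a0 a1 (fp : point -> D -> D -> set -> (nat -> D) -> D)
    (fc : part -> D -> D -> D -> set -> (nat -> D) -> D) :
  deft t -> deft a0 -> deft a1 ->
  (forall j, deft (fun X r => fp j (r 1%nat) (r O) X (fun i => r (S (S i))))) ->
  (forall i, deft (fun X r => fc i (r 2%nat) (r 1%nat) (r O) X (fun i => r (S (S (S i)))))) ->
  deft (fun X r => vcase (t X r) (a0 X r) (a1 X r) (fun j b g => fp j b g X r)
                     (fun i b g w => fc i b g w X r)).
Proof.
  intros Ht H0 H1 Hp Hc. unfold deft.
  apply def_iff with (fun X r =>
    (t X (fun i => r (S i)) = 0 /\ r O = a0 X (fun i => r (S i))) \/
    (t X (fun i => r (S i)) = 1 /\ r O = a1 X (fun i => r (S i))) \/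
    (exists j b g, t X (fun i => r (S i)) = pnt j b g /\ r O = fp j b g X (fun i => r (S i))) \/
    (exists i b g w, t X (fun i => r (S i)) = cpy i b g w /\
                     r O = fc i b g w X (fun i => r (S i))) \/
    (~ (t X (fun i => r (S i)) = 0 \/ t X (fun i => r (S i)) = 1 \/
        (exists j b g, t X (fun i => r (S i)) = pnt j b g) \/
        (exists i b g w, t X (fun i => r (S i)) = cpy i b g w)) /\ r O = 0)).
  - intros X r. generalize (t X (fun i => r (S i))). intro x. unfold vcase. split.
    + intros [[-> ->]|[[-> ->]|[(j & b & g & -> & ->)|[(i & b & g & w & -> & ->)|[N ->]]]]].
      * now rewrite view_start.
      * now rewrite view_end.
      * now rewrite view_pnt.
      * now rewrite view_cpy.
      * unfold view. destruct (decide _) as [[s Hs]|]; auto.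
        exfalso. apply N. destruct s; simpl in Hs; eauto 8. tauto.
    + unfold view. destruct (decide _) as [Hs|N]; intro E.
      * apply (epsilon_spec (inhabits SJunk) (encodes x)) in Hs.
        destruct (epsilon _ _) as [| |j b g|i b g w|]; simpl in Hs; eauto 10.
      * do 4 right. split; auto.
        intros [H|[H|[(j & b & g & H)|(i & b & g & w & H)]]]; apply N.
        -- now exists SStart.
        -- now exists SEnd.
        -- now exists (SPnt j b g).
        -- now exists (SCpy i b g w).
  - assert (Hx : forall n, deft (fun X r => t X (fun i => r (S (n + i))%nat))).
    { intro n. exact (deft_ren (fun i => S (n + i))%nat Ht). }
    repeat apply def_or.
    + apply def_and; [|exact H0]. apply (@def_app2 _ eq); gdef. exact (Hx O).
    + apply def_and; [|exact H1]. apply (@def_app2 _ eq); gdef. exact (Hx O).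
    + apply def_ex_point. intro j. do 2 apply def_ex. apply def_and.
      * apply (@def_app2 _ eq); gdef. exact (Hx 2%nat).
      * exact (def_ren (fun n => match n with 0 => 2 | 1 => 0 | 2 => 1 | n => n end)%nat (Hp j)).
    + apply def_ex_part. intro j. do 3 apply def_ex. apply def_and.
      * apply (@def_app2 _ eq); gdef. exact (Hx 3%nat).
      * exact (def_ren (fun n => match n with 0 => 3 | 1 => 0 | 2 => 1 | 3 => 2 | n => n end)%nat
                 (Hc j)).
    + apply def_and; [apply def_not; repeat apply def_or|gdef].
      * apply (@def_app2 _ eq); gdef. exact (Hx O).
      * apply (@def_app2 _ eq); gdef. exact (Hx O).
      * apply def_ex_point. intro j. do 2 apply def_ex.
        apply (@def_app2 _ eq); gdef. exact (Hx 2%nat).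
      * apply def_ex_part. intro j. do 3 apply def_ex.
        apply (@def_app2 _ eq); gdef. exact (Hx 3%nat).
Qed.

End Words.

#[export] Hint Resolve deff2_pnt deff3_cpy : def.

Ltac gdef := repeat first
  [ progress cbn beta
  | match goal with
    | |- deft (fun X r => vcase _ _ _ _ _) => apply deft_vcase; [| | |intros []|intros []]
    end
  | ddef_step
  | apply def_ex_point; intro | apply def_ex_part; intro | apply def_ex_kind; intro ].

Ltac view_inv H :=
  apply (f_equal view) in H; rewrite ?view_start, ?view_end, ?view_pnt, ?view_cpy in H;
  try discriminate H; try (injection H; clear H; intros; subst).

(** The data from which the graph is built: [ear a b g] says that the edges coloured [a]
    carry an ear with the colours [b] and [g], and [ideal l a] that the colour [a] lies
    in the [l]-th ideal. *)
Class Colouring (M : model) : Type := {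
  colour : num M -> Prop;
  ear : num M -> num M -> num M -> Prop;
  ideal : num M -> num M -> Prop;
  def1_colour : def1 colour;
  def3_ear : def3 ear;
  def2_ideal : def2 ideal;
  ear_colour : forall a b g, ear a b g -> colour a /\ colour b /\ colour g;
  ear_ideal : forall l a b g, ear a b g -> ideal l b -> ideal l g -> ideal l a }.

Section Graph.
Context {M : model} {HM : ACA M} {GC : Colouring M}.
Local Open Scope num_scope.
Notation D := (num M).
Notation set := (sets M).
Hint Extern 1 (def1 colour) => apply def1_colour : def.
Hint Extern 1 (def3 ear) => apply def3_ear : def.
Hint Extern 1 (def2 ideal) => apply def2_ideal : def.

Lemma one_neq0 : (1 : D) <> 0.
Proof. rewrite <- (plus0l 1). apply succ_neq0. Qed.

Definition part_colour (i : part) (b g : D) : D :=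
  match kind_of i with KB => b | KG => g end.

(** The parts are oriented so that the folding onto either colour sends starts to 0 and ends
    to 1. *)
Definition part_start (i : part) (b g : D) : D :=
  match i with E1 => 0 | E2 => pnt Pp b g | E3 => pnt Pr b g | E4 => 1 end.

Definition part_end (i : part) (b g : D) : D :=
  match i with E1 => pnt Pp b g | E2 => pnt Pq b g | E3 => pnt Pq b g | E4 => pnt Pr b g end.

(** The vertex [w] of the component attached at part [i]; the ends of the component are
    identified with the ends of the part. *)
Definition ins (i : part) (b g w : D) : D :=
  if decide (w = 0) then part_start i b g
  else if decide (w = 1) then part_end i b g else cpy i b g w.

Lemma deff2_part_colour i : deff2 (part_colour i).
Proof. destruct i; unfold part_colour; simpl; ddef. Qed.
Lemma deff2_part_start i : deff2 (part_start i).
Proof. destruct i; unfold part_start; ddef. Qed.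
Lemma deff2_part_end i : deff2 (part_end i).
Proof. destruct i; unfold part_end; ddef. Qed.
Hint Resolve deff2_part_colour deff2_part_start deff2_part_end : def.

Lemma deff3_ins i : deff3 (ins i).
Proof. unfold ins. ddef. Qed.
Hint Resolve deff3_ins : def.

Lemma ins_0 i b g : ins i b g 0 = part_start i b g.
Proof. unfold ins. destruct (decide _); tauto. Qed.

Lemma ins_1 i b g : ins i b g 1 = part_end i b g.
Proof.
  unfold ins. destruct (decide _) as [E|_]; [now apply one_neq0 in E|].
  destruct (decide _); tauto.
Qed.

Lemma ins_inner i b g w : w <> 0 -> w <> 1 -> ins i b g w = cpy i b g w.
Proof. intros. unfold ins. destruct (decide (w = 0)), (decide (w = 1)); tauto. Qed.

Definition low (x : D) : Prop := x = 0 \/ x = 1 \/ exists j b g, x = pnt j b g.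

Lemma low_start i b g : low (part_start i b g).
Proof. unfold low. destruct i; simpl; eauto 6. Qed.

Lemma low_end i b g : low (part_end i b g).
Proof. unfold low. destruct i; simpl; eauto 6. Qed.

Lemma low_not_cpy x i b g w : low x -> x <> cpy i b g w.
Proof. intros [->|[->|(j & b' & g' & ->)]] E; view_inv E. Qed.

(** ** Vertices *)

Lemma valid_exists : exists V : D -> D -> Prop, def2 V /\ forall a w,
  V a w <-> (w = 0 \/ w = 1 \/ exists j b g, w = pnt j b g /\ ear a b g) \/
            exists i b g v, w = cpy i b g v /\ ear a b g /\ v <> 0 /\ v <> 1 /\
                            V (part_colour i b g) v.
Proof.
  destruct (@inductive_definition M HM
    (fun z => exists a w, z = pair a w /\
       (w = 0 \/ w = 1 \/ exists j b g, w = pnt j b g /\ ear a b g))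
    (fun z z' => exists a i b g v, z = pair a (cpy i b g v) /\ ear a b g /\ v <> 0 /\ v <> 1 /\
       z' = pair (part_colour i b g) v)) as (F & DF & EF); [gdef|gdef|].
  exists (fun a w => F (pair a w)). split; [ddef|].
  intros a w. rewrite EF. split.
  - intros [(a' & w' & E & H)|(z' & (a' & i & b & g & v & E & He & H0 & H1 & ->) & H)];
      apply pair_inj in E as [-> ->]; auto.
    right. exists i, b, g, v. auto.
  - intros [H|(i & b & g & v & -> & He & H0 & H1 & H)].
    + left. eauto.
    + right. exists (pair (part_colour i b g) v). split; auto.
      exists a, i, b, g, v. auto.
Qed.

Definition valid : D -> D -> Prop :=
  proj1_sig (constructive_indefinite_description _ valid_exists).

Lemma def2_valid : def2 valid.
Proof. apply (proj2_sig (constructive_indefinite_description _ valid_exists)). Qed.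
Hint Resolve def2_valid : def.

Lemma valid_iff a w :
  valid a w <-> (w = 0 \/ w = 1 \/ exists j b g, w = pnt j b g /\ ear a b g) \/
            exists i b g v, w = cpy i b g v /\ ear a b g /\ v <> 0 /\ v <> 1 /\
                            valid (part_colour i b g) v.
Proof. apply (proj2_sig (constructive_indefinite_description _ valid_exists)). Qed.

Lemma valid_0 a : valid a 0.
Proof. apply valid_iff. auto. Qed.

Lemma valid_1 a : valid a 1.
Proof. apply valid_iff. auto. Qed.

Lemma valid_pnt a j b g : ear a b g -> valid a (pnt j b g).
Proof. intro H. apply valid_iff. left. right. right. eauto. Qed.

Lemma valid_cpy a i b g v : ear a b g -> v <> 0 -> v <> 1 -> valid (part_colour i b g) v ->
  valid a (cpy i b g v).
Proof. intros. apply valid_iff. right. exists i, b, g, v. auto. Qed.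
Hint Resolve valid_0 valid_1 valid_pnt valid_cpy : core.

Lemma valid_ind (Q : D -> D -> Prop) : def2 Q ->
  (forall a, Q a 0) -> (forall a, Q a 1) ->
  (forall a j b g, ear a b g -> Q a (pnt j b g)) ->
  (forall a i b g v, ear a b g -> v <> 0 -> v <> 1 -> valid (part_colour i b g) v ->
     Q (part_colour i b g) v -> Q a (cpy i b g v)) ->
  forall a w, valid a w -> Q a w.
Proof.
  intros DQ H0 H1 HT HC.
  assert (H : forall w a, valid a w -> Q a w); auto.
  intro w. pattern w. apply strong_induction; [ddef|]. clear w. intros w IH a Hw.
  apply valid_iff in Hw as [[->|[->|(j & b & g & -> & He)]]
                           |(i & b & g & v & -> & He & N0 & N1 & Hv)]; auto.
  apply HC; auto. apply IH; auto. apply lt_cpy.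
Qed.

Ltac valid_induction :=
  match goal with
  | |- forall a w, valid a w -> @?Q a w => apply (@valid_ind Q); cbn beta
  end.

Lemma valid_ins a i b g w : ear a b g -> valid (part_colour i b g) w -> valid a (ins i b g w).
Proof.
  intros He Hw. unfold ins. destruct (decide _); [|destruct (decide _)]; auto;
    destruct i; simpl; auto.
Qed.

(** ** Representatives modulo an ideal *)

(** In an ear whose colours [b] and [g] both lie in the ideal all the points go to the ends;
    these go to 0 as well, because the ideal then contains the colour [a]. *)

Section Representatives.
Variable l : D.

Definition end_rep (a : D) : D := if decide (ideal l a) then 0 else 1.

Definition p_rep (b g : D) : D := if decide (ideal l b) then 0 else pnt Pp b g.

Definition pnt_rep (a : D) (j : point) (b g : D) : D :=
  match j with
  | Pp => p_rep b g
  | Pq => if decide (ideal l g) then p_rep b g else pnt Pq b g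
  | Pr => if decide (ideal l g) then end_rep a
          else if decide (ideal l b) then pnt Pq b g else pnt Pr b g
  end.

(** One step towards 0, for vertices that are not inside of a part. *)
Definition ret (a x : D) : D :=
  vcase x 0 (end_rep a) (pnt_rep a) (fun i b g w => cpy i b g w).

End Representatives.

Lemma deff2_end_rep : deff2 end_rep.
Proof. unfold end_rep. ddef. Qed.
Lemma deff3_p_rep : deff3 p_rep.
Proof. unfold p_rep. ddef. Qed.
Hint Resolve deff2_end_rep deff3_p_rep : def.

Lemma deff3_ret : deff3 ret.
Proof.
  unfold ret, deff3, def4.
  apply (@deft_vcase M HM (fun _ r => r 2%nat) (fun _ _ => 0) (fun _ r => end_rep (r O) (r 1%nat))
           (fun j b g _ r => pnt_rep (r O) (r 1%nat) j b g) (fun i b g w _ _ => cpy i b g w));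
    gdef.
  - intros []; unfold pnt_rep; gdef.
  - intros []; gdef.
Qed.
Hint Resolve deff3_ret : def.

(** The representative of a vertex inside a part is found in the attached component first;
    if it is an end of the component, it moves on in the ear. *)
Lemma rep_exists : exists F : D -> D -> D -> D, deff3 F /\
  (forall l a w, low w -> F l a w = ret l a w) /\
  (forall l a i b g v, F l a (cpy i b g v) = ret l a (ins i b g (F l (part_colour i b g) v))).
Proof.
  destruct (@recursion M HM
    (fun x => exists i b g v, snd x = cpy i b g v)
    (fun x => vcase (snd x) 0 0 (fun _ _ _ => 0)
                (fun i b g v => pair (pair (fst (fst x)) (part_colour i b g)) v))
    (fun x => snd x)
    (fun x => ret (fst (fst x)) (snd (fst x)) (snd x))
    (fun x y => vcase (snd x) 0 0 (fun _ _ _ => 0)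
                  (fun i b g v => ret (fst (fst x)) (snd (fst x)) (ins i b g y))))
    as (f & Df & Ef).
  - gdef.
  - gdef.
  - gdef.
  - gdef.
  - gdef.
  - intros x (i & b & g & v & E). rewrite E. unfold vcase. rewrite view_cpy, snd_pair.
    apply lt_cpy.
  - exists (fun l a w => f (pair (pair l a) w)). split; [gdef|split].
    + intros l a w Hw. rewrite Ef. cbn beta. rewrite !snd_pair, !fst_pair, ?snd_pair.
      destruct (decide _) as [(i & b & g & v & E)|]; auto.
      now apply low_not_cpy in E.
    + intros l a i b g v. rewrite Ef. cbn beta. rewrite !snd_pair, !fst_pair, ?snd_pair.
      destruct (decide _) as [_|N]; [|exfalso; apply N; now exists i, b, g, v].
      unfold vcase. now rewrite view_cpy.
Qed.

Definition rep : D -> D -> D -> D :=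
  proj1_sig (constructive_indefinite_description _ rep_exists).

Lemma deff3_rep : deff3 rep.
Proof. apply (proj2_sig (constructive_indefinite_description _ rep_exists)). Qed.
Hint Resolve deff3_rep : def.

Lemma rep_low l a w : low w -> rep l a w = ret l a w.
Proof. apply (proj2_sig (constructive_indefinite_description _ rep_exists)). Qed.

Lemma rep_cpy l a i b g v :
  rep l a (cpy i b g v) = ret l a (ins i b g (rep l (part_colour i b g) v)).
Proof. apply (proj2_sig (constructive_indefinite_description _ rep_exists)). Qed.

Lemma low_0 : low (0 : D).
Proof. now left. Qed.

Lemma low_1 : low (1 : D).
Proof. right. now left. Qed.

Lemma low_pnt j b g : low (pnt j b g).
Proof. right. right. eauto. Qed.
Hint Resolve low_0 low_1 low_pnt low_start low_end : core.

Lemma ret_0 l a : ret l a 0 = 0.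
Proof. unfold ret, vcase. now rewrite view_start. Qed.

Lemma ret_1 l a : ret l a 1 = end_rep l a.
Proof. unfold ret, vcase. now rewrite view_end. Qed.

Lemma ret_pnt l a j b g : ret l a (pnt j b g) = pnt_rep l a j b g.
Proof. unfold ret, vcase. now rewrite view_pnt. Qed.

Lemma ret_cpy l a i b g w : ret l a (cpy i b g w) = cpy i b g w.
Proof. unfold ret, vcase. now rewrite view_cpy. Qed.

Lemma rep_0 l a : rep l a 0 = 0.
Proof. rewrite rep_low; auto using ret_0. Qed.

Lemma rep_1 l a : rep l a 1 = end_rep l a.
Proof. rewrite rep_low; auto using ret_1. Qed.

(* Evaluates the retraction on the vertices of an ear. *)
Ltac ear_cases :=
  repeat (rewrite ?ret_0, ?ret_1, ?ret_pnt in *; unfold pnt_rep, p_rep, end_rep in *; simpl in *;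
    match goal with
    | |- context [decide (ideal ?l ?x)] => destruct (decide (ideal l x))
    | H : context [decide (ideal ?l ?x)] |- _ => destruct (decide (ideal l x))
    end);
  rewrite ?ret_0, ?ret_1, ?ret_pnt in *.

Lemma low_ret l a x : low x -> low (ret l a x).
Proof.
  intros [->|[->|(j & b & g & ->)]]; [rewrite ret_0; auto|rewrite ret_1|rewrite ret_pnt].
  - unfold end_rep. destruct (decide _); auto.
  - destruct j; ear_cases; auto.
Qed.

Lemma ret_idem l a x : low x -> ret l a (ret l a x) = ret l a x.
Proof.
  intros [->|[->|(j & b & g & ->)]]; [now rewrite !ret_0| |destruct j];
    ear_cases; tauto.
Qed.

Lemma valid_ret l a x : valid a x -> valid a (ret l a x).
Proof.
  intro H. apply valid_iff in H as [[->|[->|(j & b & g & -> & He)]]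
                                   |(i & b & g & v & -> & He & N0 & N1 & Hv)].
  - rewrite ret_0. auto.
  - ear_cases; auto.
  - destruct j; ear_cases; auto.
  - rewrite ret_cpy. auto.
Qed.

Lemma low_or_inner (w : D) : w = 0 \/ w = 1 \/ w <> 0 /\ w <> 1.
Proof. destruct (classic (w = 0)), (classic (w = 1)); auto. Qed.

Lemma low_ins i b g w : w = 0 \/ w = 1 -> low (ins i b g w).
Proof. intros [->| ->]; rewrite ?ins_0, ?ins_1; auto. Qed.

Lemma valid_rep l a w : valid a w -> valid a (rep l a w).
Proof.
  revert a w. valid_induction; [ddef|intros; rewrite rep_0; auto|..].
  - intro a. rewrite rep_low; auto using valid_ret.
  - intros a j b g He. rewrite rep_low; auto using valid_ret.
  - intros a i b g v He N0 N1 Hv IH. rewrite rep_cpy. auto using valid_ret, valid_ins.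
Qed.

Lemma rep_idem l a w : valid a w -> rep l a (rep l a w) = rep l a w.
Proof.
  revert a w. valid_induction; [ddef|intros; now rewrite !rep_0|..].
  - intro a. rewrite (@rep_low l a 1) by auto; rewrite rep_low; auto using low_ret, ret_idem.
  - intros a j b g He. rewrite (@rep_low l a (pnt j b g)) by auto; rewrite rep_low; auto using low_ret, ret_idem.
  - intros a i b g v He N0 N1 Hv IH. rewrite rep_cpy.
    set (u := rep l (part_colour i b g) v) in *.
    destruct (low_or_inner u) as [E|[E|[E0 E1]]].
    + rewrite rep_low; auto using low_ret, ret_idem, low_ins.
    + rewrite rep_low; auto using low_ret, ret_idem, low_ins.
    + rewrite (ins_inner _ _ _ E0 E1), ret_cpy, rep_cpy, IH, ins_inner, ret_cpy; auto.
Qed.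

(** Closure of the ideal under joins enters at the third part, when both colours of the ear
    lie in the ideal: then q goes to 0, and r follows the end of the edge. *)
Lemma ret_edge l a i b g : ear a b g -> ideal l (part_colour i b g) ->
  ret l a (part_start i b g) = ret l a (part_end i b g).
Proof.
  intros He H. assert (K := ear_ideal (l := l) He).
  destruct i; unfold part_colour, part_start, part_end in *; simpl in *; ear_cases; tauto.
Qed.

(** Inside the component this is how representatives are defined; at the ends of the component
    it is [ret_edge]. *)
Lemma rep_ins l a i b g w : ear a b g ->
  rep l a (ins i b g w) = ret l a (ins i b g (rep l (part_colour i b g) w)).
Proof.
  intro He. destruct (low_or_inner w) as [->|[->|[E0 E1]]].
  - rewrite rep_0, ins_0, rep_low; auto.
  - rewrite rep_1, ins_1, rep_low; auto. unfold end_rep.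
    destruct (decide _) as [H|H]; rewrite ?ins_0, ?ins_1; auto. symmetry. now apply ret_edge.
  - rewrite ins_inner, rep_cpy; auto.
Qed.

Lemma rep_cpy_fixed l a i b g v : rep l a (cpy i b g v) = cpy i b g v ->
  rep l (part_colour i b g) v = v.
Proof.
  rewrite rep_cpy. set (u := rep l _ v).
  destruct (low_or_inner u) as [E|[E|[E0 E1]]].
  - intro H. exfalso. eapply low_not_cpy; [|exact H]. auto using low_ret, low_ins.
  - intro H. exfalso. eapply low_not_cpy; [|exact H]. auto using low_ret, low_ins.
  - rewrite ins_inner, ret_cpy by auto. intro H. apply (f_equal view) in H. rewrite !view_cpy in H. congruence.
Qed.

(** ** Folding an ear onto one of its colours *)

(** The components of all the colours are glued together at their starts. *)
Definition vertex (a w : D) : D := if decide (w = 0) then 0 else pair a w.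

Definition kind_colour (k : kind) (b g : D) : D := match k with KB => b | KG => g end.

(** Both foldings send 0 and 1, the ends of the ear, to 0.  This is possible because either
    colour occurs twice in an ear, and it allows the rest of the graph to go to 0. *)
Definition fold_point (k : kind) (j : point) : D :=
  match k, j with
  | KB, Pp | KB, Pq | KG, Pq | KG, Pr => 1
  | KB, Pr | KG, Pp => 0
  end.

(** A part of the other colour is contracted; this is its image. *)
Definition fold_part (i : part) : D := match i with E1 | E4 => 0 | E2 | E3 => 1 end.

Definition same_kind (k k' : kind) : bool :=
  match k, k' with KB, KB | KG, KG => true | _, _ => false end.

Definition fold_copy (k : kind) (i : part) (v : D) : D :=
  if same_kind k (kind_of i) then v else fold_part i.

Definition fold (k : kind) (b g w : D) : D :=
  vcase w 0 0
    (fun j b' g' => if decide (b' = b /\ g' = g)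
                    then vertex (kind_colour k b g) (fold_point k j) else 0)
    (fun i b' g' v => if decide (b' = b /\ g' = g)
                      then vertex (kind_colour k b g) (fold_copy k i v)
                      else 0).

Lemma deff2_vertex : deff2 vertex.
Proof. unfold vertex. ddef. Qed.
Hint Resolve deff2_vertex : def.

Lemma deff2_kind_colour k : deff2 (kind_colour k).
Proof. destruct k; unfold kind_colour; ddef. Qed.
Lemma deff1_fold_copy k i : deff1 (fold_copy k i).
Proof. unfold fold_copy. destruct (same_kind _ _); ddef. Qed.
Hint Resolve deff2_kind_colour deff1_fold_copy : def.

Lemma deff3_fold k : deff3 (fold k).
Proof. unfold fold. gdef. Qed.
Hint Resolve deff3_fold : def.

Lemma fold_0 k b g : fold k b g 0 = 0.
Proof. unfold fold, vcase. now rewrite view_start. Qed.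

Lemma fold_1 k b g : fold k b g 1 = 0.
Proof. unfold fold, vcase. now rewrite view_end. Qed.

Lemma fold_pnt k b g j : fold k b g (pnt j b g) = vertex (kind_colour k b g) (fold_point k j).
Proof. unfold fold, vcase. rewrite view_pnt. destruct (decide _); tauto. Qed.

Lemma fold_cpy k b g i v :
  fold k b g (cpy i b g v) = vertex (kind_colour k b g) (fold_copy k i v).
Proof. unfold fold, vcase. rewrite view_cpy. destruct (decide _); tauto. Qed.

Lemma fold_pnt_other k b g j b' g' : ~ (b' = b /\ g' = g) -> fold k b g (pnt j b' g') = 0.
Proof. intro N. unfold fold, vcase. rewrite view_pnt. destruct (decide _); tauto. Qed.

Lemma fold_cpy_other k b g i b' g' v : ~ (b' = b /\ g' = g) -> fold k b g (cpy i b' g' v) = 0.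
Proof. intro N. unfold fold, vcase. rewrite view_cpy. destruct (decide _); tauto. Qed.

Lemma fold_low_other k b g x i b' g' : ~ (b' = b /\ g' = g) -> x = 0 \/ x = 1 ->
  fold k b g (ins i b' g' x) = 0.
Proof.
  intros N [->| ->]; rewrite ?ins_0, ?ins_1; destruct i; simpl;
    rewrite ?fold_0, ?fold_1, ?fold_pnt_other; auto.
Qed.

Lemma vertex_0 a : vertex a 0 = 0.
Proof. unfold vertex. destruct (decide _); tauto. Qed.

Lemma vertex_pair a w : w <> 0 -> vertex a w = pair a w.
Proof. intro N. unfold vertex. destruct (decide _); tauto. Qed.

Lemma fold_start k b g i : fold k b g (part_start i b g) =
  vertex (kind_colour k b g) (fold_copy k i 0).
Proof.
  destruct k, i; unfold part_start, fold_copy; simpl;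
    rewrite ?fold_0, ?fold_1, ?fold_pnt; simpl; rewrite ?vertex_0; auto.
Qed.

Lemma fold_end k b g i : fold k b g (part_end i b g) =
  vertex (kind_colour k b g) (fold_copy k i 1).
Proof.
  destruct k, i; unfold part_end, fold_copy; simpl;
    rewrite ?fold_pnt; simpl; rewrite ?vertex_0; auto.
Qed.

Lemma fold_ins k b g i x : x = 0 \/ x = 1 ->
  fold k b g (ins i b g x) = vertex (kind_colour k b g) (fold_copy k i x).
Proof. intros [->| ->]; rewrite ?ins_0, ?ins_1; auto using fold_start, fold_end. Qed.

(** The folding of a single ear, wherever it lies in the component; [s] is the code of its
    point p.  All the vertices outside of that ear go to 0. *)
Lemma ear_fold_exists k : exists F : D -> D -> D, deff2 F /\
  (forall i b g s w, F (cpy i b g s) (cpy i b g w) = F s w) /\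
  (forall i b g s w, (forall v, w <> cpy i b g v) -> F (cpy i b g s) w = 0) /\
  (forall b g w, F (pnt Pp b g) w = fold k b g w) /\
  (forall s w, (forall i b g v, s <> cpy i b g v) -> (forall b g, s <> pnt Pp b g) ->
     F s w = 0).
Proof.
  destruct (@recursion M HM
    (fun x => exists i b g s w, fst x = cpy i b g s /\ snd x = cpy i b g w)
    (fun x => vcase (fst x) 0 0 (fun _ _ _ => 0)
       (fun _ _ _ s => vcase (snd x) 0 0 (fun _ _ _ => 0) (fun _ _ _ w => pair s w)))
    (fun x => snd x)
    (fun x => vcase (fst x) 0 0
       (fun j b g => match j with Pp => fold k b g (snd x) | _ => 0 end) (fun _ _ _ _ => 0))
    (fun _ y => y)) as (f & Df & Ef).
  - gdef.
  - gdef.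
  - gdef.
  - gdef.
  - gdef.
  - intros x (i & b & g & s & w & E & E'). rewrite E, E'. unfold vcase.
    rewrite !view_cpy, snd_pair. apply lt_cpy.
  - exists (fun s w => f (pair s w)). split; [gdef|]. repeat split.
    + intros i b g s w. rewrite Ef. cbn beta. rewrite !fst_pair, !snd_pair.
      destruct (decide _) as [_|N]; [|exfalso; apply N; now exists i, b, g, s, w].
      unfold vcase. now rewrite !view_cpy.
    + intros i b g s w Hw. rewrite Ef. cbn beta. rewrite !fst_pair, !snd_pair.
      destruct (decide _) as [(i' & b' & g' & s' & w' & E & E')|_].
      * exfalso. view_inv E. now apply (Hw w').
      * unfold vcase. now rewrite view_cpy.
    + intros b g w. rewrite Ef. cbn beta. rewrite !fst_pair, !snd_pair.
      destruct (decide _) as [(i' & b' & g' & s' & w' & E & E')|_]; [view_inv E|].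
      unfold vcase. now rewrite view_pnt.
    + intros s w Hc Hp. rewrite Ef. cbn beta. rewrite !fst_pair, !snd_pair.
      destruct (decide _) as [(i' & b' & g' & s' & w' & E & E')|_]; [now apply Hc in E|].
      unfold vcase, view. destruct (decide _) as [Hs|]; auto.
      apply (epsilon_spec (inhabits SJunk) (encodes s)) in Hs.
      destruct (epsilon _ _) as [| |[] b g| |]; auto. now apply Hp in Hs.
Qed.

Definition ear_fold (k : kind) : D -> D -> D :=
  proj1_sig (constructive_indefinite_description _ (ear_fold_exists k)).

Lemma deff2_ear_fold k : deff2 (ear_fold k).
Proof. apply (proj2_sig (constructive_indefinite_description _ (ear_fold_exists k))). Qed.
Hint Resolve deff2_ear_fold : def.

Lemma ear_fold_cpy k i b g s w : ear_fold k (cpy i b g s) (cpy i b g w) = ear_fold k s w.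
Proof. apply (proj2_sig (constructive_indefinite_description _ (ear_fold_exists k))). Qed.

Lemma ear_fold_outside k i b g s w : (forall v, w <> cpy i b g v) ->
  ear_fold k (cpy i b g s) w = 0.
Proof. apply (proj2_sig (constructive_indefinite_description _ (ear_fold_exists k))). Qed.

Lemma ear_fold_pnt k b g w : ear_fold k (pnt Pp b g) w = fold k b g w.
Proof. apply (proj2_sig (constructive_indefinite_description _ (ear_fold_exists k))). Qed.

Lemma ear_fold_junk k s w : (forall i b g v, s <> cpy i b g v) ->
  (forall b g, s <> pnt Pp b g) -> ear_fold k s w = 0.
Proof. apply (proj2_sig (constructive_indefinite_description _ (ear_fold_exists k))). Qed.

Lemma address_cases (s : D) : (exists i b g v, s = cpy i b g v) \/ (exists b g, s = pnt Pp b g) \/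
  (forall i b g v, s <> cpy i b g v) /\ (forall b g, s <> pnt Pp b g).
Proof.
  destruct (classic (exists i b g v, s = cpy i b g v)); auto.
  destruct (classic (exists b g, s = pnt Pp b g)); auto.
  right. right. split.
  - intros i b g v E. apply H. now exists i, b, g, v.
  - intros b g E. apply H0. now exists b, g.
Qed.

Lemma ear_fold_end k s w : w = 0 \/ w = 1 -> ear_fold k s w = 0.
Proof.
  intro Hw. destruct (address_cases s) as [(i & b & g & v & ->)|[(b & g & ->)|[N1 N2]]].
  - apply ear_fold_outside. intros v'. apply low_not_cpy. destruct Hw as [->| ->]; auto.
  - rewrite ear_fold_pnt. destruct Hw as [->| ->]; auto using fold_0, fold_1.
  - now apply ear_fold_junk.
Qed.

Definition in_graph (x : D) : Prop :=
  exists a w, (w = 0 \/ colour a) /\ valid a w /\ x = vertex a w.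

Definition graph_rep (l x : D) : D := vertex (fst x) (rep l (fst x) (snd x)).

Lemma def1_in_graph : def1 in_graph.
Proof. unfold in_graph. ddef. Qed.

Lemma deff2_graph_rep : deff2 graph_rep.
Proof. unfold graph_rep. gdef. Qed.
Hint Resolve def1_in_graph deff2_graph_rep : def.

Lemma pair_00 : pair 0 0 = (0 : D).
Proof. unfold pair. now rewrite !plus0, times0. Qed.

Lemma snd_vertex a w : snd (vertex a w) = w.
Proof.
  unfold vertex. destruct (decide _) as [->|]; [rewrite <- pair_00 at 1|]; apply snd_pair.
Qed.

Lemma snd_0 : snd (0 : D) = 0.
Proof. generalize (snd_vertex 0 0). now rewrite vertex_0. Qed.

Lemma fst_vertex a w : w <> 0 -> fst (vertex a w) = a.
Proof. intro N. rewrite vertex_pair by auto. apply fst_pair. Qed.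

Lemma graph_rep_vertex l a w : graph_rep l (vertex a w) = vertex a (rep l a w).
Proof.
  unfold graph_rep. rewrite snd_vertex. destruct (classic (w = 0)) as [->|N].
  - now rewrite !rep_0, !vertex_0.
  - now rewrite fst_vertex.
Qed.

Lemma graph_rep_0 l : graph_rep l 0 = 0.
Proof. rewrite <- (vertex_0 0) at 1. now rewrite graph_rep_vertex, rep_0, vertex_0. Qed.

Lemma vertex_inj a w w' : vertex a w = vertex a w' -> w = w'.
Proof. intro H. apply (f_equal snd) in H. now rewrite !snd_vertex in H. Qed.

(** Foldings respect representatives: on the ear itself by inspection, and elsewhere
    because the ear meets the rest of the graph only in vertices that go to 0. *)
Lemma ear_fold_low k s l a x : low x ->
  graph_rep l (ear_fold k s x) = graph_rep l (ear_fold k s (ret l a x)).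
Proof.
  intro Hx. destruct (address_cases s) as [(i & b & g & v & ->)|[(b & g & ->)|[N1 N2]]].
  - rewrite !ear_fold_outside; auto; intro; apply low_not_cpy; auto using low_ret.
  - rewrite !ear_fold_pnt. destruct Hx as [->|[->|(j & b' & g' & ->)]].
    + now rewrite ret_0.
    + rewrite ret_1. unfold end_rep. destruct (decide _); now rewrite ?fold_0, ?fold_1.
    + destruct (classic (b' = b /\ g' = g)) as [[-> ->]|N].
      * destruct k, j; ear_cases; rewrite ?fold_0, ?fold_1, ?fold_pnt; simpl;
          rewrite ?graph_rep_vertex, ?graph_rep_0, ?rep_0, ?rep_1; unfold end_rep;
          repeat destruct (decide _); rewrite ?vertex_0; tauto.
      * destruct j; ear_cases; rewrite ?fold_0, ?fold_1, ?(fold_pnt_other _ _ N); auto.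
  - now rewrite !ear_fold_junk.
Qed.

Lemma graph_rep_vertex_fixed l a w : valid a w ->
  graph_rep l (vertex a (rep l a w)) = graph_rep l (vertex a w).
Proof. intro H. now rewrite !graph_rep_vertex, rep_idem. Qed.

Lemma same_head i (b g w : D) : (exists v, w = cpy i b g v) \/ (forall v, w <> cpy i b g v).
Proof.
  destruct (classic (exists v, w = cpy i b g v)) as [H|H]; auto.
  right. intros v E. eauto.
Qed.

Lemma same_kind_eq k k' : same_kind k k' = true -> k = k'.
Proof. destruct k, k'; simpl; congruence. Qed.

Lemma ear_fold_rep k l a w : valid a w -> forall s,
  graph_rep l (ear_fold k s w) = graph_rep l (ear_fold k s (rep l a w)).
Proof.
  revert a w. valid_induction; [ddef|..].
  - intros a s. now rewrite rep_0.
  - intros a s. rewrite rep_low; auto. now apply ear_fold_low.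
  - intros a j b g He s. rewrite rep_low; auto. now apply ear_fold_low.
  - intros a i b g w He N0 N1 Hw IH s. rewrite rep_cpy.
    set (u := rep l (part_colour i b g) w) in *.
    assert (Hu : (u = 0 \/ u = 1) \/ u <> 0 /\ u <> 1)
      by (destruct (low_or_inner u) as [H|[H|H]]; auto).
    destruct Hu as [Hu|[U0 U1]].
    + rewrite <- ear_fold_low by auto using low_ins.
      destruct (address_cases s) as [(i' & b' & g' & s' & ->)|[(b' & g' & ->)|[K1 K2]]].
      * rewrite (ear_fold_outside _ _ (w := ins i b g u))
          by (intro; apply low_not_cpy, low_ins, Hu).
        destruct (same_head i' b' g' (cpy i b g w)) as [[v Ev]|Ev].
        -- view_inv Ev. rewrite ear_fold_cpy, IH, ear_fold_end; auto.
        -- now rewrite ear_fold_outside.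
      * rewrite !ear_fold_pnt. destruct (classic (b = b' /\ g = g')) as [[<- <-]|N].
        -- rewrite fold_cpy, fold_ins by auto. unfold fold_copy.
           destruct (same_kind k (kind_of i)) eqn:Ek; auto.
           apply same_kind_eq in Ek as ->. symmetry. now apply graph_rep_vertex_fixed.
        -- rewrite fold_cpy_other, fold_low_other; auto.
      * now rewrite !ear_fold_junk.
    + rewrite ins_inner, ret_cpy by auto.
      destruct (address_cases s) as [(i' & b' & g' & s' & ->)|[(b' & g' & ->)|[K1 K2]]].
      * destruct (same_head i' b' g' (cpy i b g w)) as [[v Ev]|Ev].
        -- view_inv Ev. rewrite !ear_fold_cpy. apply IH.
        -- rewrite !ear_fold_outside; auto. intros v Ev'. view_inv Ev'. now apply (Ev w).
      * rewrite !ear_fold_pnt. destruct (classic (b = b' /\ g = g')) as [[<- <-]|N].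
        -- rewrite !fold_cpy. unfold fold_copy.
           destruct (same_kind k (kind_of i)) eqn:Ek; auto.
           apply same_kind_eq in Ek as ->. symmetry. now apply graph_rep_vertex_fixed.
        -- now rewrite !fold_cpy_other.
      * now rewrite !ear_fold_junk.
Qed.

Lemma in_graph_0 : in_graph 0.
Proof. exists 0, 0. rewrite vertex_0. auto. Qed.

Lemma in_graph_vertex a w : colour a -> valid a w -> in_graph (vertex a w).
Proof. exists a, w. auto. Qed.
Hint Resolve in_graph_0 in_graph_vertex : core.

Lemma ear_kind_colour a b g k : ear a b g -> colour (kind_colour k b g).
Proof. intro H. apply ear_colour in H. destruct k; simpl; tauto. Qed.

Lemma ear_fold_in_graph k a w : valid a w -> forall s, in_graph (ear_fold k s w).
Proof.
  revert a w. valid_induction; [ddef|..].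
  - intros a s. rewrite ear_fold_end; auto.
  - intros a s. rewrite ear_fold_end; auto.
  - intros a j b g He s.
    destruct (address_cases s) as [(i' & b' & g' & s' & ->)|[(b' & g' & ->)|[K1 K2]]].
    + rewrite ear_fold_outside; auto. intro. now apply low_not_cpy.
    + rewrite ear_fold_pnt. destruct (classic (b = b' /\ g = g')) as [[<- <-]|N].
      * rewrite fold_pnt. apply in_graph_vertex; eauto using ear_kind_colour.
        destruct k, j; simpl; auto.
      * rewrite fold_pnt_other; auto.
    + rewrite ear_fold_junk; auto.
  - intros a i b g w He N0 N1 Hw IH s.
    destruct (address_cases s) as [(i' & b' & g' & s' & ->)|[(b' & g' & ->)|[K1 K2]]].
    + destruct (same_head i' b' g' (cpy i b g w)) as [[v Ev]|Ev].
      * view_inv Ev. rewrite ear_fold_cpy. auto.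
      * rewrite ear_fold_outside; auto.
    + rewrite ear_fold_pnt. destruct (classic (b = b' /\ g = g')) as [[<- <-]|N].
      * rewrite fold_cpy. apply in_graph_vertex; eauto using ear_kind_colour.
        unfold fold_copy. destruct (same_kind k (kind_of i)) eqn:Ek.
        -- apply same_kind_eq in Ek as ->. exact Hw.
        -- destruct i; simpl; auto.
      * rewrite fold_cpy_other; auto.
    + rewrite ear_fold_junk; auto.
Qed.

Definition separated (l w v : D) : Prop :=
  exists k s c, colour c /\ ~ ideal l c /\
    (ear_fold k s w = pair c 1 /\ ear_fold k s v = 0 \/
     ear_fold k s w = 0 /\ ear_fold k s v = pair c 1).

Lemma separated_sym l w v : separated l w v -> separated l v w.
Proof. intros (k & s & c & H1 & H2 & H3). exists k, s, c. tauto. Qed.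

Lemma def2_separated l : def2 (separated l).
Proof. unfold separated. gdef. Qed.
Hint Resolve def2_separated : def.

Lemma pnt_neq0 j (b g : D) : pnt j b g <> 0.
Proof. intro E. view_inv E. Qed.
Lemma pnt_neq1 j (b g : D) : pnt j b g <> 1.
Proof. intro E. view_inv E. Qed.

(** A representative in an ear is sent to the end by the folding onto a colour of the ear that
    is not in the ideal: for p this is [b], and for q and r it is [g]. *)
Lemma separate_pnt l a b g j : ear a b g -> rep l a (pnt j b g) = pnt j b g ->
  exists k c, colour c /\ ~ ideal l c /\ fold k b g (pnt j b g) = pair c 1.
Proof.
  intros He Hr. assert (C := ear_colour He). rewrite rep_low in Hr by auto.
  destruct j.
  - exists KB, b. rewrite fold_pnt. simpl. rewrite vertex_pair by apply one_neq0.
    ear_cases; try (symmetry in Hr; apply pnt_neq0 in Hr); tauto.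
  - exists KG, g. rewrite fold_pnt. simpl. rewrite vertex_pair by apply one_neq0.
    ear_cases; try (symmetry in Hr; apply pnt_neq0 in Hr); try tauto. view_inv Hr.
  - exists KG, g. rewrite fold_pnt. simpl. rewrite vertex_pair by apply one_neq0.
    ear_cases; try (symmetry in Hr; apply pnt_neq0 in Hr); try tauto;
      view_inv Hr.
Qed.

Lemma separated_from_0 l a w : valid a w -> w <> 0 -> w <> 1 -> rep l a w = w ->
  exists k s c, colour c /\ ~ ideal l c /\ ear_fold k s w = pair c 1.
Proof.
  revert a w. valid_induction; [gdef|tauto|tauto|..].
  - intros a j b g He _ _ Hr. destruct (separate_pnt He Hr) as (k & c & H1 & H2 & H3).
    exists k, (pnt Pp b g), c. now rewrite ear_fold_pnt.
  - intros a i b g w He N0 N1 Hw IH _ _ Hr. apply rep_cpy_fixed in Hr.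
    destruct (IH N0 N1 Hr) as (k & s & c & H1 & H2 & H3).
    exists k, (cpy i b g s), c. now rewrite ear_fold_cpy.
Qed.

Lemma separated_outside l a i b g w v : ear a b g -> w <> 0 -> w <> 1 ->
  valid (part_colour i b g) w -> rep l a (cpy i b g w) = cpy i b g w ->
  (forall u, v <> cpy i b g u) -> separated l (cpy i b g w) v.
Proof.
  intros He N0 N1 Hw Hr Hv. apply rep_cpy_fixed in Hr.
  destruct (separated_from_0 Hw N0 N1 Hr) as (k & s & c & H1 & H2 & H3).
  exists k, (cpy i b g s), c. rewrite ear_fold_cpy, ear_fold_outside; auto.
Qed.

Lemma separated_pnts l a b g j j' : ear a b g -> j <> j' ->
  rep l a (pnt j b g) = pnt j b g -> rep l a (pnt j' b g) = pnt j' b g ->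
  separated l (pnt j b g) (pnt j' b g).
Proof.
  intros He N Hr Hr'. destruct (ear_colour He) as (_ & Cb & Cg).
  assert (Sep : forall k, colour (kind_colour k b g) -> ~ ideal l (kind_colour k b g) ->
    fold_point k j = 1 /\ fold_point k j' = 0 \/ fold_point k j = 0 /\ fold_point k j' = 1 ->
    separated l (pnt j b g) (pnt j' b g)).
  { intros k Hc Hi F. exists k, (pnt Pp b g), (kind_colour k b g).
    split; [auto|split; [auto|]]. rewrite !ear_fold_pnt, !fold_pnt.
    destruct F as [[-> ->]|[-> ->]]; rewrite vertex_0, (vertex_pair _ one_neq0); auto. }
  assert (Ig : forall i, i <> Pp -> rep l a (pnt i b g) = pnt i b g -> ~ ideal l g).
  { intros i Ni Ei Hg. rewrite rep_low, ret_pnt in Ei by auto.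
    destruct i; [tauto| |]; simpl in Ei; unfold p_rep, end_rep in Ei;
      repeat destruct (decide _); try tauto; now view_inv Ei. }
  assert (Ib : forall i, i <> Pq -> rep l a (pnt i b g) = pnt i b g -> ~ ideal l b).
  { intros i Ni Ei Hb. rewrite rep_low, ret_pnt in Ei by auto.
    destruct i; [|tauto|]; simpl in Ei; unfold p_rep, end_rep in Ei;
      repeat destruct (decide _); try tauto; now view_inv Ei. }
  assert (Sb := Sep KB Cb). assert (Sg := Sep KG Cg). clear Sep.
  destruct j, j'; try (exfalso; now apply N); simpl in Sb, Sg.
  - apply Sg; auto. now apply (Ig Pq).
  - apply Sb; auto. now apply (Ib Pp).
  - apply Sg; auto. now apply (Ig Pq).
  - apply Sb; auto. now apply (Ib Pr).
  - apply Sb; auto. now apply (Ib Pp).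
  - apply Sb; auto. now apply (Ib Pr).
Qed.

(** Two representatives inside the same part are separated inside the component attached
    there.  Otherwise one of them lies inside a part that does not contain the other, or both
    are points, and a folding of the ear reached in this way separates them. *)
Lemma separation l a w : valid a w -> forall v, valid a v -> w <> v ->
  rep l a w = w -> rep l a v = v -> (w <> 0 /\ w <> 1) \/ (v <> 0 /\ v <> 1) ->
  separated l w v.
Proof.
  assert (End : forall a w v, valid a v -> rep l a v = v -> w = 0 \/ w = 1 ->
                  v <> 0 -> v <> 1 -> separated l w v).
  { clear a w. intros a w v Hv Hr Hw N0 N1.
    destruct (separated_from_0 Hv N0 N1 Hr) as (k & s & c & H1 & H2 & H3).
    exists k, s, c. rewrite (ear_fold_end k s Hw). tauto. }
  revert a w. valid_induction; [gdef|..].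
  - intros a v Hv N _ Hr [[? ?]|[? ?]]; [tauto|eauto].
  - intros a v Hv N _ Hr [[? ?]|[? ?]]; [tauto|eauto].
  - intros a j b g He v Hv N Hr Hr' _.
    apply valid_iff in Hv as [[->|[->|(j' & b' & g' & -> & He')]]
                             |(i & b' & g' & u & -> & He' & N0 & N1 & Hu)].
    + apply separated_sym. eapply End; eauto using pnt_neq0, pnt_neq1.
    + apply separated_sym. eapply End; eauto using pnt_neq0, pnt_neq1.
    + destruct (classic (b' = b /\ g' = g)) as [[-> ->]|Nb].
      * eapply separated_pnts; eauto. congruence.
      * destruct (separate_pnt He Hr) as (k & c & H1 & H2 & H3).
        exists k, (pnt Pp b g), c. rewrite !ear_fold_pnt, H3, fold_pnt_other; auto.
    + apply separated_sym. eapply separated_outside; eauto.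
      intro u'. now apply low_not_cpy.
  - intros a i b g w He N0 N1 Hw IH v Hv N Hr Hr' _.
    destruct (same_head i b g v) as [[u ->]|Nv].
    + apply valid_iff in Hv as [Hl|(i' & b' & g' & u' & E & He' & M0 & M1 & Hu)].
      { exfalso. destruct Hl as [E|[E|(j & b' & g' & E & _)]]; view_inv E. }
      view_inv E. apply rep_cpy_fixed in Hr, Hr'.
      destruct (IH u') as (k & s & c & H1 & H2 & H3); auto.
      { intros ->. tauto. }
      exists k, (cpy i' b' g' s), c. now rewrite !ear_fold_cpy.
    + eapply separated_outside; eauto.
Qed.

(** ** The operations and their congruences *)

(** The insertions spread the contraction of one edge to all the edges of its colour; the
    foldings and the retractions onto a component detect which edges are contracted. *)
Inductive operation :=
| OpIns (a : D) (i : part) (b g : D)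
| OpFold (a : D) (k : kind) (s : D)
| OpRoot (a : D).

Definition admissible (o : operation) : Prop :=
  match o with OpIns a _ b g => ear a b g | _ => True end.

Definition operate (o : operation) (x : D) : D :=
  match o with
  | OpIns a i b g =>
      vertex a (ins i b g (if decide (fst x = part_colour i b g) then snd x else 0))
  | OpFold a k s => if decide (fst x = a) then ear_fold k s (snd x) else 0
  | OpRoot a => if decide (fst x = a) then x else 0
  end.

Lemma operate_vertex o a w : operate o (vertex a w) =
  match o with
  | OpIns a' i b g => vertex a' (ins i b g (if decide (a = part_colour i b g) then w else 0))
  | OpFold a' k s => if decide (a = a') then ear_fold k s w else 0
  | OpRoot a' => if decide (a = a') then vertex a w else 0
  end.
Proof.
  destruct (classic (w = 0)) as [->|N].
  - destruct o; unfold operate; rewrite vertex_0.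
    + rewrite snd_0. now repeat destruct (decide _).
    + rewrite snd_0, ear_fold_end by auto.
      now repeat destruct (decide _).
    + now repeat destruct (decide _).
  - unfold operate. rewrite snd_vertex, fst_vertex by auto. reflexivity.
Qed.

Lemma operate_0 o : operate o 0 = match o with
  | OpIns a i b g => vertex a (part_start i b g) | _ => 0 end.
Proof.
  rewrite <- (vertex_0 0), operate_vertex. destruct o.
  - rewrite <- (ins_0 i b g). now destruct (decide _).
  - rewrite ear_fold_end by auto. rewrite vertex_0. now destruct (decide _).
  - rewrite vertex_0. now destruct (decide _).
Qed.

Lemma operate_in_graph o x : admissible o -> in_graph x -> in_graph (operate o x).
Proof.
  intros Ho (a & w & Hc & Hw & ->). rewrite operate_vertex.
  destruct o as [a' i b g|a' k s|a']; simpl in Ho.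
  - apply in_graph_vertex; [now apply ear_colour in Ho|].
    apply valid_ins; auto. destruct (decide _) as [<-|]; auto.
  - destruct (decide _); auto. eapply ear_fold_in_graph, Hw.
  - destruct (decide _); auto. now exists a, w.
Qed.

Lemma graph_rep_operate l o x : admissible o -> in_graph x ->
  graph_rep l (operate o x) = graph_rep l (operate o (graph_rep l x)).
Proof.
  intros Ho (a & w & Hc & Hw & ->). rewrite graph_rep_vertex, !operate_vertex.
  destruct o as [a' i b g|a' k s|a']; simpl in Ho.
  - rewrite !graph_rep_vertex. destruct (decide _) as [->|]; auto.
    now rewrite !rep_ins, rep_idem.
  - destruct (decide _) as [->|]; auto. now apply ear_fold_rep.
  - destruct (decide _); auto. now rewrite graph_rep_vertex_fixed.
Qed.

Definition graph_congruence (theta : D -> D -> Prop) : Prop :=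
  (forall x y, theta x y -> in_graph x /\ in_graph y) /\
  (forall x, in_graph x -> theta x x) /\
  (forall x y, theta x y -> theta y x) /\
  (forall x y z, theta x y -> theta y z -> theta x z) /\
  (forall o x y, admissible o -> theta x y -> theta (operate o x) (operate o y)).

Definition modulo (l x y : D) : Prop :=
  in_graph x /\ in_graph y /\ graph_rep l x = graph_rep l y.

Lemma modulo_congruence l : graph_congruence (modulo l).
Proof.
  unfold modulo. split; [|split; [|split; [|split]]]; try tauto.
  - intros x y (Hx & Hy & E). auto.
  - intros x y z (Hx & Hy & E) (_ & Hz & E'). repeat split; congruence.
  - intros o x y Ho (Hx & Hy & E). repeat split; auto using operate_in_graph.
    rewrite graph_rep_operate, E, <- graph_rep_operate; auto.
Qed.

Lemma modulo_edge l a : colour a -> (modulo l 0 (vertex a 1) <-> ideal l a).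
Proof.
  intro Ha. unfold modulo. rewrite graph_rep_0, graph_rep_vertex, rep_1. unfold end_rep.
  destruct (decide _) as [H|H].
  - rewrite vertex_0. split; auto.
  - split; [|tauto]. intros (_ & _ & E). exfalso. rewrite <- (vertex_0 a) in E.
    apply vertex_inj in E. symmetry in E. now apply one_neq0 in E.
Qed.

Lemma graph_rep_idem l x : in_graph x -> graph_rep l (graph_rep l x) = graph_rep l x.
Proof.
  intros (a & w & Hc & Hw & ->). rewrite !graph_rep_vertex, rep_idem; auto.
Qed.

Section Congruence.
Variable theta : D -> D -> Prop.
Hypothesis def2_theta : def2 theta.
Hypothesis cong : graph_congruence theta.
Hint Resolve def2_theta : def.

Definition identified (a : D) : Prop := theta 0 (vertex a 1).

Lemma theta_refl x : in_graph x -> theta x x.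
Proof. apply cong. Qed.
Lemma theta_sym x y : theta x y -> theta y x.
Proof. apply cong. Qed.
Lemma theta_trans y x z : theta x y -> theta y z -> theta x z.
Proof. apply cong. Qed.
Lemma theta_operate o x y : admissible o -> theta x y -> theta (operate o x) (operate o y).
Proof. apply cong. Qed.

Lemma theta_part a i b g : ear a b g -> identified (part_colour i b g) ->
  theta (vertex a (part_start i b g)) (vertex a (part_end i b g)).
Proof.
  intros He H. apply (@theta_operate (OpIns a i b g)) in H; auto.
  rewrite operate_0, operate_vertex in H. destruct (decide _); [|tauto].
  now rewrite ins_1 in H.
Qed.

(** The ear of [b] and [g] joins the ends of an edge coloured [a]. *)
Lemma identified_ear a b g : ear a b g -> identified b -> identified g -> identified a.
Proof.
  intros He Hb Hg. unfold identified. rewrite <- (vertex_0 a).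
  apply theta_trans with (vertex a (pnt Pp b g)); [exact (@theta_part a E1 b g He Hb)|].
  apply theta_trans with (vertex a (pnt Pq b g)); [exact (@theta_part a E2 b g He Hg)|].
  apply theta_trans with (vertex a (pnt Pr b g)); apply theta_sym.
  - exact (@theta_part a E3 b g He Hb).
  - exact (@theta_part a E4 b g He Hg).
Qed.

Variable l : D.

(** Every step of the retraction runs along an edge that is contracted. *)
Lemma theta_low a x : (forall c, colour c -> ideal l c -> identified c) ->
  colour a -> valid a x -> low x -> theta (vertex a x) (vertex a (ret l a x)).
Proof.
  intros HI Ha Hv Hx.
  assert (End : theta (vertex a 1) (vertex a (end_rep l a))).
  { unfold end_rep. destruct (decide _); [|apply theta_refl; auto].
    rewrite vertex_0. apply theta_sym. now apply HI. }
  apply valid_iff in Hv as [[->|[->|(j & b & g & -> & He)]]|(i & b & g & v & -> & _)].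
  - rewrite ret_0. apply theta_refl; auto.
  - now rewrite ret_1.
  - rewrite ret_pnt. assert (C := ear_colour He).
    assert (P : theta (vertex a (pnt Pp b g)) (vertex a (p_rep l b g))).
    { unfold p_rep. destruct (decide _); [|apply theta_refl; auto].
      apply theta_sym. apply (@theta_part a E1 b g He). apply HI; tauto. }
    destruct j; simpl; auto.
    + destruct (decide _); [|apply theta_refl; auto].
      apply theta_trans with (vertex a (pnt Pp b g)); auto.
      apply theta_sym. apply (@theta_part a E2 b g He). apply HI; tauto.
    + destruct (decide _).
      * apply theta_trans with (vertex a 1); auto.
        apply theta_sym. apply (@theta_part a E4 b g He). apply HI; tauto.
      * destruct (decide _); [|apply theta_refl; auto].
        apply (@theta_part a E3 b g He). apply HI; tauto.
  - exfalso. eapply low_not_cpy; [exact Hx|reflexivity].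
Qed.

Lemma theta_rep x : (forall c, colour c -> ideal l c -> identified c) ->
  in_graph x -> theta x (graph_rep l x).
Proof.
  intros HI (a & w & Hc & Hw & ->). rewrite graph_rep_vertex.
  destruct Hc as [->|Hc].
  { rewrite rep_0, vertex_0. apply theta_refl; auto. }
  revert a w Hw Hc. valid_induction; [gdef|..].
  - intros a Ha. rewrite rep_low; auto using theta_low.
  - intros a Ha. rewrite rep_low; auto using theta_low.
  - intros a j b g He Ha. rewrite rep_low; auto using theta_low.
  - intros a i b g w He N0 N1 Hw IH Ha. rewrite rep_cpy.
    set (u := rep l (part_colour i b g) w) in *.
    assert (K : theta (vertex a (cpy i b g w)) (vertex a (ins i b g u))).
    { assert (C : colour (part_colour i b g)) by exact (ear_kind_colour (kind_of i) He).
      specialize (IH C). apply (@theta_operate (OpIns a i b g)) in IH; auto.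
      rewrite !operate_vertex in IH. destruct (decide _); [|tauto].
      now rewrite ins_inner in IH. }
    apply theta_trans with (vertex a (ins i b g u)); auto.
    assert (Hu : valid (part_colour i b g) u) by now apply valid_rep.
    destruct (low_or_inner u) as [E|[E|[U0 U1]]].
    + apply theta_low; auto using valid_ins, low_ins.
    + apply theta_low; auto using valid_ins, low_ins.
    + rewrite ins_inner, ret_cpy; auto. apply theta_refl. auto.
Qed.

(** Every vertex is congruent to its representative, and two congruent representatives are
    equal: otherwise a folding that separates them would show that an edge with a colour
    outside of the ideal is contracted. *)
Theorem congruence_modulo : (forall c, colour c -> (ideal l c <-> identified c)) ->
  forall x y, theta x y <-> modulo l x y.
Proof.
  intro HI.
  assert (Rep : forall x, in_graph x -> theta x (graph_rep l x)).
  { intros x Hx. apply theta_rep; auto. intros c Hc. now apply HI. }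
  assert (Fixed : forall x y, theta x y -> graph_rep l x = x -> graph_rep l y = y ->
                    x <> 0 -> x = y).
  { intros x y Hxy Hx Hy N0. apply NNPP. intro N.
    destruct (proj1 cong _ _ Hxy) as [(a & w & Hc & Hw & ->) (a' & v & Hc' & Hv & ->)].
    destruct Hc as [->|Hc]; [now rewrite vertex_0 in N0|].
    assert (Nw : w <> 0) by (intros ->; now rewrite vertex_0 in N0).
    rewrite graph_rep_vertex in Hx, Hy. apply vertex_inj in Hx, Hy.
    assert (H : exists v', valid a v' /\ rep l a v' = v' /\ w <> v' /\
                  theta (vertex a w) (vertex a v')).
    { destruct (classic (a' = a)) as [->|Na].
      - exists v. repeat split; auto. congruence.
      - exists 0. repeat split; auto using rep_0.
        apply (@theta_operate (OpRoot a)) in Hxy; simpl; auto.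
        rewrite !operate_vertex in Hxy. rewrite vertex_0.
        destruct (decide (a = a)), (decide (a' = a)); tauto. }
    destruct H as (v' & Hv' & Hr & Nv & H).
    assert (Sep : separated l w v' \/ w = 1 /\ v' = 0).
    { destruct (low_or_inner w) as [E|[E|E]]; [tauto| |left; eapply separation; eauto].
      destruct (low_or_inner v') as [E'|[E'|E']]; auto; [congruence|].
      left. eapply separation; eauto. }
    destruct Sep as [(k & s & c & Cc & Nc & E)|[-> ->]].
    - apply Nc, HI; auto. unfold identified. rewrite vertex_pair by apply one_neq0.
      apply (@theta_operate (OpFold a k s)) in H; simpl; auto.
      rewrite !operate_vertex in H. destruct (decide (a = a)); [|tauto].
      destruct E as [[-> ->]|[-> ->]] in H; auto. now apply theta_sym.
    - assert (I : ideal l a).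
      { apply HI; auto. apply theta_sym. now rewrite vertex_0 in H. }
      rewrite rep_1 in Hx. unfold end_rep in Hx. destruct (decide _); [|tauto].
      now apply one_neq0. }
  intros x y. split.
  - intro H. assert (G := proj1 cong _ _ H). destruct G as [Gx Gy].
    split; [|split]; auto.
    assert (K : theta (graph_rep l x) (graph_rep l y)).
    { apply theta_trans with x; [now apply theta_sym, Rep|].
      apply theta_trans with y; auto. }
    destruct (classic (graph_rep l x = 0)) as [Ex|Nx].
    + destruct (classic (graph_rep l y = 0)) as [Ey|Ny]; [congruence|].
      symmetry. apply Fixed; auto using graph_rep_idem. now apply theta_sym.
    + apply Fixed; auto using graph_rep_idem.
  - intros (Gx & Gy & E). apply theta_trans with (graph_rep l x); auto.
    rewrite E. now apply theta_sym, Rep.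
Qed.

End Congruence.

Lemma def3_modulo : def3 modulo.
Proof. unfold modulo. gdef. Qed.

End Graph.

#[export] Hint Resolve deff2_part_colour deff3_ins deff2_vertex : def.
#[export] Hint Extern 1 (def1 colour) => apply def1_colour : def.
#[export] Hint Extern 1 (def3 ear) => apply def3_ear : def.
#[export] Hint Extern 1 (def2 ideal) => apply def2_ideal : def.
#[export] Hint Extern 1 (deff2 (ear_fold _)) => apply deff2_ear_fold : def.
#[export] Hint Extern 1 (def1 in_graph) => apply def1_in_graph : def.
#[export] Hint Extern 1 (def3 modulo) => apply def3_modulo : def.

(** * The algebra of the graph *)

Section Sequences.
Context {M : model} {HM : ACA M}.
Local Open Scope num_scope.
Notation D := (num M).
Notation set := (sets M).
Add Ring num_ring : (num_semiring (M := M)).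

Lemma lt_1 (i : D) : i < 1 -> i = 0.
Proof.
  rewrite <- (plus0l 1). intro H. apply ltS in H as [H|H]; auto. now apply not_lt0 in H.
Qed.

Lemma lt_01 : (0 : D) < 1.
Proof. rewrite <- (plus0l 1). apply lt_succ. Qed.

Lemma remainder_unique (m q q' y y' : D) : q * m + y = q' * m + y' -> y < m -> y' < m -> y = y'.
Proof.
  assert (W : forall q q' y y' : D, q * m + y = q' * m + y' -> y < m -> q <= q' -> y = y').
  { clear q q' y y'. intros q q' y y' E H [z ->]. destruct (zero_or_succ z) as [->|[w ->]].
    - apply (@plus_cancel M HM _ _ (q * m)). rewrite (plus_comm y), E. ring.
    - exfalso. apply (lt_not_le H). exists (w * m + y').
      apply (@plus_cancel M HM _ _ (q * m)). rewrite (plus_comm y), E. ring. }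
  intros E H H'. destruct (le_or_lt q q') as [K|K]; [eauto|].
  symmetry. apply lt_le_incl in K. eauto.
Qed.

Lemma remainder_ex (m a : D) : exists q y, a = q * (m + 1) + y /\ y < m + 1.
Proof.
  pattern a. apply induction; [ddef| |].
  - exists 0, 0. split; [ring|]. apply lt_succ_le, le0.
  - clear a. intros a (q & y & -> & H). destruct (le_or_lt (m + 1) (y + 1)) as [K|K].
    + exists (q + 1), 0. split; [|apply lt_succ_le, le0].
      assert (y = m) as ->; [|ring].
      apply lt_succ_le in H. destruct K as [z K]. apply le_antisym; auto.
      exists z. apply (@plus_cancel M HM _ _ 1). rewrite K. ring.
    + exists q, (y + 1). split; [ring|auto].
Qed.

Lemma seq_code_1 (s : D) : seq_code 1 s -> exists x, entry s 0 x.
Proof.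
  intros (a & b & -> & _). destruct (remainder_ex ((0 + 1) * b) a) as (q & y & E & H).
  exists y, 1, a, b. split; [reflexivity|split; [apply lt_01|]].
  split; [exact H|]. now exists q.
Qed.

Lemma seq_code_index (s i y : D) : seq_code 1 s -> entry s i y -> i = 0.
Proof.
  intros (a & b & -> & _) (n & a' & b' & E & H & _).
  apply pair_inj in E as [<- _]. now apply lt_1.
Qed.

Lemma entry_unique (s i y y' : D) : entry s i y -> entry s i y' -> y = y'.
Proof.
  intros (n & a & b & -> & _ & H & q & Hq) (n' & a' & b' & E & _ & H' & q' & Hq').
  apply pair_inj in E as [<- E]. apply pair_inj in E as [<- <-].
  apply (@remainder_unique ((i + 1) * b + 1) q q'); auto. congruence.
Qed.

Lemma entry_fun (s i j y y' : D) : seq_code 1 s -> entry s i y -> entry s j y' -> y = y'.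
Proof.
  intros Hs H H'. assert (i = 0) as -> by eauto using seq_code_index.
  assert (j = 0) as -> by eauto using seq_code_index. eapply entry_unique; eauto.
Qed.

Lemma def4_beta : def4 (@beta M).
Proof. unfold beta. ddef. Qed.
Hint Resolve def4_beta : def.

Lemma def3_entry : def3 (@entry M).
Proof. unfold entry. ddef. Qed.

(** Every number is its own remainder modulo a larger one, and the least code with that
    remainder satisfies the minimality required of codes of sequences. *)
Lemma singleton_code (x : D) : exists s, seq_code 1 s /\ entry s 0 x.
Proof.
  destruct (@least M HM (fun c => exists a b, c = pair a b /\ beta a b 0 x))
    as (c & (a & b & -> & Hb) & Hl); [ddef| |].
  - exists (pair x x), x, x. split; auto. split; [apply lt_succ_le; exists 0; ring|].
    exists 0. ring.
  - exists (pair 1 (pair a b)). split.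
    + exists a, b. split; auto. intros a' b' H. exists 0. split; [apply lt_01|].
      exists x. split; auto. intro K. apply (Hl _ H). eauto.
    + exists 1, a, b. auto using lt_01.
Qed.

End Sequences.

#[export] Hint Resolve def4_beta def3_entry : def.

Section GraphAlgebra.
Context {M : model} {HM : ACA M} {GC : Colouring M}.
Local Open Scope num_scope.
Notation D := (num M).
Notation set := (sets M).

Notation op := (operation (M := M)).

Definition kind_tag (k : kind) : nat := match k with KB => 1 | KG => 2 end.

Definition operation_code (o : op) : D :=
  match o with
  | OpIns a i b g => pair (numeral (part_tag i)) (pair a (pair b g))
  | OpFold a k s => pair (numeral (kind_tag k)) (pair a s)
  | OpRoot a => pair 0 a
  end.

Lemma operation_code_inj o o' : operation_code o = operation_code o' -> o = o'.
Proof.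
  change 0 with (numeral (M := M) 0).
  destruct o as [a i b g|a k s|a], o' as [a' i' b' g'|a' k' s'|a']; unfold operation_code;
    intro E; apply pair_inj in E as [Et E]; change 0 with (numeral (M := M) 0) in Et;
    apply numeral_inj in Et.
  - apply pair_inj in E as [-> E]. apply pair_inj in E as [-> ->].
    destruct i, i'; congruence || discriminate.
  - destruct i, k'; discriminate.
  - destruct i; discriminate.
  - destruct i', k; discriminate.
  - apply pair_inj in E as [-> ->]. destruct k, k'; congruence || discriminate.
  - destruct k; discriminate.
  - destruct i'; discriminate.
  - destruct k'; discriminate.
  - congruence.
Qed.

Lemma def_ex_operation (Q : op -> set -> (nat -> D) -> Prop) :
  (forall i, def (fun X r => exists a b g, Q (OpIns a i b g) X r)) ->
  (forall k, def (fun X r => exists a s, Q (OpFold a k s) X r)) ->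
  def (fun X r => exists a, Q (OpRoot a) X r) ->
  def (fun X r => exists o, Q o X r).
Proof.
  intros H1 H2 H3.
  apply def_iff with (fun X r => (exists i a b g, Q (OpIns a i b g) X r) \/
    (exists k a s, Q (OpFold a k s) X r) \/ exists a, Q (OpRoot a) X r).
  - intros X r. split.
    + intros [(i & a & b & g & H)|[(k & a & s & H)|(a & H)]]; eauto.
    + intros [[a i b g|a k s|a] H]; eauto 10.
  - auto using def_or, def_ex_part, def_ex_kind.
Qed.

Lemma graph_algebra_sets : exists A I N F : set,
  (forall x, x ∈ A <-> in_graph x) /\
  (forall n, n ∈ I <-> exists o, admissible o /\ n = operation_code o) /\
  (forall z, z ∈ N <-> exists n, n ∈ I /\ z = pair n 1) /\
  (forall z, z ∈ F <-> exists o, admissible o /\ exists s x,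
     entry s 0 x /\ z = pair (pair (operation_code o) s) (operate o x)).
Proof.
  destruct (@comp M HM in_graph) as [A HA]; [gdef|].
  destruct (@comp M HM (fun n => exists o, admissible o /\ n = operation_code o)) as [I HI].
  { apply def_ex_operation; [intros []|intros []|]; simpl; gdef. }
  destruct (@comp M HM (fun z => exists n, n ∈ I /\ z = pair n 1)) as [N HN]; [gdef|].
  destruct (@comp M HM (fun z => exists o, admissible o /\ exists s x,
     entry s 0 x /\ z = pair (pair (operation_code o) s) (operate o x))) as [F HF].
  { apply def_ex_operation; [intros []|intros []|]; simpl; gdef. }
  exists A, I, N, F. auto.
Qed.

Variables A I N F : set.
Hypothesis HA : forall x, x ∈ A <-> in_graph x.
Hypothesis HI : forall n, n ∈ I <-> exists o, admissible o /\ n = operation_code o.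
Hypothesis HN : forall z, z ∈ N <-> exists n, n ∈ I /\ z = pair n 1.
Hypothesis HF : forall z, z ∈ F <-> exists o, admissible o /\ exists s x,
  entry s 0 x /\ z = pair (pair (operation_code o) s) (operate o x).

Lemma arity i n : pair i n ∈ N -> n = 1.
Proof. intro H. apply HN in H as (m & _ & E). now apply pair_inj in E as [_ E]. Qed.

Lemma graph_algebra : algebra A I N F.
Proof.
  split.
  - intros i Hi. exists 1. split; [apply HN; eauto|]. intros m. apply arity.
  - intros i Hi n s Hn [Hs HsA]. apply arity in Hn as ->.
    apply HI in Hi as (o & Ho & ->). destruct (seq_code_1 Hs) as [x Hx].
    exists (operate o x). split; [|split].
    + apply HA, operate_in_graph; auto. eapply HA, HsA, Hx.
    + apply HF. eauto 6.
    + intros z Hz. apply HF in Hz as (o' & _ & s' & x' & Hx' & E).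
      apply pair_inj in E as [E ->]. apply pair_inj in E as [E <-].
      apply operation_code_inj in E as <-. f_equal. eapply entry_unique; eauto.
Qed.

Definition pairs (theta : D -> D -> Prop) (n : D) : Prop :=
  exists x y, n = pair x y /\ theta x y.

Lemma pairs_pair theta x y : pairs theta (pair x y) <-> theta x y.
Proof.
  split; [|unfold pairs; eauto]. intros (x' & y' & E & H). now apply pair_inj in E as [-> ->].
Qed.

Lemma congruence_pairs theta : graph_congruence theta -> congruence A I N F (pairs theta).
Proof.
  intros (G1 & G2 & G3 & G4 & G5). split; [|split; [|split; [|split]]].
  - intros n (x & y & -> & H). exists x, y. destruct (G1 _ _ H) as [Hx Hy].
    rewrite !HA. auto.
  - intros a Ha. apply pairs_pair, G2, HA, Ha.
  - intros a b. rewrite !pairs_pair. auto.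
  - intros a b c. rewrite !pairs_pair. eauto.
  - intros i Hi n s t y z Hn [Hs _] [Ht _] He Hy Hz. apply arity in Hn as ->.
    apply HF in Hy as (o & Ho & s' & u & Hu & E).
    apply pair_inj in E as [E ->]. apply pair_inj in E as [-> <-].
    apply HF in Hz as (o' & _ & t' & v & Hv & E).
    apply pair_inj in E as [E ->]. apply pair_inj in E as [E <-].
    apply operation_code_inj in E as <-.
    apply pairs_pair, G5; auto. eapply pairs_pair, He; eauto.
Qed.

Lemma congruence_graph X : congruence A I N F X -> graph_congruence (fun x y => X (pair x y)).
Proof.
  intros (C1 & C2 & C3 & C4 & C5). split; [|split; [|split; [|split]]]; auto.
  - intros x y H. apply C1 in H as (a & b & Ha & Hb & E). apply pair_inj in E as [-> ->].
    rewrite <- !HA. auto.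
  - intros x Hx. apply C2, HA, Hx.
  - intros o x y Ho H.
    assert (G : in_graph x /\ in_graph y).
    { apply C1 in H as (a & b & Ha & Hb & E). apply pair_inj in E as [-> ->].
      rewrite <- !HA. auto. }
    destruct (singleton_code x) as (s & Hs & Hx), (singleton_code y) as (t & Ht & Hy).
    apply (C5 (operation_code o)) with (n := 1) (s := s) (t := t).
    + apply HI. eauto.
    + apply HN. exists (operation_code o). split; auto. apply HI. eauto.
    + split; auto. intros i u Hu. rewrite (entry_fun Hs Hu Hx). now apply HA.
    + split; auto. intros i u Hu. rewrite (entry_fun Ht Hu Hy). now apply HA.
    + intros j u v Hu Hv. now rewrite (entry_fun Hs Hu Hx), (entry_fun Ht Hv Hy).
    + apply HF. eauto 6.
    + apply HF. eauto 6.
Qed.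

End GraphAlgebra.

(** * The representation *)

Section Representation.
Context {M : model} {HM : ACA M}.
Local Open Scope num_scope.
Notation D := (num M).
Notation set := (sets M).
Variables L R K : set.
Hypothesis alg : algebraic L R.
Hypothesis HK : forall a, a ∈ K <-> compact L R a.
Notation "x ⊑ y" := (below R x y) (at level 70).
Hint Resolve def2_below : def.
Hint Extern 1 (deff2 (join L R)) => apply (deff2_join alg) : def.

Definition bottom : D := the (is_sup L R (fun _ => False)).

Lemma bottom_spec : is_sup L R (fun _ => False) bottom.
Proof.
  destruct (@sup_ex M HM L R alg (fun _ => False)) as [z Hz]; [ddef|tauto|].
  unfold bottom. rewrite (@the_eq M _ z); auto.
  intros. eapply is_sup_unique; eauto.
Qed.

Lemma bottom_in : bottom ∈ L.
Proof. apply bottom_spec. Qed.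

Lemma bottom_below x : x ∈ L -> bottom ⊑ x.
Proof. intro Hx. apply bottom_spec; auto. tauto. Qed.

(** The bottom element is not a colour: an edge of that colour would be contracted by every
    congruence. *)
Definition proper (a : D) : Prop := a ∈ K /\ a <> bottom.

Lemma proper_in a : proper a -> a ∈ L.
Proof. intros [H _]. apply HK in H. now apply compact_in with R. Qed.

#[local] Instance lattice_colouring : Colouring M.
Proof.
  refine {|
    colour := proper;
    ear := fun a b g => proper a /\ proper b /\ proper g /\ a ⊑ join L R b g;
    ideal := fun l a => l ∈ L /\ a ⊑ l |}.
  - unfold proper. ddef.
  - unfold proper. ddef.
  - ddef.
  - tauto.
  - intros l a b g (Ha & Hb & Hg & H) [Hl Hbl] [_ Hgl]. split; auto.
    apply proper_in in Ha, Hb, Hg.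
    apply (below_trans alg) with (join L R b g); auto using join_in, join_lub.
Defined.

Lemma bottom_or_proper a : a ∈ K -> a = bottom \/ proper a.
Proof. unfold proper. destruct (classic (a = bottom)); auto. Qed.

Section Ideal.
Variable theta : D -> D -> Prop.
Hypothesis def2_theta : def2 theta.
Hypothesis cong : graph_congruence theta.
Hint Resolve def2_theta : def.

Lemma def1_identified : def1 (identified theta).
Proof. unfold identified. gdef. Qed.
Hint Resolve def1_identified : def.

Lemma identified_below a b : proper a -> proper b -> identified theta b -> a ⊑ b ->
  identified theta a.
Proof.
  intros Ha Hb Ib H. apply (identified_ear cong (b := b) (g := b)); auto.
  change (proper a /\ proper b /\ proper b /\ a ⊑ join L R b b).
  repeat split; try apply Ha; try apply Hb.
  apply (below_trans alg) with b; auto using proper_in, join_in, join_l.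
Qed.

Lemma identified_join a b : proper a -> proper b -> identified theta a -> identified theta b ->
  proper (join L R a b) /\ identified theta (join L R a b).
Proof.
  intros Ha Hb Ia Ib. assert (La := proper_in Ha). assert (Lb := proper_in Hb).
  assert (P : proper (join L R a b)).
  { split.
    - apply HK, compact_join; auto; apply HK; [apply Ha|apply Hb].
    - intro E. apply (proj2 Ha). apply (below_antisym alg); auto using bottom_in, bottom_below.
      rewrite <- E. now apply join_l. }
  split; auto. apply (identified_ear cong (b := a) (g := b)); auto.
  change (proper (join L R a b) /\ proper a /\ proper b /\
          join L R a b ⊑ join L R a b).
  repeat split; try apply P; try apply Ha; try apply Hb. apply (below_refl alg).
  now apply join_in.
Qed.

(** The identified colours form an ideal, so a compact element below their supremum, being
    below a finite join of them, is one of them. *)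
Lemma identified_ideal : exists l, l ∈ L /\ forall c, proper c ->
  (c ⊑ l <-> identified theta c).
Proof.
  destruct (@comp M HM (fun a => proper a /\ identified theta a)) as [J HJ].
  { unfold proper. ddef. }
  assert (JL : forall n, n ∈ J -> n ∈ L) by (intros n Hn; apply HJ in Hn; now apply proper_in).
  destruct (@sup_ex M HM L R alg (fun n => n ∈ J)) as [l Hl]; [ddef|auto|].
  exists l. split; [apply Hl|]. intros c Hc. split.
  - intro H. assert (Cc : compact L R c) by apply HK, Hc.
    destruct (proj2 (proj1 (compact_iff alg c) Cc) J JL l Hl H) as (k & y & Hy & Hcy).
    assert (P : forall k y, is_sup L R (initial J k) y -> y = bottom \/ y ∈ J).
    { clear k y Hy Hcy. intros k. pattern k. apply induction.
      - unfold initial. unfold_order. ddef.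
      - intros y Hy. left. eapply (is_sup_unique alg); [exact Hy|].
        eapply is_sup_ext; [|exact bottom_spec]. intro n. unfold initial.
        split; [tauto|]. intros [_ Hn]. now apply not_lt0 in Hn.
      - clear k. intros k IH y Hy.
        destruct (@sup_ex M HM L R alg (initial J k)) as [x Hx];
          [unfold initial; ddef|intros n [Hn _]; auto|].
        destruct (classic (k ∈ J)) as [Hk|Hk].
        + assert (E : is_sup L R (initial J (k + 1)) (join L R x k)).
          { destruct Hx as (Lx & Ux & Vx). assert (Lk := JL k Hk).
            split; [now apply join_in|split].
            - intros s [Hs Hsk]. assert (Ls := JL s Hs). apply ltS in Hsk as [Hsk| ->].
              + apply (below_trans alg) with x; auto using join_in, join_l.
                apply Ux. split; auto.
              + now apply join_r.
            - intros u Lu Hu. apply join_lub; auto.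
              + apply Vx; auto. intros s [Hs Hsk]. apply Hu. split; auto. apply ltS. auto.
              + apply Hu. split; auto. apply lt_succ. }
          rewrite (is_sup_unique alg Hy E). right.
          assert (Pk := proj1 (HJ k) Hk).
          destruct (IH x Hx) as [->|Jx].
          * replace (join L R bottom k) with k; auto.
            assert (Lk := JL k Hk). assert (Lb := bottom_in).
            apply (below_antisym alg); auto using join_in, join_r, join_lub, bottom_below.
            apply join_lub; auto using bottom_below. now apply (below_refl alg).
          * apply HJ in Jx. apply HJ. apply identified_join; tauto.
        + apply IH. eapply is_sup_ext; [|exact Hy]. intro n. unfold initial. rewrite ltS.
          split; [|tauto]. intros [Hn [Hl'|Hl']]; auto. subst. tauto. }
    destruct (P k y Hy) as [->|Jy].
    + exfalso. apply (proj2 Hc). apply (below_antisym alg); auto using proper_in, bottom_in.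
      apply bottom_below. now apply proper_in.
    + apply HJ in Jy as [Py Iy]. now apply identified_below with y.
  - intro H. apply Hl. apply HJ. auto.
Qed.

End Ideal.

Definition norm (i : D) : D := if decide (i ∈ L) then i else bottom.

Lemma norm_in i : norm i ∈ L.
Proof. unfold norm. destruct (decide _); auto using bottom_in. Qed.

Lemma norm_id i : i ∈ L -> norm i = i.
Proof. intro H. unfold norm. destruct (decide _); tauto. Qed.

(** As the representative modulo [x] is also reached modulo [y], larger elements give larger
    congruences. *)
Lemma modulo_mono x y u v : x ∈ L -> y ∈ L -> x ⊑ y -> modulo x u v -> modulo y u v.
Proof.
  intros Lx Ly H (Gu & Gv & E).
  assert (C := modulo_congruence y).
  assert (Dm : def2 (modulo y)) by gdef.
  assert (T : forall w, in_graph w -> modulo y w (graph_rep x w)).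
  { intros w Gw. apply (theta_rep Dm C); auto.
    intros c Hc [_ Hcx]. apply modulo_edge; auto. split; auto.
    apply (below_trans alg) with x; auto. now apply proper_in. }
  apply (theta_trans C) with (graph_rep x u); auto.
  rewrite E. apply (theta_sym C). auto.
Qed.

(** The congruence that belongs to a number outside of [L] is that of the bottom element, so
    that the family is indexed by all the numbers. *)
Theorem representable_of_compact_set : representable L R.
Proof.
  destruct (graph_algebra_sets (M := M)) as (A & I & N & F & HA & HI & HN & HF).
  exists A, I, N, F. split; [eapply graph_algebra; eauto|].
  assert (Dn : deff1 norm) by (unfold norm; ddef).
  destruct (@comp M HM (fun z => exists i n, z = pair i n /\ pairs (modulo (norm i)) n))
    as [E HE]; [unfold pairs; gdef|].
  assert (ColE : forall i, col E i = pairs (modulo (norm i))).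
  { intro i. extensionality n. apply propositional_extensionality. unfold col. rewrite HE.
    split; [|eauto]. intros (i' & n' & E' & H). now apply pair_inj in E' as [-> ->]. }
  exists E. split; [|split].
  - intro i. rewrite ColE. apply (congruence_pairs HA HN HF). apply modulo_congruence.
  - intros X HX. assert (C := congruence_graph HA HI HN HF HX).
    assert (Dt : def2 (fun x y => pair x y ∈ X)) by ddef.
    destruct (identified_ideal Dt C) as (l & Ll & Hl).
    exists l. intro n. rewrite ColE, (norm_id Ll).
    assert (Q := congruence_modulo Dt C (l := l)).
    assert (Q' : forall x y, pair x y ∈ X <-> modulo l x y).
    { apply Q. intros c Hc. rewrite <- Hl by auto. simpl. tauto. }
    split.
    + intro Hn. destruct (proj1 HX n Hn) as (x & y & _ & _ & ->). apply pairs_pair, Q', Hn.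
    + intros (x & y & -> & H). now apply Q'.
  - destruct (@comp M HM (fun z => exists x, x ∈ L /\ z = pair x x)) as [P HP]; [ddef|].
    assert (HP' : forall x i, pair x i ∈ P <-> x ∈ L /\ i = x).
    { intros x i. rewrite HP. split.
      - intros (y & Hy & E'). now apply pair_inj in E' as [-> ->].
      - intros [Hx ->]. eauto. }
    exists P. split; [|split].
    + intros x Hx. exists x. split; [apply HP'; auto|]. intros j Hj. now apply HP' in Hj.
    + intros x Lx y Ly i j Hi Hj. apply HP' in Hi as [_ ->], Hj as [_ ->].
      rewrite !ColE, !norm_id by auto. split.
      * intros H n (u & v & -> & Huv). apply pairs_pair. exact (modulo_mono Lx Ly H Huv).
      * intro H. apply (compact_gen alg); auto. intros c Hc Hcx.
        destruct (bottom_or_proper (proj2 (HK c) Hc)) as [->|Pc]; [now apply bottom_below|].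
        assert (S : modulo y 0 (vertex c 1)).
        { apply pairs_pair, H, pairs_pair, modulo_edge; simpl; auto. }
        apply modulo_edge in S; [apply S|exact Pc].
    + intro i. exists (norm i). split; [apply norm_in|]. exists (norm i).
      split; [apply HP'; auto using norm_in|].
      intro n. rewrite !ColE, (norm_id (norm_in i)). tauto.
Qed.

End Representation.

(** * Provability *)

Lemma proves_RCA0 T : subst_closed T ->
  (forall M, models M T -> (exists X : sets M, True) -> ACA M) -> proves_theory T RCA0.
Proof.
  intros HT H p Hp. apply completeness; auto. intros M HM r u.
  apply ACA_models_RCA0; auto. apply H; auto. now exists (u O).
Qed.

Theorem proposition5p14 : proves_theory Pi11CA0 GS /\ proves_theory ACA0 GSD.
Proof.
  split.
  - intros p [Hp| ->].
    + exact (@proves_RCA0 _ Pi11CA0_subst_closed Pi11CA0_model p Hp).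
    + apply completeness; [exact Pi11CA0_subst_closed|]. intros M HM r u.
      apply sat_GS. intros L R alg.
      assert (HA : ACA M) by (apply Pi11CA0_model; auto; now exists (u O)).
      destruct (Pi11_compact_set alg) as [K HK].
      * intros q Hq. apply sat_comprehension. intros r' u'. apply HM. now apply Pi11CA0_comp.
      * now apply (representable_of_compact_set alg HK).
  - intros p [Hp| ->].
    + exact (@proves_RCA0 _ ACA0_subst_closed ACA0_model p Hp).
    + apply completeness; [exact ACA0_subst_closed|]. intros M HM r u.
      apply sat_GSD. intros L R [alg distr].
      assert (HA : ACA M) by (apply ACA0_model; auto; now exists (u O)).
      destruct (distributive_compact_set alg distr) as [K HK].
      now apply (representable_of_compact_set alg HK).
Qed.
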